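(* Let $d\ge 2$ and let $\Sigma$ be a compact metric space. Let $\mathfrak{C}_d(\Sigma)$ be the set of all random cocycles $(A,\mu)\in C(\Sigma,\mathrm{GL}_d(\mathbb{R}))\times\mathrm{Prob}(\Sigma)$ such that $(A,\mu)$ is quasi-irreducible and $L_1(A,\mu)>L_2(A,\mu)$. Then the function $L_1\colon \mathfrak{C}_d(\Sigma)\to\mathbb{R}$, $(A,\mu)\mapsto L_1(A,\mu)$, satisfies: (1) $L_1$ is locally Hölder continuous with respect to the metrics $d_\infty$ and $d$; that is, every $(A_0,\mu_0)\in\mathfrak{C}_d(\Sigma)$ has a neighbourhood $U$ in $\mathfrak{C}_d(\Sigma)$ and constants $C>0$, $\alpha\in(0,1]$ such that $|L_1(A,\mu)-L_1(B,\nu)|\le C\,\big(d_\infty(A,B)+d(\mu,\nu)\big)^\alpha$ for all $(A,\mu),(B,\nu)\in U$. (2) $L_1$ is locally Lipschitz continuous in the variable $\mu$ with respect to $d$; that is, every $(A_0,\mu_0)\in\mathfrak{C}_d(\Sigma)$ has a neighbourhood $U$ in $\mathfrak{C}_d(\Sigma)$ and a constant $C>0$ such that $|L_1(A,\mu_1)-L_1(A,\mu_2)|\le C\,d(\mu_1,\mu_2)$ for all $(A,\mu_1),(A,\mu_2)\in U$.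
   Context: $C(\Sigma,\mathrm{GL}_d(\mathbb{R}))$ is the space of continuous maps $A\colon\Sigma\to\mathrm{GL}_d(\mathbb{R})$ with the distance $d_\infty(A,B)=\max_{x\in\Sigma}\|A(x)-B(x)\|$ (operator norm for the Euclidean norm). $\mathrm{Prob}(\Sigma)$ is the set of Borel probability measures on $\Sigma$ with the distance $d(\mu_1,\mu_2)=\|\mu_1-\mu_2\|$, where $\|\cdot\|$ is the total variation of a signed measure. Neighbourhoods in $\mathfrak{C}_d(\Sigma)$ are taken in the topology induced by the product of these two metrics. A random cocycle is a pair $(A,\mu)\in C(\Sigma,\mathrm{GL}_d(\mathbb{R}))\times \mathrm{Prob}(\Sigma)$. Let $\omega=(\omega_n)_{n\in\mathbb{Z}}\in\Sigma^{\mathbb{Z}}$ be distributed according to the product measure $\mathbb{P}_\mu=\mu^{\mathbb{Z}}$, and $A^n(\omega)=A(\omega_{n-1})\cdots A(\omega_1)A(\omega_0)$ for $n\ge1$. The Lyapunov exponents of $(A,\mu)$ are the $\mathbb{P}_\mu$-almost sure (constant) limits $L_i(A,\mu)=\lim_{n\to\infty}\frac1n\log s_i(A^n(\omega))$, $1\le i\le d$, where $s_1(M)\ge\dots\ge s_d(M)$ denote the singular values of $M$. In particular $L_1(A,\mu)=\lim_{n\to\infty}\frac1n\log\|A^n(\omega)\|$. The cocycle $(A,\mu)$ is quasi-irreducible if there is no non-zero proper linear subspace $V\subset\mathbb{R}^d$ such that $A(x)V=V$ for $\mu$-a.e. $x\in\Sigma$ and $L_1(A|_V)\le L_2(A,\mu)$,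 where $L_1(A|_V)$ is the $\mathbb{P}_\mu$-almost sure limit $\lim_{n\to\infty}\frac1n\log\|A^n(\omega)|_V\|$. *)

(* Defs.v *)
From HB Require Import structures.
From mathcomp Require Import all_boot all_order all_algebra.
From mathcomp Require Import all_classical all_reals all_analysis.
From mathcomp Require polyrcf.

Set Implicit Arguments.
Unset Strict Implicit.
Unset Printing Implicit Defensive.

Import Order.TTheory GRing.Theory Num.Theory.
Import numFieldNormedType.Exports.

Local Open Scope classical_set_scope.
Local Open Scope ring_scope.

(* Nonempty metric spaces: MathComp-Analysis only puts sigma-algebras on
   pointed types. On the empty space there is no probability measure, hence
   no random cocycle. *)
#[short(type="pmetricType")]
HB.structure Definition PointedMetric (K : numDomainType) :=
  {M of Pointed M & Metric K M}.

Section linear_algebra.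
Context {R : realType} {d : nat}.
Implicit Types (M : 'M[R]_d) (V : {vspace 'cV[R]_d}).

(* The library norm on matrices is the sup norm. *)
Definition enorm (v : 'cV[R]_d) : R := Num.sqrt (\sum_i (v i 0) ^+ 2).

Definition opnorm_on V M : R :=
  sup [set enorm (M *m v) | v in [set v | v \in V /\ enorm v <= 1]].

Definition opnorm M : R := opnorm_on fullv M.

(* Square roots of the eigenvalues of M^T M, repeated according to
   multiplicity. *)
Definition singular_values M : seq R :=
  let p := char_poly (M^T *m M) in
  sort >=%R [seq Num.sqrt x
    | x <- flatten [seq nseq (mup x p) x | x <- polyrcf.rootsR p]].

(* Numbered from 1: [singular_value M 1] is the largest one. *)
Definition singular_value M (i : nat) : R := (singular_values M)`_i.-1.

End linear_algebra.

Section total_variation.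
Context {R : realType} d (T : measurableType d).

Definition total_variation (nu : {charge set T -> \bar R}) : R :=
  let P_ex := cid (Hahn_decomposition nu) in
  let N_ex := cid (svalP P_ex) in
  fine (charge_variation (svalP N_ex) setT).

Definition dist_tv (mu1 mu2 : probability T R) : R :=
  total_variation (cadd (charge_of_finite_measure mu1)
                        (copp (charge_of_finite_measure mu2))).

End total_variation.

Section bernoulli_shift.
Context {R : realType} (Sigma : pmetricType R).

Definition borel := g_sigma_algebraType (@open Sigma).

Definition coordinate_sets : set (set (int -> borel)) :=
  \bigcup_(i in [set: int])
    preimage_set_system setT (fun omega : int -> borel => omega i) measurable.

Definition shift_space := g_sigma_algebraType coordinate_sets.

Definition is_product_measure (mu : probability borel R)
    (P : probability shift_space R) : Prop :=
  forall (s : seq int) (E : int -> set borel), uniq s ->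
    (forall i, measurable (E i)) ->
    P [set omega | forall i, i \in s -> E i (omega i)] =
    (\prod_(i <- s) mu (E i))%E.

(* The library has no infinite product measures: mu^Z is the unique
   probability with the product values on cylinders; the Dirac mass is a
   dummy default. *)
Definition product_measure (mu : probability borel R) :
    probability shift_space R :=
  xget (\d_(point : shift_space) : probability shift_space R)
    [set P | is_product_measure mu P].

End bernoulli_shift.

Section random_cocycles.
Context {R : realType} (d : nat) (Sigma : pmetricType R).

Record GLmap := MkGLmap {
  GLmap_fun :> Sigma -> 'M[R]_d ;
  GLmap_continuous : continuous GLmap_fun ;
  GLmap_unit : forall x, GLmap_fun x \in unitmx }.

Definition dist_sup (A B : GLmap) : R :=
  sup (range (fun x => opnorm (A x - B x))).

Definition cocycle : Type := (GLmap * probability (borel Sigma) R)%type.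

Fixpoint iterate (A : GLmap) (omega : int -> Sigma) (n : nat) : 'M[R]_d :=
  if n is k.+1 then A (omega k%:Z) *m iterate A omega k else 1%:M.

Definition as_limit (mu : probability (borel Sigma) R)
    (u : (int -> Sigma) -> nat -> R) (l : R) : Prop :=
  {ae product_measure mu, forall omega, u omega n @[n --> \oo] --> l}.

(* The Lyapunov exponents below are almost sure limits; 0 is the dummy value
   in case there is no limit. *)
Definition lyapunov (c : cocycle) (i : nat) : R :=
  xget 0 [set l | as_limit c.2 (fun omega n =>
    n%:R^-1 * ln (singular_value (iterate c.1 omega n) i)) l].

Definition lyapunov_on (c : cocycle) (V : {vspace 'cV[R]_d}) : R :=
  xget 0 [set l | as_limit c.2 (fun omega n =>
    n%:R^-1 * ln (opnorm_on V (iterate c.1 omega n))) l].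

Definition quasi_irreducible (c : cocycle) : Prop :=
  ~ exists V : {vspace 'cV[R]_d},
      [/\ V != 0%VS, V != fullv,
          {ae c.2, forall x, (linfun (mulmx (c.1 x)) @: V)%VS = V}
        & lyapunov_on c V <= lyapunov c 2].

Definition frakC : set cocycle :=
  [set c | quasi_irreducible c /\ lyapunov c 2 < lyapunov c 1].

(* Neighbourhoods of c0 in the subspace [frakC]. *)
Definition frakC_nbhs (c0 : cocycle) (U : set cocycle) : Prop :=
  U `<=` frakC /\
  exists2 r : R, 0 < r &
    [set c | [/\ frakC c, dist_sup c.1 c0.1 < r & dist_tv c.2 c0.2 < r]]
      `<=` U.

End random_cocycles.

(* Main.v *)
(* Let a_n(v) be the expectation of ln (|A^n v| / |v|). A vector whose growth
   rate is below L_1 almost surely grows at rate at most L_2, by the gap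
   L_1 > L_2 (an elementary form of Oseledets' dichotomy); such vectors form an
   invariant subspace, which quasi-irreducibility forbids. By compactness of
   the sphere, a_n(v) / n therefore tends to L_1 uniformly in v. Hence for some
   m the expectation of ln (s_1 s_2 (A^m)) - 2 ln (|A^m v| / |v|) is at most
   -1 for all v; this is an open condition on the cocycle, and it makes A^m
   contract the power alpha of the sine of angles in expectation, uniformly on
   a neighbourhood. So the functions a_n are alpha-Hoelder in the direction of
   v, uniformly in n. Conditioning on the first step, one compares the a_n of
   two nearby cocycles: the errors add up to at most n times the error of one
   step, which is linear in the total variation distance and Hoelder in the
   distance of the matrices. Dividing by n and letting n tend to infinity gives
   both estimates. *)

From HB Require Import structures.
Require Import Defs.
From mathcomp Require Import all_boot all_order all_algebra.
From mathcomp Require Import all_classical all_reals all_analysis.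
From mathcomp Require Import measurable_realfun ring lra zify.
From mathcomp Require Import spectral complex.
From mathcomp Require polyrcf.

Set Implicit Arguments.
Unset Strict Implicit.
Unset Printing Implicit Defensive.

Import Order.TTheory GRing.Theory Num.Theory.
Import numFieldNormedType.Exports.

Local Open Scope classical_set_scope.
Local Open Scope ring_scope.

(** * Infinite products of probability measures *)

(** The exponents of the statement are chosen almost sure limits with a default value, so their
    existence must be proved; this rests on a construction of the product measure without topology
    on the base. Singular values enter only through two Frobenius norms, that of a matrix and that
    of its second exterior power. Up to a factor [d] they are s_1 and s_1 s_2, so they have the same
    rates, and they are submultiplicative with squares polynomial in the entries. In the comparison
    the obstacle is that a_n has size n: comparing integrals of a_n naively would cost order n at
    each of n steps. The Hoelder bound, which does not depend on n, says that a_n varies by a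
    bounded amount over all directions. After subtraction of a constant, each change of law
    therefore costs a bounded multiple of the total variation distance, which is why the dependence
    on the measure is Lipschitz. The Hoelder exponent enters only where two matrices send one vector
    to different directions. It is the small t for which E exp(t f) is governed by the linear term t
    E f, with f the logarithm of the contraction ratio. *)

Definition coord_sets (I : Type) d (T : measurableType d) : set (set (I -> T)) :=
  \bigcup_(i in [set: I])
    preimage_set_system setT (fun w : I -> T => w i) measurable.

(** For [I := int] and [T := borel Sigma] this is [shift_space] up to conversion, so results over an
    abstract base apply to the measure of the statement. *)
Definition prodT (I : Type) d (T : measurableType d) :=
  g_sigma_algebraType (@coord_sets I d T).

Section prodT_measurability.
Context (I : choiceType) d (T : measurableType d).

Lemma measurable_coord (i : I) :
  measurable_fun setT (fun w : prodT I T => w i).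
Proof.
move=> _ B mB; apply: sub_sigma_algebra; exists i => //.
by exists B.
Qed.

Lemma measurable_fun_prodT d' (S : measurableType d') (F : S -> prodT I T) :
  (forall i, measurable_fun setT (fun s => F s i)) -> measurable_fun setT F.
Proof.
move=> mF; apply: (@measurability _ _ S (prodT I T) setT F (@coord_sets I d T)) => //.
move=> _ [_ [i _ [B mB <-]] <-].
rewrite setTI setTI; have := mF i measurableT B mB; rewrite setTI.
by [].
Qed.

End prodT_measurability.

Section prodT_unique.
Context (I : choiceType) d (T : measurableType d) (R : realType).
Implicit Types P Q : probability (prodT I T) R.

Definition cylinder (s : seq I) (E : I -> set T) : set (prodT I T) :=
  [set w | forall i, i \in s -> E i (w i)].

Lemma measurable_cylinder s E : (forall i, measurable (E i)) ->
  measurable (cylinder s E).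
Proof.
move=> mE.
have -> : cylinder s E = \bigcap_(i in [set` s]) ((fun w : prodT I T => w i) @^-1` E i).
  by apply/seteqP; split => w; [move=> h i /= /h | move=> h i /h].
apply: fin_bigcap_measurable; first exact: finite_seq.
move=> i _; rewrite -[X in measurable X]setTI.
exact: measurable_coord.
Qed.

Lemma cylinderI s1 s2 E1 E2 : cylinder s1 E1 `&` cylinder s2 E2 =
  cylinder (undup (s1 ++ s2)) (fun i => (if i \in s1 then E1 i else setT) `&`
     (if i \in s2 then E2 i else setT)).
Proof.
apply/seteqP; split => w.
  move=> [h1 h2] i _; split; case: ifPn => // h; [exact: h1|exact: h2].
move=> h; split => i hi.
  by have := h i; rewrite mem_undup mem_cat hi => /(_ isT) [].
by have := h i; rewrite mem_undup mem_cat hi orbT => /(_ isT) [].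
Qed.

(** Cylinders generate the sigma-algebra, are stable under finite intersection and include the whole
    space. *)
Lemma probability_cylinder_unique P Q :
  (forall s E, uniq s -> (forall i, measurable (E i)) ->
    P (cylinder s E) = Q (cylinder s E)) ->
  forall A, measurable A -> P A = Q A.
Proof.
move=> PQ A mA.
pose G : set (set (prodT I T)) := [set C | exists s E, [/\ uniq s,
  (forall i, measurable (E i)) & C = cylinder s E]].
apply: (measure_unique G (fun=> setT)) => //.
- apply/seteqP; split.
    apply: smallest_sub; first exact: smallest_sigma_algebra.
    move=> _ [i _ [B mB <-]]; apply: sub_sigma_algebra.
    exists [:: i], (fun=> B); split => //.
    rewrite setTI; apply/seteqP; split => w /=.
      by move=> h j; rewrite inE => /eqP ->.
    by apply; rewrite inE.
  apply: smallest_sub; first exact: smallest_sigma_algebra.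
  by move=> _ [s [E [us mE ->]]]; exact: measurable_cylinder.
- move=> _ _ [s1 [E1 [us1 mE1 ->]]] [s2 [E2 [us2 mE2 ->]]].
  rewrite cylinderI; exists (undup (s1 ++ s2)).
  exists (fun i => (if i \in s1 then E1 i else setT) `&`
     (if i \in s2 then E2 i else setT)); split => //; first exact: undup_uniq.
  by move=> i; apply: measurableI; case: ifPn.
- move=> _; exists [::], (fun=> setT); split => //.
  by apply/seteqP; split.
- by rewrite bigcup_const.
- by move=> _ [s [E [us mE ->]]]; exact: PQ.
- move=> _. apply: (@le_lt_trans _ _ 1%E); last exact: ltry.
  exact: probability_le1.
Qed.

End prodT_unique.

Section probability_constructions.
Context d (X : measurableType d) (R : realType).

(** Normalizing a measure of mass one leaves it unchanged and returns a bundled probability; the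
    Dirac mass only fills the default case of [mnormalize]. *)
Lemma probability_of_measure (m : {measure set X -> \bar R}) : m setT = 1%E ->
  exists Q : probability X R, forall A, Q A = m A.
Proof.
move=> m1.
exists (mnormalize m (\d_(point : X) : probability X R)) => A.
by rewrite /= /mnormalize m1 onee_eq0/= invr1 mule1.
Qed.

Lemma probability_image d' (Y : measurableType d') (P : probability X R) (f : X -> Y) :
  measurable_fun setT f ->
  exists Q : probability Y R, forall A, Q A = P (f @^-1` A).
Proof.
move=> mf.
pose F : {mfun X >-> Y} := HB.pack f (isMeasurableFun.Build _ _ _ _ f mf).
by exists (distribution P F).
Qed.

End probability_constructions.

Section infinite_product.
Context d (T : measurableType d) (R : realType) (mu : probability T R).
Local Open Scope ereal_scope.
Local Notation Om := (prodT nat T).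

Definition upd (w : Om) (n : nat) (x : T) : Om :=
  fun i => if i == n then x else w i.

Lemma measurable_upd n :
  measurable_fun setT (fun p : Om * T => upd p.1 n p.2).
Proof.
apply: measurable_fun_prodT => i; rewrite /upd.
case: eqP => _; first exact: measurable_snd.
apply: (@measurableT_comp _ _ _ _ _ _ (fun w : Om => w i)) => //.
exact: measurable_coord.
Qed.

Lemma measurable_upd1 w n : measurable_fun setT (upd w n).
Proof.
apply: measurable_fun_prodT => i; rewrite /upd.
by case: eqP => _.
Qed.

(** The integrated coordinate remains as a formal argument. All functions thus live on one space of
    sequences, and no isomorphisms between finite products appear. *)
Definition resample (n : nat) (f : Om -> \bar R) (w : Om) : \bar R :=
  \int[mu]_x f (upd w n x).

Definition nnmeas (f : Om -> \bar R) :=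
  measurable_fun setT f /\ (forall w, 0 <= f w).

Lemma resample_nnmeas n f : nnmeas f -> nnmeas (resample n f).
Proof.
move=> [mf f0]; split; last by move=> w; apply: integral_ge0 => x _.
apply: (measurable_fun_fubini_tonelli_F (fun p : Om * T => f (upd p.1 n p.2))).
- by apply: (measurableT_comp mf); exact: measurable_upd.
- by move=> p; exact: f0.
Qed.

(* [expect_from f m k] integrates out the coordinates [m, ..., m + k - 1]. *)
Fixpoint expect_from (f : Om -> \bar R) (m k : nat) : Om -> \bar R :=
  if k is k'.+1 then resample m (expect_from f m.+1 k') else f.

Lemma expect_from_nnmeas f m k : nnmeas f -> nnmeas (expect_from f m k).
Proof.
by move=> nf; elim: k m => [|k IH] m //=; apply: resample_nnmeas.
Qed.

Lemma measurable_updf f w n : nnmeas f -> measurable_fun setT (fun x => f (upd w n x)).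
Proof. by move=> [mf _]; apply: (measurableT_comp mf); exact: measurable_upd1. Qed.

Definition determined (n : nat) (f : Om -> \bar R) :=
  forall w w' : Om, (forall i, (i < n)%N -> w i = w' i) -> f w = f w'.

Lemma determined_resample n m f : determined n f -> determined n (resample m f).
Proof.
move=> df w w' ww'; apply: eq_integral => x _; apply: df => i /ww'.
by rewrite /upd; case: eqP.
Qed.

Lemma determined_resampleS n f : determined n.+1 f -> determined n (resample n f).
Proof.
move=> df w w' ww'; apply: eq_integral => x _; apply: df => i.
by rewrite /upd ltnS leq_eqVlt; case: eqP => //= _ /ww'.
Qed.

Lemma determined_expect_from n f m k : (m <= n)%N -> (n <= m + k)%N ->
  determined n f -> determined m (expect_from f m k).
Proof.
move=> mn nmk df; elim: k m mn nmk => [|k IH] m mn nmk /=.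
  by rewrite addn0 in nmk; have -> : m = n by apply/eqP; rewrite eqn_leq mn.
move: mn; rewrite leq_eqVlt => /orP[/eqP mn|mn].
  apply: determined_resample; rewrite mn in nmk *; move: df; clear.
  elim: k (n.+1) => [|k IH] m df //=.
  by apply: determined_resample; exact: IH.
by apply: determined_resampleS; apply: IH => //; rewrite addSnnS.
Qed.

Lemma resample_id n m f : (n <= m)%N -> determined n f -> resample m f = f.
Proof.
move=> nm df; apply/funext => w; rewrite /resample.
rewrite (eq_integral (fun=> f w)); last first.
  move=> x _; apply: df => i ilt; rewrite /upd; case: eqP => // im.
  by move: ilt; rewrite im ltnNge nm.
transitivity (f w * mu setT); first exact: integral_cst.
by rewrite (probability_setT mu) mule1.
Qed.

Lemma expect_from_id n m k f : (n <= m)%N -> determined n f ->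
  expect_from f m k = f.
Proof.
move=> + df; elim: k m => [|k IH] m nm //=.
by rewrite IH ?(leq_trans nm)// (resample_id nm).
Qed.

Lemma expect_from_eq n f m k k' : determined n f -> (n <= m + k)%N ->
  (n <= m + k')%N -> expect_from f m k = expect_from f m k'.
Proof.
move=> df; elim: k k' m => [|k IH] k' m.
  by rewrite addn0 => nm _; rewrite [RHS](expect_from_id _ nm).
case: k' => [|k'] h h'; first by rewrite addn0 in h'; rewrite [LHS](expect_from_id _ h').
by rewrite /= (IH k')// addSnnS.
Qed.

Lemma expect_fromD f g m k : nnmeas f -> nnmeas g ->
  expect_from (f \+ g) m k = expect_from f m k \+ expect_from g m k.
Proof.
move=> nf ng; elim: k m => [|k IH] m //=.
rewrite IH; apply/funext => w; rewrite /resample /=.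
rewrite -ge0_integralD//.
- by move=> x _; apply: (expect_from_nnmeas m.+1 k nf).2.
- by apply: measurable_updf; exact: expect_from_nnmeas.
- by move=> x _; apply: (expect_from_nnmeas m.+1 k ng).2.
- by apply: measurable_updf; exact: expect_from_nnmeas.
Qed.

Lemma expect_from0 m k : expect_from (cst 0) m k = cst 0.
Proof. by apply: (@expect_from_id 0) => // w w'. Qed.

Definition indE (C : set Om) : Om -> \bar R := fun w => (\1_C w)%:E.

Lemma indE_nnmeas C : measurable C -> nnmeas (indE C).
Proof.
move=> mC; split; last by move=> w; rewrite lee_fin.
by apply/measurable_EFinP; exact: measurable_indic.
Qed.

Definition finite_dim : set (set Om) :=
  [set C | measurable C /\ exists n, determined n (indE C)].

Lemma determinedW n m f : (n <= m)%N -> determined n f -> determined m f.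
Proof. by move=> nm df w w' h; apply: df => i ilt; apply: h; exact: leq_trans nm. Qed.

Lemma finite_dim0 : finite_dim set0.
Proof. by split => //; exists 0%N => w w' _; rewrite /indE !indicE !in_set0. Qed.

Lemma finite_dimC C : finite_dim C -> finite_dim (~` C).
Proof.
move=> [mC [n dC]]; split; first exact: measurableC.
exists n => w w' h; have := dC _ _ h; rewrite /indE !indicE !in_setC => -[].
by case: (w \in C); case: (w' \in C) => //= /eqP; rewrite ?oner_eq0// eq_sym oner_eq0.
Qed.

Lemma finite_dimU C D : finite_dim C -> finite_dim D -> finite_dim (C `|` D).
Proof.
move=> [mC [n dC]] [mD [m dD]]; split; first exact: measurableU.
exists (maxn n m) => w w' h.
have := determinedW (leq_maxl n m) dC h; have := determinedW (leq_maxr n m) dD h.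
rewrite /indE !indicE !in_setU => -[] + [].
by case: (w \in C); case: (w' \in C); case: (w \in D); case: (w' \in D) => //= /eqP;
 rewrite ?oner_eq0// ?[_ == 1%R]eq_sym ?oner_eq0// => _ /eqP;
 rewrite ?oner_eq0// ?[_ == 1%R]eq_sym ?oner_eq0.
Qed.

(** A copy of the sequence space that carries the algebra of finite-dimensional sets; the extension
    theorem for measures starts from it. *)
Definition cyl_type := (nat -> T).
HB.instance Definition _ := Pointed.on cyl_type.
Definition cyl_display : measure_display. Proof. exact: default_measure_display. Qed.
HB.instance Definition _ := @isAlgebraOfSets.Build cyl_display cyl_type
  finite_dim finite_dim0 finite_dimU finite_dimC.

Definition dimof (C : set Om) : nat :=
  if pselect (exists n, determined n (indE C)) is left h then projT1 (cid h) else 0%N.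

Lemma dimofP C : finite_dim C -> determined (dimof C) (indE C).
Proof.
move=> [_ h]; rewrite /dimof; case: pselect => // h'.
by case: (cid h').
Qed.

(** The value at [point] is the value everywhere, since all coordinates on which [indE C] depends
    have been integrated out. *)
Definition precontent (C : set cyl_type) : \bar R :=
  expect_from (indE C) 0 (dimof C) point.

Lemma precontentE C n : finite_dim C -> (dimof C <= n)%N ->
  precontent C = expect_from (indE C) 0 n point.
Proof.
by move=> /dimofP dC h; rewrite /precontent (@expect_from_eq _ _ _ _ n dC).
Qed.

Lemma precontent0 : precontent set0 = 0.
Proof.
rewrite /precontent (_ : indE set0 = cst 0) ?expect_from0//.
by apply/funext => w; rewrite /indE indicE in_set0.
Qed.

Lemma precontent_ge0 C : 0 <= precontent C.
Proof.
have H : forall m k w, 0 <= expect_from (indE C) m k w.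
  move=> m k; elim: k m => [|k IH] m w /=; first by rewrite lee_fin.
  by apply: integral_ge0 => x _.
exact: H.
Qed.

Lemma precontent_additive2 : semi_additive2 (precontent : set cyl_type -> _).
Proof.
move=> A B mA mB mAB AB.
pose n := maxn (dimof A) (maxn (dimof B) (dimof (A `|` B))).
have -> := @precontentE A n mA (leq_maxl _ _).
have -> : precontent B = expect_from (indE B) 0 n point.
  by apply: precontentE => //; rewrite /n !leq_max leqnn orbT.
have -> : precontent (A `|` B) = expect_from (indE (A `|` B)) 0 n point.
  by apply: precontentE => //; rewrite /n !leq_max leqnn !orbT.
rewrite -[RHS]/((expect_from (indE A) 0 n \+ expect_from (indE B) 0 n) point).
rewrite -expect_fromD; last 2 first.
- by apply: indE_nnmeas; case: mA.
- by apply: indE_nnmeas; case: mB.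
congr (expect_from _ _ _ _); apply/funext => w; rewrite /indE /= -EFinD.
rewrite !indicE in_setU; congr (_%:E).
have : w \notin A `&` B by rewrite AB in_set0.
by rewrite in_setI; case: (w \in A); case: (w \in B) => //= _; rewrite ?addr0 ?add0r.
Qed.

Lemma precontent_additive :
  measure_function.semi_additive (precontent : set cyl_type -> _).
Proof.
rewrite additive2P; last exact: precontent0.
by rewrite -semi_additive2E; exact: precontent_additive2.
Qed.

HB.instance Definition _ := isContent.Build cyl_display cyl_type R precontent
  precontent_ge0 precontent_additive.

(** The conditional probability of [C] given the coordinates below [m]. Truncated subtraction makes
    it the indicator of [C] as soon as [m] reaches [dimof C]. *)
Definition cond_prob (C : set Om) (m : nat) : Om -> \bar R :=
  expect_from (indE C) m (dimof C - m).

Lemma cond_prob_nnmeas C m : finite_dim C -> nnmeas (cond_prob C m).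
Proof. by move=> [mC _]; apply: expect_from_nnmeas; exact: indE_nnmeas. Qed.

Lemma resample_cond_prob C m : finite_dim C ->
  resample m (cond_prob C m.+1) = cond_prob C m.
Proof.
move=> fC; rewrite /cond_prob; have [h|h] := ltnP m (dimof C).
  by rewrite -(subnSK h).
have -> : (dimof C - m.+1 = 0)%N by apply/eqP; rewrite subn_eq0 (leq_trans h).
have -> : (dimof C - m = 0)%N by apply/eqP; rewrite subn_eq0.
by rewrite /= (resample_id h)//; exact: dimofP.
Qed.

Lemma determined_cond_prob C m : finite_dim C -> determined m (cond_prob C m).
Proof.
move=> fC; rewrite /cond_prob; have [h|h] := leqP m (dimof C).
  by apply: (determined_expect_from h); [rewrite subnKC|exact: dimofP].
have -> : (dimof C - m = 0)%N by apply/eqP; rewrite subn_eq0 ltnW.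
by apply: (determinedW (ltnW h)); exact: dimofP.
Qed.

Lemma cond_prob_indE C m : (dimof C <= m)%N -> cond_prob C m = indE C.
Proof.
by move=> h; rewrite /cond_prob (_ : (_ - _ = 0)%N)//; apply/eqP; rewrite subn_eq0.
Qed.

Section sigma_subadditivity.
Variables (A : set Om) (F : (set Om)^nat).
Hypotheses (fA : finite_dim A) (fF : forall k, finite_dim (F k)).

Let S m w := \sum_(k <oo) cond_prob (F k) m w.

Lemma resample_series m w : \int[mu]_x S m.+1 (upd w m x) = S m w.
Proof.
rewrite /S integral_nneseries//; last first.
- by move=> k x _; apply: (cond_prob_nnmeas m.+1 (fF k)).2.
- by move=> k; apply: measurable_updf; exact: cond_prob_nnmeas.
by apply: eq_eseriesr => k _; rewrite -[in RHS]resample_cond_prob.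
Qed.

Lemma measurable_series m w : measurable_fun setT (fun x => S m (upd w m.-1 x)).
Proof.
apply: ge0_emeasurable_sum => k; first by move=> x _ _; apply: (cond_prob_nnmeas m (fF k)).2.
by move=> _; apply: measurable_updf; exact: cond_prob_nnmeas.
Qed.

(** If the reverse inequality held for every [x], integration over coordinate [m] would give it for
    [w]. *)
Lemma extend_coordinate m w : S m w < cond_prob A m w ->
  exists x, S m.+1 (upd w m x) < cond_prob A m.+1 (upd w m x).
Proof.
move=> h; apply: contrapT => /forallNP H; move: h; apply/negP; rewrite -leNgt.
rewrite -resample_series -resample_cond_prob//.
apply: ge0_le_integral => //.
- by move=> x _; apply: (cond_prob_nnmeas m.+1 fA).2.
- by apply: measurable_updf; exact: cond_prob_nnmeas.
- exact: (measurable_series m.+1).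
- by move=> x _; rewrite leNgt; apply/negP; exact: H.
Qed.

(** The argument of Ionescu-Tulcea, which replaces compactness. If [A] had more mass than the cover,
    coordinates could be chosen one after the other so that its conditional probability always
    exceeds the sum of the others. The resulting sequence lies in [A] but in no [F k]. *)
Lemma precontent_subadditive : A `<=` \bigcup_k F k ->
  precontent A <= \sum_(k <oo) precontent (F k).
Proof.
move=> AF; rewrite leNgt; apply/negP => h0.
have [f fP] : {f : nat -> Om -> T & forall m w, S m w < cond_prob A m w ->
    S m.+1 (upd w m (f m w)) < cond_prob A m.+1 (upd w m (f m w))}.
  apply: (@choice _ _ (fun m (g : Om -> T) => forall w, S m w < cond_prob A m w ->
    S m.+1 (upd w m (g w)) < cond_prob A m.+1 (upd w m (g w)))) => m.
  suff [g gP] : {g : Om -> T & forall w, S m w < cond_prob A m w ->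
      S m.+1 (upd w m (g w)) < cond_prob A m.+1 (upd w m (g w))} by exists g.
  apply: (@choice _ _ (fun w x => S m w < cond_prob A m w ->
    S m.+1 (upd w m x) < cond_prob A m.+1 (upd w m x))) => w.
  have [h|h] := pselect (S m w < cond_prob A m w); last by exists point => /h.
  by have [x hx] := extend_coordinate h; exists x.
pose W := fix W m : Om := if m is k.+1 then upd (W k) k (f k (W k)) else point.
have W_inv m : S m (W m) < cond_prob A m (W m).
  elim: m => [|m IH]; last exact: fP.
  move: h0; rewrite /precontent /S /cond_prob subn0.
  by under eq_eseriesr do rewrite -(subn0 (dimof (F _))).
(* Coordinate [i] is set at stage [i.+1] and never changed afterwards. *)
pose w : Om := fun i => W i.+1 i.
have Ww m i : (i < m)%N -> W m i = w i.
  elim: m => // m IH; rewrite ltnS leq_eqVlt => /orP[/eqP ->//|im].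
  by rewrite /= /upd; case: eqP => [im'|_]; [rewrite im' ltnn in im|exact: IH].
have cpw C m : finite_dim C -> cond_prob C m (W m) = cond_prob C m w.
  by move=> fC; apply: determined_cond_prob => // i; exact: Ww.
have S_inv m : S m w < cond_prob A m w.
  have := W_inv m; rewrite cpw// /S.
  by under eq_eseriesr do rewrite cpw//.
have S_ge0 m : 0 <= S m w.
  by apply: nneseries_ge0 => k _ _; apply: (cond_prob_nnmeas m (fF k)).2.
have Aw : A w.
  have := le_lt_trans (S_ge0 _) (S_inv (dimof A)).
  rewrite cond_prob_indE// /indE indicE lte_fin.
  by case: (boolP (w \in A)) => [/set_mem//|]; rewrite ltxx.
have [k _ Fkw] := AF _ Aw.
(* From this [m] on, the conditional probabilities of [A] and [F k] are indicators, both equal to 1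
   at [w]; hence 1 <= [S m w] < 1. *)
pose m := maxn (dimof A) (dimof (F k)).
have : 1 <= S m w.
  apply: le_trans (nneseries_lim_ge k.+1 _); last first.
    by move=> j _ _; apply: (cond_prob_nnmeas m (fF j)).2.
  rewrite big_nat_recr//= (_ : cond_prob (F k) m w = 1); last first.
    by rewrite (cond_prob_indE (leq_maxr _ _)) /indE indicE mem_set.
  by rewrite leeDr//; apply: sume_ge0 => j _; apply: (cond_prob_nnmeas m (fF j)).2.
apply/negP; rewrite -ltNge; apply: lt_le_trans (S_inv m) _.
by rewrite cond_prob_indE ?leq_maxl// /indE lee_fin indicE; case: (_ \in _).
Qed.

End sigma_subadditivity.

Lemma precontent_sigma_subadditive :
  measurable_subset_sigma_subadditive (precontent : set cyl_type -> _).
Proof. by move=> A F fF fA; exact: precontent_subadditive. Qed.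

HB.instance Definition _ := Content_SigmaSubAdditive_isMeasure.Build
  cyl_display R cyl_type precontent precontent_sigma_subadditive.

Definition box (D : nat -> set T) (m n : nat) : set Om :=
  [set w | forall j, (m <= j < n)%N -> D j (w j)].

Lemma measurable_box D m n : (forall j, measurable (D j)) -> measurable (box D m n).
Proof.
move=> mD; rewrite (_ : box D m n = cylinder (index_iota m n) D); last first.
  apply/seteqP; split => w h j; have := h j; by rewrite mem_index_iota.
exact: measurable_cylinder.
Qed.

Lemma finite_dim_box D m n : (forall j, measurable (D j)) -> finite_dim (box D m n).
Proof.
move=> mD; split; first exact: measurable_box.
exists n => w w' h; rewrite /indE !indicE; congr (_%:R%:E); congr nat_of_bool.
by apply/idP/idP => /set_mem H; apply/mem_set => j hj; have := H j hj; rewrite h//;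
  case/andP: hj.
Qed.

(** Keeping the coordinates below [m] free is what lets the induction on [k] pass through one
    integration. *)
Lemma expect_box D m k w : (forall j, measurable (D j)) ->
  expect_from (indE (box D 0 (m + k))) m k w =
  indE (box D 0 m) w * (\prod_(m <= j < m + k) mu (D j)).
Proof.
move=> mD; elim: k m w => [|k IH] m w; first by rewrite addn0 big_geq//= mule1.
rewrite /= /resample -addSnnS.
have boxS x : indE (box D 0 m.+1) (upd w m x) = indE (box D 0 m) w * (\1_(D m) x)%:E.
  rewrite /indE -EFinM !indicE -natrM mulnb; congr (_%:R%:E); congr nat_of_bool.
  apply/idP/andP => [/set_mem h|[/set_mem h /set_mem Dx]].
    split; apply/mem_set.
      move=> j /andP[_ jm]; have := h j; rewrite /upd ltnS leq0n (ltnW jm) => /(_ isT).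
      by case: eqP => [jm'|//]; rewrite jm' ltnn in jm.
    by have := h m; rewrite /upd ltnSn eqxx => /(_ isT).
  apply/mem_set => j; rewrite leq0n andTb ltnS leq_eqVlt /upd.
  by case: eqP => [->//|/= _ jm]; exact: h.
under eq_integral do rewrite IH boxS.
rewrite [in RHS]big_ltn; last by rewrite addSn ltnS leq_addr.
set p := \prod_(_ <= _ < _) _.
have p0 : 0 <= p by apply: prode_ge0 => j _.
transitivity (\int[mu]_x (indE (box D 0 m) w * p * (\1_(D m) x)%:E)).
  by apply: eq_integral => x _; rewrite muleAC.
rewrite ge0_integralZl//.
- by rewrite integral_indic// setIT -muleA [p * _]muleC.
- by apply/measurable_EFinP; exact: measurable_indic.
- by apply: mule_ge0 => //; rewrite /indE lee_fin.
Qed.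

Lemma precontent_box D n : (forall j, measurable (D j)) ->
  precontent (box D 0 n) = \prod_(0 <= j < n) mu (D j).
Proof.
move=> mD; pose N := maxn n (dimof (box D 0 n)).
rewrite (@precontentE _ (n + N)%N); last 2 first.
- exact: finite_dim_box.
- by rewrite (leq_trans _ (leq_addl _ _))// leq_maxr.
rewrite (@expect_from_eq n _ _ _ n); last 3 first.
- move=> w w' h; rewrite /indE !indicE; congr (_%:R%:E); congr nat_of_bool.
  by apply/idP/idP => /set_mem H; apply/mem_set => j hj; have := H j hj; rewrite h.
- by rewrite add0n leq_addr.
- by rewrite add0n.
have := @expect_box D 0 n point mD; rewrite add0n => ->.
by rewrite /indE indicE mem_set ?mul1e// => j; rewrite ltn0 andbF.
Qed.

Section embed.
Variables (I : choiceType) (phi : I -> nat) (phi_inj : injective phi).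

Local Notation X := (g_sigma_algebraType (@measurable _ cyl_type)).

Definition embed (w : X) : prodT I T := fun i => w (phi i).

Lemma measurable_embed : measurable_fun setT embed.
Proof.
apply: (@measurability _ _ X (prodT I T) setT embed (@coord_sets I d T)) => //.
move=> _ [_ [i _ [B mB <-]] <-]; rewrite !setTI.
apply: sub_sigma_algebra; split.
  rewrite -[X in measurable X]setTI; exact: (@measurable_coord _ _ _ (phi i)).
exists (phi i).+1 => w w' h; rewrite /indE !indicE; congr (_%:R%:E); congr nat_of_bool.
by apply/idP/idP => /set_mem H; apply/mem_set; move: H; rewrite /embed /= h.
Qed.

(** The measure is extended on sequences indexed by [nat] and carried to [I] by reindexing along
    [phi]. *)
Lemma iid_exists : exists P : probability (prodT I T) R, forall s E, uniq s ->
  (forall i, measurable (E i)) -> P (cylinder s E) = \prod_(i <- s) mu (E i).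
Proof.
have ext C : finite_dim C -> measure_extension precontent C = precontent C.
  by move=> fC; exact: measurable_mu_extE.
have fT : finite_dim setT by exact: (@measurableT _ cyl_type).
have eT : measure_extension precontent setT = 1.
  rewrite ext// -[setT]setCK setCT.
  have -> : ~` set0 = box (fun=> setT) 0 0 by apply/seteqP; split => // w _ [].
  by rewrite precontent_box// big_geq.
have [Q0 Q0E] := probability_of_measure eT.
have [Q QE] := probability_image Q0 measurable_embed.
exists Q => s E us mE.
(* The factor [E i] is placed at coordinate [phi i]; the coordinates outside the image of [s] are
   left free. *)
pose D j := if pselect (exists2 i, i \in s & phi i = j) is left h
  then E (projT1 (cid2 h)) else setT.
have mD j : measurable (D j) by rewrite /D; case: pselect.
have DE i : i \in s -> D (phi i) = E i.
  move=> si; rewrite /D; case: pselect => [h|[]]; last by exists i.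
  by congr E; case: cid2 => i' /= _ /phi_inj.
pose n := (\max_(i <- s) (phi i).+1)%N.
have ltn_phi i : i \in s -> (phi i < n)%N.
  by move=> si; rewrite /n (big_rem i)//= leq_max leqnn.
rewrite QE Q0E (_ : _ @^-1` _ = box D 0 n); last first.
  apply/seteqP; split => w.
    move=> h j _; rewrite /D; case: pselect => // h'; case: cid2 => i /= si <-.
    exact: h.
  by move=> h i si; have := h (phi i); rewrite leq0n ltn_phi// DE// => /(_ isT).
transitivity (precontent (box D 0 n)); first by apply: ext; exact: finite_dim_box.
rewrite precontent_box// /index_iota subn0.
transitivity (\prod_(j <- [seq phi i | i <- s]) mu (D j)); last first.
  by rewrite big_map big_seq [RHS]big_seq; apply: eq_bigr => i si; rewrite DE.
rewrite (bigID (fun j => j \in [seq phi i | i <- s]))/= [X in _ * X]big1 ?mule1.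
  rewrite -big_filter; apply: perm_big; apply: uniq_perm.
  - by rewrite filter_uniq// iota_uniq.
  - by rewrite map_inj_uniq.
  move=> j; rewrite mem_filter mem_iota add0n andbC.
  apply/andP/idP => [[]//|/mapP[i si ->]]; split; first exact: ltn_phi.
  exact: map_f.
move=> j jn; rewrite /D; case: pselect => [[i si ij]|_]; last exact: probability_setT.
by rewrite -ij map_f in jn.
Qed.

End embed.

End infinite_product.

(** * Bounded measurable functions and i.i.d. sequences *)

Section bounded_measurable.
Context d (X : measurableType d) (R : realType).
Implicit Types (P : probability X R) (f g : X -> R).

(** Boundedness makes every function integrable for every probability, and the class is stable under
    the operations used below. *)
Definition bm f := measurable_fun setT f /\ exists C, forall x, `|f x| <= C.

Definition Ex P f : R := \int[P]_x f x.

Lemma bm_integrable P f : bm f -> P.-integrable setT (EFin \o f).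
Proof.
move=> [mf [C fC]]; apply: measurable_bounded_integrable => //.
  by have := ltry (1 : R); rewrite -(probability_setT P).
by exists C; split => //= y Cy x _; rewrite /= (le_trans (fC x))// ltW.
Qed.

Lemma bm_cst c : bm (fun=> c).
Proof. by split; [exact: measurable_cst|exists `|c|]. Qed.

Lemma bmD f g : bm f -> bm g -> bm (fun x => f x + g x).
Proof.
move=> [mf [C fC]] [mg [D gD]]; split; first exact: measurable_funD.
by exists (C + D) => x; rewrite (le_trans (ler_normD _ _))// lerD.
Qed.

Lemma bmM f g : bm f -> bm g -> bm (fun x => f x * g x).
Proof.
move=> [mf [C fC]] [mg [D gD]]; split; first exact: measurable_funM.
by exists (C * D) => x; rewrite normrM ler_pM.
Qed.

Lemma bmZ c f : bm f -> bm (fun x => c * f x).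
Proof. by move=> bf; apply: bmM => //; exact: bm_cst. Qed.

Lemma bmN f : bm f -> bm (fun x => - f x).
Proof.
move=> [mf [C fC]]; split; first exact: measurableT_comp.
by exists C => x; rewrite normrN.
Qed.

Lemma bmB f g : bm f -> bm g -> bm (fun x => f x - g x).
Proof. by move=> bf bg; apply: bmD => //; exact: bmN. Qed.

Lemma bm_indic (A : set X) : measurable A -> bm (fun x => \1_A x : R).
Proof.
move=> mA; split; first exact: measurable_indic.
by exists 1 => x; rewrite indicE; case: (_ \in _); rewrite ?normr1 ?normr0.
Qed.

Lemma bm_sum (I : Type) (s : seq I) (F : I -> X -> R) :
  (forall i, bm (F i)) -> bm (fun x => \sum_(i <- s) F i x).
Proof.
move=> bF; elim: s => [|i s IH].
  by under eq_fun do rewrite big_nil; exact: bm_cst.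
by under eq_fun do rewrite big_cons; exact: bmD.
Qed.

Lemma Ex_cst P c : Ex P (fun=> c) = c.
Proof.
transitivity (c * fine (P setT)); first exact: Rintegral_cst.
by rewrite (probability_setT P)/= mulr1.
Qed.

Lemma ExD P f g : bm f -> bm g -> Ex P (fun x => f x + g x) = Ex P f + Ex P g.
Proof. by move=> bf bg; apply: RintegralD => //; exact: bm_integrable. Qed.

Lemma ExB P f g : bm f -> bm g -> Ex P (fun x => f x - g x) = Ex P f - Ex P g.
Proof. by move=> bf bg; apply: RintegralB => //; exact: bm_integrable. Qed.

Lemma ExZ P c f : bm f -> Ex P (fun x => c * f x) = c * Ex P f.
Proof. by move=> bf; apply: RintegralZl => //; exact: bm_integrable. Qed.

Lemma eq_Ex P f g : f =1 g -> Ex P f = Ex P g.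
Proof. by move=> fg; apply: eq_Rintegral => x _. Qed.

Lemma le_Ex P f g : bm f -> bm g -> (forall x, f x <= g x) -> Ex P f <= Ex P g.
Proof. by move=> bf bg fg; apply: le_Rintegral => //; exact: bm_integrable. Qed.

Lemma Ex_ge0 P f : (forall x, 0 <= f x) -> 0 <= Ex P f.
Proof. by move=> f0; apply: Rintegral_ge0. Qed.

Lemma le_Ex_cst P f c : bm f -> (forall x, f x <= c) -> Ex P f <= c.
Proof. by move=> bf fc; rewrite -(Ex_cst P c) le_Ex//; exact: bm_cst. Qed.

Lemma ge_Ex_cst P f c : bm f -> (forall x, c <= f x) -> c <= Ex P f.
Proof. by move=> bf fc; rewrite -(Ex_cst P c) le_Ex//; exact: bm_cst. Qed.

Lemma norm_Ex_le P f c : bm f -> (forall x, `|f x| <= c) -> `|Ex P f| <= c.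
Proof.
move=> bf fc; rewrite ler_norml; apply/andP; split.
  by apply: ge_Ex_cst => // x; have := fc x; rewrite ler_norml => /andP[].
by apply: le_Ex_cst => // x; have := fc x; rewrite ler_norml => /andP[].
Qed.

Lemma Ex_sum (I : Type) P (s : seq I) (F : I -> X -> R) :
  (forall i, bm (F i)) ->
  Ex P (fun x => \sum_(i <- s) F i x) = \sum_(i <- s) Ex P (F i).
Proof.
move=> bF; elim: s => [|i s IH].
  by rewrite big_nil; under eq_Ex do rewrite big_nil; rewrite Ex_cst.
rewrite big_cons -IH -ExD//; last exact: bm_sum.
by apply: eq_Ex => x; rewrite big_cons.
Qed.

Lemma Ex_indic P (A : set X) : measurable A -> Ex P (fun x => \1_A x) = fine (P A).
Proof.
by move=> mA; rewrite /Ex /Rintegral integral_indic// setIT.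
Qed.

Lemma EFin_Ex P f : bm f -> (Ex P f)%:E = (\int[P]_x (f x)%:E)%E.
Proof.
move=> bf; rewrite /Ex /Rintegral fineK//.
by apply: integrable_fin_num => //; exact: bm_integrable.
Qed.

Lemma Ex_ge0_ae P f : bm f -> (forall x, 0 <= f x) -> Ex P f = 0 ->
  {ae P, forall x, f x = 0}.
Proof.
move=> bf f0 Ef.
have E0 : (\int[P]_x `|(EFin \o f) x|)%E = 0%E.
  transitivity (Ex P f)%:E; last by rewrite Ef.
  by rewrite EFin_Ex//; apply: eq_integral => x _; rewrite /= ger0_norm.
have mf : measurable_fun setT (EFin \o f) by apply/measurable_EFinP; case: bf.
have := (ae_eq_integral_abs P measurableT mf).1 E0.
apply: filterS => x /(_ I) /= [].
by [].
Qed.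

End bounded_measurable.

Section image.
Context d d' (X : measurableType d) (Y : measurableType d') (R : realType).

Lemma bm_comp (F : X -> Y) (f : Y -> R) : measurable_fun setT F -> bm f -> bm (f \o F).
Proof.
move=> mF [mf [C fC]]; split; first exact: measurableT_comp.
by exists C => x; exact: fC.
Qed.

Lemma Ex_image (P : probability X R) (Q : probability Y R) (F : X -> Y) (f : Y -> R) :
  measurable_fun setT F -> (forall A, measurable A -> Q A = P (F @^-1` A)) -> bm f ->
  Ex Q f = Ex P (f \o F).
Proof.
move=> mF QP bf.
pose G : {mfun X >-> Y} := HB.pack F (isMeasurableFun.Build _ _ _ _ F mF).
transitivity (Ex (distribution P G) f).
  by rewrite /Ex /Rintegral; congr fine; apply: eq_measure_integral => A mA _; exact: QP.
rewrite /Ex /Rintegral; congr fine.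
rewrite [LHS](@integral_pushforward _ _ _ _ _ G)//; last 2 first.
- by apply/measurable_EFinP; case: bf.
- exact: (bm_integrable P (bm_comp mF bf)).
Qed.

End image.

Section fubini.
Context d d' (X : measurableType d) (Y : measurableType d') (R : realType).
Variables (P : probability X R) (Q : probability Y R).

Lemma bm_section (f : X * Y -> R) x : bm f -> bm (fun y => f (x, y)).
Proof.
move=> [mf [C fC]]; split; last by exists C => y; exact: fC.
by apply: (measurableT_comp mf); exact: pair1_measurable.
Qed.

Lemma bm_Ex_section (f : X * Y -> R) : bm f -> bm (fun x => Ex Q (fun y => f (x, y))).
Proof.
move=> bf; have [mf [C fC]] := bf; split.
  apply/measurable_EFinP.
  rewrite (_ : _ \o _ = fun x => \int[Q]_y (f (x, y))%:E)%E; last first.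
    by apply/funext => x /=; rewrite EFin_Ex//; exact: bm_section.
  apply: (measurable_fubini_F (m1 := P) (f := EFin \o f)).
  exact: (bm_integrable (P \x Q)%E bf).
by exists C => x; apply: norm_Ex_le => [|y]; [exact: bm_section|exact: fC].
Qed.

(** Repackages the product measure as a bundled probability, so that [Ex] and image measures apply
    to it. *)
Lemma product_probability_exists : exists PQ : probability (X * Y)%type R,
  (forall A B, measurable A -> measurable B -> PQ (A `*` B) = (P A * Q B)%E) /\
  (forall f, bm f -> Ex PQ f = Ex P (fun x => Ex Q (fun y => f (x, y)))).
Proof.
have PQ1 : (P \x Q)%E setT = 1%E.
  rewrite -setXTT; transitivity (P setT * Q setT)%E; first exact: product_measure1E.
  by rewrite (probability_setT P) (probability_setT Q) mule1.
have [PQ PQE] := probability_of_measure PQ1.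
exists PQ; split; first by move=> A B mA mB; rewrite PQE; exact: product_measure1E.
move=> f bf.
have -> : Ex PQ f = fine (\int[(P \x Q)%E]_z (f z)%:E).
  by rewrite /Ex /Rintegral; congr fine; apply: eq_measure_integral => A mA _; exact: PQE.
have If : (P \x Q)%E.-integrable setT (EFin \o f).
  have := bm_integrable PQ bf => /integrableP[mf h].
  apply/integrableP; split => //; move: h; congr (_ < _)%E.
  by apply: eq_measure_integral => A mA _; exact: PQE.
rewrite -[X in fine X]/(\int[(P \x Q)%E]_z (EFin \o f) z)%E.
rewrite -(integral12_prod_meas1 If) /fubini_F.
rewrite /Ex /Rintegral; congr fine; apply: eq_integral => x _.
by rewrite fineK//; apply: integrable_fin_num => //; exact: (bm_integrable Q (bm_section x bf)).
Qed.

End fubini.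

Section iid_sequences.
Context d (T : measurableType d) (R : realType) (mu : probability T R).
Local Notation Om := (prodT int T).

Definition iid_law (P : probability Om R) := forall (s : seq int) E, uniq s ->
  (forall i, measurable (E i)) -> P (cylinder s E) = (\prod_(i <- s) mu (E i))%E.

Lemma iid_law_exists : exists P, iid_law P.
Proof. exact: (iid_exists mu (pcan_inj (@pickleK int))). Qed.

Variables (P : probability Om R) (PI : iid_law P).

Lemma iid_law_unique Q : iid_law Q -> forall A, measurable A -> Q A = P A.
Proof.
move=> QI; apply: probability_cylinder_unique => s E us mE.
by rewrite PI// QI.
Qed.

Lemma iid_coord (f : T -> R) i : bm f -> Ex P (fun w => f (w i)) = Ex mu f.
Proof.
move=> bf; symmetry; apply: (@Ex_image _ _ Om T R P mu (fun w : Om => w i)) => //.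
  exact: measurable_coord.
move=> A mA; have := PI (s := [:: i]) (E := fun=> A) isT (fun=> mA).
rewrite big_seq1 => <-; congr (P _); apply/seteqP; split => w /=.
  by apply; rewrite inE.
by move=> Aw j; rewrite inE => /eqP ->.
Qed.

Definition shiftn (n : nat) (w : Om) : Om := fun i => w (i + n%:Z).

Lemma measurable_shift n : measurable_fun setT (shiftn n).
Proof. by apply: measurable_fun_prodT => i; exact: measurable_coord. Qed.

Lemma shift_invariant n A : measurable A -> P A = P (shiftn n @^-1` A).
Proof.
have [Q QE] := probability_image P (measurable_shift n).
move=> mA; rewrite -QE; symmetry; apply: iid_law_unique => // s E us mE.
rewrite QE (_ : _ @^-1` _ = cylinder [seq i + n%:Z | i <- s] (fun j => E (j - n%:Z))).
  rewrite PI; last 2 first.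
  - by rewrite map_inj_uniq//; exact: addIr.
  - by [].
  by rewrite big_map; apply: eq_bigr => i _; rewrite addrK.
apply/seteqP; split => w h.
  by move=> _ /mapP[i si ->]; rewrite addrK; exact: h.
by move=> i si; have := h _ (map_f _ si); rewrite addrK.
Qed.

(** All coordinates below [n], the negative ones included, come from the first sequence; the second
    one starts at time [n]. *)
Definition splice (n : nat) (p : Om * Om) : Om :=
  fun i => if i < n%:Z then p.1 i else p.2 (i - n%:Z).

Lemma measurable_splice n : measurable_fun setT (splice n).
Proof.
apply: measurable_fun_prodT => i; rewrite /splice; case: (i < n%:Z).
  by apply: (measurableT_comp (measurable_coord (T := T) i)); exact: measurable_fst.
by apply: (measurableT_comp (measurable_coord (T := T) (i - n%:Z))); exact: measurable_snd.
Qed.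

(** Two independent i.i.d. sequences glued at time [n] form an i.i.d. sequence, by uniqueness on
    cylinders. This is the form in which one conditions on the first [n] steps. *)
Lemma iid_splice n (f : Om -> R) : bm f ->
  Ex P f = Ex P (fun w => Ex P (fun w' => f (splice n (w, w')))).
Proof.
move=> bf; have [PP [PPE PPF]] := product_probability_exists P P.
have [Q QE] := probability_image PP (measurable_splice n).
rewrite -(PPF (f \o splice n)); last exact: bm_comp (measurable_splice n) bf.
apply: Ex_image => //; first exact: measurable_splice.
move=> A mA; rewrite -QE; symmetry; apply: iid_law_unique => // s E us mE.
pose s1 := [seq i <- s | i < n%:Z]; pose s2 := [seq i - n%:Z | i <- s & ~~ (i < n%:Z)].
rewrite QE (_ : _ @^-1` _ = cylinder s1 E `*` cylinder s2 (fun j => E (j + n%:Z))).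
  rewrite PPE; last 2 first.
  - exact: measurable_cylinder.
  - by apply: measurable_cylinder.
  rewrite PI ?filter_uniq// PI//; last first.
    by rewrite map_inj_uniq ?filter_uniq//; exact: addIr.
  symmetry; rewrite [LHS](bigID (fun i : int => (i < n%:Z)%R)) big_filter.
  congr (_ * _)%E.
  by rewrite -big_filter big_map; apply: eq_bigr => i _; rewrite subrK.
apply/seteqP; split => [[w w'] h|[w w'] [h1 h2] i si].
  split => i; rewrite /s1 /s2.
    rewrite mem_filter => /andP[ilt si].
    by have := h i si; rewrite /splice ilt.
  move=> /mapP[j]; rewrite mem_filter => /andP[jlt sj] ->.
  by have := h j sj; rewrite /splice (negbTE jlt) subrK.
rewrite /splice; case: ifPn => ilt.
  by apply: h1; rewrite mem_filter ilt.
have := h2 (i - n%:Z); rewrite subrK; apply.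
by apply/mapP; exists i => //; rewrite mem_filter ilt.
Qed.

End iid_sequences.

(** * Frobenius norms and second exterior powers *)

Section cauchy_schwarz.
Context {R : realType}.

(** Lagrange's identity: the defect is half the sum of the squared 2 x 2 minors. *)
Lemma cauchy_schwarz_sum (I : finType) (a b : I -> R) :
  (\sum_i a i * b i) ^+ 2 <= (\sum_i a i ^+ 2) * (\sum_i b i ^+ 2).
Proof.
rewrite -subr_ge0.
have -> : (\sum_i a i ^+ 2) * (\sum_i b i ^+ 2) - (\sum_i a i * b i) ^+ 2 =
   2^-1 * \sum_i \sum_j (a i * b j - a j * b i) ^+ 2.
  have E i : \sum_j (a i * b j - a j * b i) ^+ 2 = a i ^+ 2 * (\sum_j b j ^+ 2)
     + (\sum_j a j ^+ 2) * b i ^+ 2 - 2 * (a i * b i * \sum_j (a j * b j)).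
    rewrite mulr_sumr mulr_suml [in X in _ - X]mulr_sumr mulr_sumr -sumrN -!big_split.
    by apply: eq_bigr => j _ /=; ring.
  rewrite [in RHS](eq_bigr _ (fun i _ => E i)).
  rewrite !big_split /= -mulr_suml -mulr_sumr sumrN -mulr_sumr -mulr_suml; by field.
apply: mulr_ge0; first by rewrite invr_ge0.
by apply: sumr_ge0 => i _; apply: sumr_ge0 => j _; exact: sqr_ge0.
Qed.

End cauchy_schwarz.

Section frobenius.
Context {R : realType}.

(** The squared Frobenius norm, which is the Euclidean one on columns. Being polynomial in the
    entries, it is measurable and splits over columns; it is comparable to the operator norm up to a
    factor [d]. *)
Definition fn2 {m n} (M : 'M[R]_(m, n)) : R := \sum_i \sum_j M i j ^+ 2.
Definition fn {m n} (M : 'M[R]_(m, n)) : R := Num.sqrt (fn2 M).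

Lemma fn2_ge0 m n (M : 'M[R]_(m, n)) : 0 <= fn2 M.
Proof. by apply: sumr_ge0 => i _; apply: sumr_ge0 => j _; exact: sqr_ge0. Qed.

Lemma fn_ge0 m n (M : 'M[R]_(m, n)) : 0 <= fn M.
Proof. exact: sqrtr_ge0. Qed.

Lemma sqr_fn m n (M : 'M[R]_(m, n)) : fn M ^+ 2 = fn2 M.
Proof. by rewrite sqr_sqrtr// fn2_ge0. Qed.

Lemma fn_le m n p q (M : 'M[R]_(m, n)) (N : 'M[R]_(p, q)) :
  (fn M <= fn N) = (fn2 M <= fn2 N).
Proof. by rewrite /fn ler_sqrt// fn2_ge0. Qed.

Lemma fn2_entry m n (M : 'M[R]_(m, n)) i j : M i j ^+ 2 <= fn2 M.
Proof.
rewrite /fn2 (bigD1 i)//= (bigD1 j)//= -addrA lerDl.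
apply: addr_ge0; first by apply: sumr_ge0 => k _; exact: sqr_ge0.
by apply: sumr_ge0 => k _; apply: sumr_ge0 => l _; exact: sqr_ge0.
Qed.

Lemma fn_entry m n (M : 'M[R]_(m, n)) i j : `|M i j| <= fn M.
Proof. by rewrite -sqrtr_sqr /fn ler_sqrt ?fn2_ge0// fn2_entry. Qed.

Lemma fn_eq0 m n (M : 'M[R]_(m, n)) : (fn M == 0) = (M == 0).
Proof.
apply/eqP/eqP => [M0|->]; last first.
  by rewrite /fn /fn2 big1 ?sqrtr0// => i _; rewrite big1// => j _; rewrite mxE expr0n.
by apply/matrixP => i j; rewrite mxE; apply/normr0_eq0/le_anti;
   rewrite normr_ge0 andbT -M0 fn_entry.
Qed.

Lemma fn0 m n : fn (0 : 'M[R]_(m, n)) = 0.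
Proof. by apply/eqP; rewrite fn_eq0. Qed.

Lemma fn_gt0 m n (M : 'M[R]_(m, n)) : (0 < fn M) = (M != 0).
Proof. by rewrite lt_def fn_ge0 andbT fn_eq0. Qed.

Lemma fn2Z m n a (M : 'M[R]_(m, n)) : fn2 (a *: M) = a ^+ 2 * fn2 M.
Proof.
rewrite /fn2 mulr_sumr; apply: eq_bigr => i _; rewrite mulr_sumr.
by apply: eq_bigr => j _; rewrite mxE exprMn.
Qed.

Lemma fnZ m n a (M : 'M[R]_(m, n)) : fn (a *: M) = `|a| * fn M.
Proof. by rewrite /fn fn2Z sqrtrM ?sqr_ge0// sqrtr_sqr. Qed.

Lemma fnN m n (M : 'M[R]_(m, n)) : fn (- M) = fn M.
Proof. by rewrite -scaleN1r fnZ normrN1 mul1r. Qed.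

Lemma fn2_tr m n (M : 'M[R]_(m, n)) : fn2 M^T = fn2 M.
Proof.
rewrite /fn2 exchange_big; apply: eq_bigr => i _; apply: eq_bigr => j _.
by rewrite mxE.
Qed.

Lemma fn_tr m n (M : 'M[R]_(m, n)) : fn M^T = fn M.
Proof. by rewrite /fn fn2_tr. Qed.

Lemma fn2_mul m n p (M : 'M[R]_(m, n)) (N : 'M[R]_(n, p)) :
  fn2 (M *m N) <= fn2 M * fn2 N.
Proof.
rewrite /fn2 mulr_suml; apply: ler_sum => i _.
rewrite [in X in _ <= _ * X]exchange_big mulr_sumr; apply: ler_sum => j _.
by rewrite mxE; exact: (cauchy_schwarz_sum (fun k => M i k) (fun k => N k j)).
Qed.

Lemma fn_mul m n p (M : 'M[R]_(m, n)) (N : 'M[R]_(n, p)) :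
  fn (M *m N) <= fn M * fn N.
Proof. by rewrite /fn -sqrtrM ?fn2_ge0// ler_sqrt ?mulr_ge0 ?fn2_ge0// fn2_mul. Qed.

Definition fdot {m n} (M N : 'M[R]_(m, n)) : R := \sum_i \sum_j M i j * N i j.

Lemma fn2D m n (M N : 'M[R]_(m, n)) :
  fn2 (M + N) = fn2 M + fn2 N + 2 * fdot M N.
Proof.
rewrite /fn2 /fdot mulr_sumr -!big_split; apply: eq_bigr => i _ /=.
by rewrite mulr_sumr -!big_split; apply: eq_bigr => j _ /=; rewrite mxE; ring.
Qed.

Lemma sqr_fdot_le m n (M N : 'M[R]_(m, n)) : fdot M N ^+ 2 <= fn2 M * fn2 N.
Proof.
rewrite /fdot /fn2 !pair_bigA /=.
exact: (cauchy_schwarz_sum (fun p => M p.1 p.2) (fun p => N p.1 p.2)).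
Qed.

Lemma fdot_le m n (M N : 'M[R]_(m, n)) : `|fdot M N| <= fn M * fn N.
Proof.
by rewrite -sqrtr_sqr /fn -sqrtrM ?fn2_ge0// ler_sqrt ?mulr_ge0 ?fn2_ge0// sqr_fdot_le.
Qed.

Lemma fnD m n (M N : 'M[R]_(m, n)) : fn (M + N) <= fn M + fn N.
Proof.
rewrite -(@ler_pXn2r _ 2)// ?nnegrE ?addr_ge0 ?fn_ge0//.
rewrite sqr_fn fn2D sqrrD !sqr_fn.
have := le_trans (ler_norm _) (fdot_le M N); rewrite mulr2n; lra.
Qed.

Lemma fnB m n (M N : 'M[R]_(m, n)) : fn (M - N) <= fn M + fn N.
Proof. by rewrite (le_trans (fnD _ _))// fnN. Qed.

Lemma fnBC m n (M N : 'M[R]_(m, n)) : fn (M - N) = fn (N - M).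
Proof. by rewrite -fnN opprB. Qed.

Lemma fn_dist m n (M N : 'M[R]_(m, n)) : `|fn M - fn N| <= fn (M - N).
Proof.
have H (A B : 'M[R]_(m, n)) : fn A <= fn (A - B) + fn B.
  by rewrite -{1}(subrK B A) fnD.
have := H M N; have := H N M; rewrite fnBC ler_norml; lra.
Qed.

Lemma fn2_cols m n (M : 'M[R]_(m, n)) : fn2 M = \sum_j fn2 (col j M).
Proof.
rewrite /fn2 exchange_big; apply: eq_bigr => j _; apply: eq_bigr => i _.
by rewrite big_ord1 mxE.
Qed.

Lemma fn_col m n (M : 'M[R]_(m, n)) j : fn (col j M) <= fn M.
Proof.
rewrite fn_le [leRHS]fn2_cols (bigD1 j)//= lerDl.
by apply: sumr_ge0 => k _; exact: fn2_ge0.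
Qed.

Lemma fn_le_cols m n (M : 'M[R]_(m, n)) c : 0 <= c -> (forall j, fn (col j M) <= c) ->
  fn M <= n%:R * c.
Proof.
move=> c0 Mc; rewrite -(@ler_pXn2r _ 2)// ?nnegrE ?fn_ge0 ?mulr_ge0//.
rewrite sqr_fn fn2_cols.
apply: (@le_trans _ _ (\sum_(j < n) c ^+ 2)).
  by apply: ler_sum => j _; rewrite -sqr_fn ler_pXn2r ?nnegrE ?fn_ge0.
rewrite sumr_const card_ord exprMn -[leLHS]mulr_natl ler_wpM2r ?sqr_ge0//.
by rewrite -natrX ler_nat; case: n {M Mc} => // n; rewrite expnS expn1 leq_pmulr.
Qed.

Lemma fn_enorm n (v : 'cV[R]_n) : enorm v = fn v.
Proof.
by rewrite /enorm /fn /fn2; congr Num.sqrt; apply: eq_bigr => i _; rewrite big_ord1.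
Qed.

Lemma fn_delta n (j : 'I_n) : fn (delta_mx j 0 : 'cV[R]_n) = 1.
Proof.
rewrite /fn /fn2 (bigD1 j)//= big_ord1 mxE !eqxx/= expr1n big1 ?addr0 ?sqrtr1//.
by move=> i ij; rewrite big_ord1 mxE (negbTE ij) expr0n.
Qed.

Lemma fn2_sub1 n : fn2 (1%:M : 'M[R]_n) = n%:R.
Proof.
rewrite /fn2 (eq_bigr (fun=> 1)) ?sumr_const ?card_ord// => i _.
rewrite (bigD1 i)//= mxE eqxx expr1n big1 ?addr0// => j ji.
by rewrite mxE eq_sym (negbTE ji) expr0n.
Qed.

(* [wdg M] is the Frobenius norm of the second exterior power of [M]: every
   2 x 2 minor is counted four times in the sum. *)
Definition minor2 {m n} (M : 'M[R]_(m, n)) i j k l : R :=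
  M i k * M j l - M i l * M j k.
Definition wdg2 {m n} (M : 'M[R]_(m, n)) : R :=
  4^-1 * \sum_i \sum_j \sum_k \sum_l minor2 M i j k l ^+ 2.
Definition wdg {m n} (M : 'M[R]_(m, n)) : R := Num.sqrt (wdg2 M).

Lemma wdg2_ge0 m n (M : 'M[R]_(m, n)) : 0 <= wdg2 M.
Proof.
apply: mulr_ge0; first by rewrite invr_ge0.
by do 4 (apply: sumr_ge0 => ? _); exact: sqr_ge0.
Qed.

Lemma wdg_ge0 m n (M : 'M[R]_(m, n)) : 0 <= wdg M.
Proof. exact: sqrtr_ge0. Qed.

Lemma sqr_wdg m n (M : 'M[R]_(m, n)) : wdg M ^+ 2 = wdg2 M.
Proof. by rewrite sqr_sqrtr// wdg2_ge0. Qed.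

(** The Cauchy-Binet formula for 2 x 2 minors; the factor 1/2 is there because each pair of
    intermediate indices occurs in both orders. *)
Lemma minor2_mul m n p (M : 'M[R]_(m, n)) (N : 'M[R]_(n, p)) i j k l :
  minor2 (M *m N) i j k l =
  2^-1 * \sum_a \sum_b minor2 M i j a b * minor2 N a b k l.
Proof.
have E (x y : 'I_p) : (M *m N) i x * (M *m N) j y =
    \sum_a \sum_b M i a * N a x * (M j b * N b y).
  rewrite !mxE mulr_suml; apply: eq_bigr => a _.
  by rewrite mulr_sumr; apply: eq_bigr => b _.
rewrite /minor2 !E.
have -> : \sum_a \sum_b M i a * N a l * (M j b * N b k) =
          \sum_a \sum_b M i b * N b l * (M j a * N a k) by rewrite exchange_big.
rewrite -sumrB.
have -> : \sum_a \sum_b (M i a * M j b - M i b * M j a) * (N a k * N b l - N a l * N b k) =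
  \sum_a \sum_b (M i a * N a k * (M j b * N b l) - M i b * N b l * (M j a * N a k)) +
  \sum_b \sum_a (M i b * N b k * (M j a * N a l) - M i a * N a l * (M j b * N b k)).
  rewrite [X in _ = _ + X]exchange_big -big_split; apply: eq_bigr => a _ /=.
  by rewrite -big_split; apply: eq_bigr => b _ /=; ring.
rewrite (_ : \sum_a _ + _ = 2 * \sum_a \sum_b (M i a * N a k * (M j b * N b l) - M i b * N b l * (M j a * N a k))).
  rewrite mulrA mulVf ?mul1r ?pnatr_eq0//.
  by apply: eq_bigr => a _; rewrite sumrB.
by rewrite mulr_natl mulr2n.
Qed.

Lemma wdg2_mul m n p (M : 'M[R]_(m, n)) (N : 'M[R]_(n, p)) :
  wdg2 (M *m N) <= wdg2 M * wdg2 N.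
Proof.
have E q r (A : 'M[R]_(q, r)) : wdg2 A =
    4^-1 * \sum_(x : 'I_q * 'I_q) \sum_(y : 'I_r * 'I_r) minor2 A x.1 x.2 y.1 y.2 ^+ 2.
  rewrite /wdg2 pair_bigA; congr (_ * _); apply: eq_bigr => x _.
  by rewrite pair_bigA.
rewrite !E.
have -> (a b : R) : 4^-1 * a * (4^-1 * b) = 4^-1 * (4^-1 * (a * b)) by ring.
rewrite ler_pM2l ?invr_gt0// mulr_suml mulr_sumr; apply: ler_sum => x _.
rewrite [in leRHS]exchange_big mulr_sumr mulr_sumr; apply: ler_sum => y _.
rewrite minor2_mul pair_bigA /=.
rewrite exprMn (_ : 2^-1 ^+ 2 = 4^-1 :> R); last by field.
rewrite ler_pM2l ?invr_gt0//.
exact: (cauchy_schwarz_sum (fun z : 'I_n * 'I_n => minor2 M x.1 x.2 z.1 z.2)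
                           (fun z => minor2 N z.1 z.2 y.1 y.2)).
Qed.

Lemma wdg_mul m n p (M : 'M[R]_(m, n)) (N : 'M[R]_(n, p)) :
  wdg (M *m N) <= wdg M * wdg N.
Proof.
rewrite /wdg -sqrtrM ?wdg2_ge0// ler_sqrt; first exact: wdg2_mul.
by rewrite mulr_ge0 ?wdg2_ge0.
Qed.

(** Newton's identity: this is the second elementary symmetric function of the eigenvalues of M^T M,
    written with the traces of M^T M and of its square. *)
Lemma wdg2E m n (M : 'M[R]_(m, n)) :
  wdg2 M = (fn2 M ^+ 2 - fn2 (M^T *m M)) / 2.
Proof.
have E1 : fn2 M ^+ 2 = \sum_i \sum_j \sum_k \sum_l (M i k ^+ 2 * M j l ^+ 2).
  rewrite expr2 /fn2 mulr_suml; apply: eq_bigr => i _.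
  rewrite mulr_sumr; apply: eq_bigr => j _; rewrite mulr_suml.
  by apply: eq_bigr => k _; rewrite mulr_sumr.
have E2 : fn2 (M^T *m M) = \sum_i \sum_j \sum_k \sum_l (M i k * M j l * (M i l * M j k)).
  transitivity (\sum_k \sum_l \sum_i \sum_j (M i k * M j l * (M i l * M j k))).
    apply: eq_bigr => k _; apply: eq_bigr => l _.
    rewrite mxE expr2 mulr_suml; apply: eq_bigr => i _.
    by rewrite mulr_sumr; apply: eq_bigr => j _; rewrite !mxE; ring.
  under eq_bigr do rewrite exchange_big.
  under eq_bigr do under eq_bigr do rewrite exchange_big.
  rewrite exchange_big; apply: eq_bigr => i _.
  by rewrite exchange_big.
have E3 : fn2 M ^+ 2 = \sum_i \sum_j \sum_k \sum_l (M i l ^+ 2 * M j k ^+ 2).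
  rewrite E1; apply: eq_bigr => i _; apply: eq_bigr => j _.
  by rewrite exchange_big.
have E : \sum_i \sum_j \sum_k \sum_l minor2 M i j k l ^+ 2 =
   fn2 M ^+ 2 + fn2 M ^+ 2 - 2 * fn2 (M^T *m M).
  rewrite {1}E1 E3 E2 mulr_sumr -big_split -sumrB; apply: eq_bigr => i _ /=.
  rewrite mulr_sumr -big_split -sumrB; apply: eq_bigr => j _ /=.
  rewrite mulr_sumr -big_split -sumrB; apply: eq_bigr => k _ /=.
  rewrite mulr_sumr -big_split -sumrB; apply: eq_bigr => l _ /=.
  by rewrite /minor2; ring.
by rewrite /wdg2 E; field.
Qed.

Lemma wdg_le m n (M : 'M[R]_(m, n)) : wdg M <= fn M ^+ 2.
Proof.
rewrite -(@ler_pXn2r _ 2)// ?nnegrE ?wdg_ge0 ?exprn_ge0 ?fn_ge0//.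
rewrite sqr_wdg sqr_fn wdg2E.
have := fn2_ge0 (M^T *m M); have := sqr_ge0 (fn2 M); lra.
Qed.

Lemma wdg1_ge1 n : (2 <= n)%N -> 1 <= wdg (1%:M : 'M[R]_n).
Proof.
move=> n2; rewrite -[leLHS]sqrtr1 /wdg ler_sqrt ?wdg2_ge0//.
rewrite wdg2E trmx1 mul1mx fn2_sub1 ler_pdivlMr// mul1r.
have : (2 : R) <= n%:R by rewrite ler_nat.
nra.
Qed.

End frobenius.

(** * Singular values through the spectrum of the Gram matrix *)

Section spectrum.

Lemma char_poly_conj (F : fieldType) n (P D : 'M[F]_n) : P \in unitmx ->
  char_poly (invmx P *m D *m P) = char_poly D.
Proof.
move=> uP; rewrite /char_poly /char_poly_mx.
pose Q := map_mx (@polyC F) P; pose Q' := map_mx (@polyC F) (invmx P).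
have QQ : Q' *m Q = 1%:M by rewrite -map_mxM mulVmx// map_mx1.
have -> : 'X%:M - map_mx polyC (invmx P *m D *m P) =
    Q' *m ('X%:M - map_mx polyC D) *m Q.
  rewrite mulmxBr mulmxBl !map_mxM; congr (_ - _).
  by rewrite -scalemx1 -scalemxAr mulmx1 -scalemxAl QQ.
rewrite !det_mulmx mulrAC -det_mulmx QQ det1 mul1r.
by [].
Qed.

Context {R : realType}.

(** The matrix is diagonalized over the complex numbers as a hermitian matrix; its eigenvalues are
    real, and the three identities descend because the embedding of the reals is injective. *)
Lemma symmetric_spectrum n (G : 'M[R]_n) : G^T = G ->
  exists lam : 'I_n -> R, [/\ char_poly G = \prod_i ('X - (lam i)%:P),
    \tr G = \sum_i lam i & \tr (G *m G) = \sum_i lam i ^+ 2].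
Proof.
move=> sG; pose f : {rmorphism R -> R[i]} := real_complex R.
pose Gc := map_mx f G.
have hG : Gc \is hermsymmx.
  apply: realsym_hermsym.
    apply/is_hermitianmxP; rewrite expr0 scale1r map_mx_id//.
    by apply/matrixP => i j; rewrite !mxE -[in LHS]sG mxE.
  by apply/mxOverP => i j; rewrite mxE complex_real.
have /orthomx_spectralP := hermitian_normalmx hG.
set P := spectralmx Gc; set sp := spectral_diag Gc => GE.
have uP : P \in unitmx by exact: spectral_unit.
have /mxOverP sp_real := hermitian_spectral_diag_real hG.
have spE i : f (complex.Re (sp 0 i)) = sp 0 i by apply: RRe_real; exact: sp_real.
exists (fun i => complex.Re (sp 0 i)).
have trE (A : 'M[R]_n) : f (\tr A) = \tr (map_mx f A) by rewrite trace_map_mx.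
have trD (D : 'M[R[i]]_n) : \tr (invmx P *m D *m P) = \tr D.
  by rewrite mxtrace_mulC mulmxA mulmxV// mul1mx.
split.
- apply: (@map_poly_inj _ _ f); rewrite map_char_poly -/Gc GE char_poly_conj//.
  rewrite char_poly_trig; last exact: diag_mx_is_trig.
  rewrite rmorph_prod; apply: eq_bigr => i _.
  by rewrite rmorphB /= map_polyX map_polyC /= spE mxE eqxx.
- apply: (fmorph_inj f); rewrite trE -/Gc GE trD mxtrace_diag rmorph_sum.
  by apply: eq_bigr => i _; rewrite /= spE.
- apply: (fmorph_inj f); rewrite trE map_mxM -/Gc.
  have -> : Gc *m Gc = invmx P *m (diag_mx sp *m diag_mx sp) *m P.
    by rewrite {1 2}GE !mulmxA mulmxK.
  rewrite trD mulmx_diag mxtrace_diag rmorph_sum.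
  by apply: eq_bigr => i _; rewrite /= mxE rmorphXn /= spE expr2.
Qed.

Lemma fdot_trmx m n (M N : 'M[R]_(m, n)) : \tr (M^T *m N) = fdot M N.
Proof.
rewrite /mxtrace /fdot exchange_big; apply: eq_bigr => i _; rewrite mxE.
by apply: eq_bigr => j _; rewrite mxE.
Qed.

Lemma fdotxx m n (M : 'M[R]_(m, n)) : fdot M M = fn2 M.
Proof. by apply: eq_bigr => i _; apply: eq_bigr => j _; rewrite expr2. Qed.

Lemma gram_spectrum n (M : 'M[R]_n) :
  exists lam : 'I_n -> R, [/\ char_poly (M^T *m M) = \prod_i ('X - (lam i)%:P),
    (forall i, 0 <= lam i), fn2 M = \sum_i lam i &
    fn2 (M^T *m M) = \sum_i lam i ^+ 2].
Proof.
have sG : (M^T *m M)^T = M^T *m M by rewrite trmx_mul trmxK.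
have [lam [chE trE tr2E]] := symmetric_spectrum sG.
exists lam; split => //.
- move=> i; have : eigenvalue (M^T *m M) (lam i).
    by rewrite eigenvalue_root_char chE /root horner_prod (bigD1 i)//= hornerXsubC subrr mul0r.
  move=> /eigenvalueP[v vE v0].
  have v2 : 0 < fn2 v by rewrite -sqr_fn exprn_gt0// fn_gt0.
  have : lam i * fn2 v = fn2 (v *m M^T).
    rewrite -!fdotxx -!fdot_trmx mxtrace_mulC [in RHS]mxtrace_mulC trmx_mul trmxK.
    by rewrite mulmxA -[v *m _ *m M]mulmxA vE -scalemxAl mxtraceZ.
  move=> E; rewrite -(pmulr_lge0 _ v2) E; exact: fn2_ge0.
- by rewrite -trE fdot_trmx fdotxx.
- by rewrite -tr2E -{2}sG fdot_trmx fdotxx.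
Qed.

(** [singular_values] lists the distinct real roots with multiplicity; since the characteristic
    polynomial splits over the reals, no eigenvalue is missed. *)
Lemma singular_values_spectrum n (M : 'M[R]_n) (lam : 'I_n -> R) :
  char_poly (M^T *m M) = \prod_i ('X - (lam i)%:P) ->
  perm_eq (singular_values M) [seq Num.sqrt (lam i) | i <- enum 'I_n].
Proof.
move=> chE; rewrite /singular_values; set p := char_poly _ in chE *.
rewrite perm_sort [X in perm_eq _ X](map_comp (@Num.sqrt R) lam); apply: perm_map.
have p0 : p != 0 by apply: monic_neq0; exact: char_poly_monic.
set s := [seq lam i | i <- enum 'I_n].
have ps : p = \prod_(y <- s) ('X - y%:P) by rewrite chE big_map big_enum.
apply/allP => x _ /=.
have -> : count_mem x s = mup x p by rewrite ps mu_prod_XsubC.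
have rootsE := polyrcf.roots_on_rootsR p0.
have cnt (r : seq R) : uniq r -> count_mem x (flatten [seq nseq (mup y p) y | y <- r]) =
    if x \in r then mup x p else 0%N.
  elim: r => //= y r IH /andP[yr ur]; rewrite count_cat IH// count_nseq in_cons /=.
  rewrite [x == y]eq_sym; case: eqP => [<-|_]; last by rewrite mul0n add0n.
  by rewrite (negbTE yr) mul1n addn0.
rewrite cnt; last exact: polyrcf.uniq_roots.
case: ifPn => // /negP xr; apply/eqP; symmetry.
have : ~~ root p x.
  by apply/negP => rx; apply: xr; rewrite -rootsE in_itv /= rx.
by rewrite ps mu_prod_XsubC root_prod_XsubC => /count_memPn.
Qed.

(** (S1^2 - S2) / 2 is the second elementary symmetric function of the squares; it is at least its
    largest term (a b)^2 and at most a dimensional multiple of it. *)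
Lemma two_largest (a b : R) (t : seq R) : 0 <= b -> b <= a ->
  (forall x, x \in t -> 0 <= x <= b) ->
  let n := (size t).+2%:R in
  let s := a :: b :: t in
  let S1 := \sum_(x <- s) x ^+ 2 in
  let S2 := \sum_(x <- s) (x ^+ 2) ^+ 2 in
  [/\ a ^+ 2 <= S1, S1 <= n * a ^+ 2, (a * b) ^+ 2 <= (S1 ^+ 2 - S2) / 2 &
    (S1 ^+ 2 - S2) / 2 <= n ^+ 2 * (a * b) ^+ 2].
Proof.
move=> b0 ba tb n s S1 S2.
pose u := \sum_(x <- t) x ^+ 2; pose w := \sum_(x <- t) (x ^+ 2) ^+ 2.
have S1E : S1 = a ^+ 2 + (b ^+ 2 + u) by rewrite /S1 !big_cons.
have S2E : S2 = (a ^+ 2) ^+ 2 + ((b ^+ 2) ^+ 2 + w) by rewrite /S2 !big_cons.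
have u0 : 0 <= u by apply: sumr_ge0 => x _; exact: sqr_ge0.
have w0 : 0 <= w by apply: sumr_ge0 => x _; exact: sqr_ge0.
have wu : w <= u ^+ 2.
  rewrite /w /u; elim: (t) => [|x r IH]; first by rewrite !big_nil expr0n.
  rewrite !big_cons sqrrD -addrA lerD2l (le_trans IH)// lerDr.
  by rewrite mulrn_wge0// mulr_ge0 ?sqr_ge0// sumr_ge0// => y _; exact: sqr_ge0.
have m0 : 0 <= (size t)%:R :> R by [].
have ub : u <= (size t)%:R * b ^+ 2.
  have -> : (size t)%:R * b ^+ 2 = \sum_(x <- t) b ^+ 2.
    by rewrite big_const_seq count_predT iter_addr addr0 mulr_natl.
  rewrite /u big_seq [leRHS]big_seq.
  apply: ler_sum => x xt; have /andP[x0 xb] := tb x xt.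
  by rewrite ler_pXn2r// nnegrE (le_trans x0).
have nE : n = (size t)%:R + 2 by rewrite /n -addn2 natrD.
have b2a2 : b ^+ 2 <= a ^+ 2 by rewrite ler_pXn2r// nnegrE// (le_trans b0).
have b20 : 0 <= b ^+ 2 by exact: sqr_ge0.
rewrite S1E S2E nE exprMn.
move: (a ^+ 2) (b ^+ 2) b2a2 b20 ub => A B BA B0 uB.
move: (size t)%:R m0 uB => m m0 uB.
have A0 : 0 <= A by exact: le_trans BA.
have mBA : m * B <= m * A by rewrite ler_wpM2l.
have uA : u * A <= m * B * A by rewrite ler_wpM2r.
have uB' : u * B <= m * B * A by rewrite (le_trans (ler_wpM2r B0 uB))// ler_wpM2l// mulr_ge0.
have uu : u ^+ 2 <= m * m * (A * B).
  rewrite expr2 (le_trans (ler_pM _ _ uB uB))//.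
  have -> : m * B * (m * B) = m * m * (B * B) by ring.
  by rewrite ler_wpM2l ?mulr_ge0// ler_wpM2r.
have AB0 : 0 <= A * B by rewrite mulr_ge0.
have mAB0 : 0 <= m * (A * B) by rewrite mulr_ge0.
have mmAB0 : 0 <= m * m * (A * B) by rewrite !mulr_ge0.
have uA0 : 0 <= u * A by rewrite mulr_ge0.
have uB0 : 0 <= u * B by rewrite mulr_ge0.
split; [lra|lra|..].
- have -> : ((A + (B + u)) ^+ 2 - (A ^+ 2 + (B ^+ 2 + w))) / 2 =
    A * B + u * A + u * B + (u ^+ 2 - w) / 2 by field.
  lra.
- have -> : ((A + (B + u)) ^+ 2 - (A ^+ 2 + (B ^+ 2 + w))) / 2 =
    A * B + u * A + u * B + (u ^+ 2 - w) / 2 by field.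
  have -> : (m + 2) ^+ 2 * (A * B) = m * m * (A * B) + 4 * (m * (A * B)) + 4 * (A * B) by ring.
  have mE : m * B * A = m * (A * B) by ring.
  rewrite mE in uA uB'; lra.
Qed.

(** Both norms are elementary symmetric functions of the squared singular values, hence comparable
    to their largest terms. A positive [wdg M] keeps the second singular value away from 0, so that
    logarithms may be taken. *)
Lemma singular_values_bounds n (M : 'M[R]_n) : (2 <= n)%N -> 0 < wdg M ->
  [/\ 0 < singular_value M 1, 0 < singular_value M 2,
    singular_value M 1 <= fn M, fn M <= n%:R * singular_value M 1 &
    (singular_value M 1 * singular_value M 2 <= wdg M) /\
    (wdg M <= n%:R * (singular_value M 1 * singular_value M 2))].
Proof.
move=> n2 w0.
have [lam [chE lam0 f1E f2E]] := gram_spectrum M.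
have pE := singular_values_spectrum chE.
have szE : size (singular_values M) = n by rewrite (perm_size pE) size_map size_enum_ord.
have srt : sorted >=%R (singular_values M).
  by apply: sort_sorted => x y; exact: le_total.
have sum1 : \sum_(x <- singular_values M) x ^+ 2 = fn2 M.
  rewrite (perm_big _ pE) big_map big_enum f1E; apply: eq_bigr => i _.
  by rewrite sqr_sqrtr.
have sum2 : \sum_(x <- singular_values M) (x ^+ 2) ^+ 2 = fn2 (M^T *m M).
  rewrite (perm_big _ pE) big_map big_enum f2E; apply: eq_bigr => i _.
  by rewrite sqr_sqrtr.
have ge0 x : x \in singular_values M -> 0 <= x.
  by rewrite (perm_mem pE) => /mapP[i _ ->]; exact: sqrtr_ge0.
have w2E : wdg M ^+ 2 = (fn2 M ^+ 2 - fn2 (M^T *m M)) / 2 by rewrite sqr_wdg wdg2E.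
rewrite /singular_value; move: (singular_values M) szE srt sum1 sum2 ge0 => s.
case: s => [|a [|b t]]; try by move=> szE; rewrite -szE in n2.
move=> szE /= /andP[ba srt] sum1 sum2 ge0.
have b0 : 0 <= b by apply: ge0; rewrite !inE eqxx orbT.
have a0 : 0 <= a by apply: ge0; rewrite !inE eqxx.
have tb x : x \in t -> 0 <= x <= b.
  move=> xt; rewrite ge0 ?inE ?xt ?orbT//=.
  have /allP := order_path_min (rev_trans (@le_trans _ R)) srt.
  by apply.
have := two_largest b0 ba tb; cbv zeta; rewrite sum1 sum2 -w2E [(size t).+2]szE.
move=> -[h1 h2 h3 h4].
have n1 : 1 <= n%:R :> R by rewrite ler1n (leq_trans _ n2).
have n0 : 0 <= n%:R :> R by [].
have ab0 : 0 <= a * b by exact: mulr_ge0.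
have abgt0 : 0 < a * b.
  rewrite lt_def ab0 andbT; apply/eqP => ab.
  have : 0 < wdg M ^+ 2 by rewrite exprn_gt0.
  by move: h4; rewrite ab expr0n mulr0 => h; rewrite ltNge h.
have ageb := abgt0.
split.
- by rewrite lt_def a0 andbT; apply/eqP => ae; move: abgt0; rewrite ae mul0r ltxx.
- by rewrite lt_def b0 andbT; apply/eqP => be; move: abgt0; rewrite be mulr0 ltxx.
- by rewrite -(@ler_pXn2r _ 2)// ?nnegrE ?fn_ge0// sqr_fn.
- rewrite -(@ler_pXn2r _ 2)// ?nnegrE ?fn_ge0 ?mulr_ge0// sqr_fn (le_trans h2)//.
  by rewrite exprMn ler_wpM2r ?sqr_ge0// expr2 ler_peMl.
- split.
    by rewrite -(@ler_pXn2r _ 2)// ?nnegrE ?wdg_ge0.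
  by rewrite -(@ler_pXn2r _ 2)// ?nnegrE ?wdg_ge0 ?mulr_ge0// exprMn.
Qed.

End spectrum.

(** * Cocycles of bounded distortion *)

Section bounded_distortion.
Context {R : realType} (d : nat).
Implicit Types (M N : 'M[R]_d) (v : 'cV[R]_d).

(** The exponential scale makes the constants add under products, and the two-sided form makes them
    pass to inverses. *)
Definition bnd (k : R) M :=
  forall v, expR (- k) * fn v <= fn (M *m v) /\ fn (M *m v) <= expR k * fn v.

Lemma bnd1 : bnd 0 1%:M.
Proof. by move=> v; rewrite mul1mx oppr0 expR0 mul1r. Qed.

Lemma bnd_mul a b M N : bnd a M -> bnd b N -> bnd (a + b) (M *m N).
Proof.
move=> bM bN v; rewrite -mulmxA.
have [h1 h2] := bM (N *m v); have [h3 h4] := bN v.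
rewrite opprD !expRD -!mulrA; split.
  by rewrite (le_trans _ h1)// ler_wpM2l// expR_ge0.
by rewrite (le_trans h2)// ler_wpM2l// expR_ge0.
Qed.

Lemma bnd_weak a b M : a <= b -> bnd a M -> bnd b M.
Proof.
move=> ab bM v; have [h1 h2] := bM v; split.
  by rewrite (le_trans _ h1)// ler_wpM2r ?fn_ge0// ler_expR lerN2.
by rewrite (le_trans h2)// ler_wpM2r ?fn_ge0// ler_expR.
Qed.

Lemma bnd_neq0 k M v : bnd k M -> v != 0 -> M *m v != 0.
Proof.
move=> bM v0; have [h _] := bM v.
by rewrite -fn_gt0 (lt_le_trans _ h)// mulr_gt0 ?expR_gt0// fn_gt0.
Qed.

Lemma bnd_unit k M : bnd k M -> M \in unitmx.
Proof.
move=> bM; rewrite -unitmx_tr unitmxE unitfE; apply/negP => /det0P[v v0 vM].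
have : M *m v^T != 0.
  by apply: (bnd_neq0 bM); apply: contraNneq v0 => /(congr1 trmx); rewrite trmxK trmx0 => ->.
by rewrite -[M]trmxK -trmx_mul vM trmx0 eqxx.
Qed.

Lemma bnd_inv k M : bnd k M -> bnd k (invmx M).
Proof.
move=> bM v; have uM := bnd_unit bM; have := bM (invmx M *m v).
rewrite mulmxA mulmxV// mul1mx => -[h1 h2]; split.
  by rewrite expRN -ler_pdivlMl ?invr_gt0 ?expR_gt0// invrK.
by rewrite -ler_pdivrMl ?expR_gt0// -expRN.
Qed.

Lemma bnd_fn_le k M : bnd k M -> fn M <= d%:R * expR k.
Proof.
move=> bM; apply: fn_le_cols => [|j]; first exact: expR_ge0.
by rewrite colE; have [_] := bM (delta_mx j 0); rewrite fn_delta mulr1.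
Qed.

Lemma bnd_fn_ge k M : (0 < d)%N -> bnd k M -> expR (- k) <= fn M.
Proof.
move=> d0 bM; have [h _] := bM (delta_mx (Ordinal d0) 0).
by rewrite fn_delta mulr1 in h; rewrite (le_trans h)// -colE fn_col.
Qed.

Lemma bnd_wdg_le k M : bnd k M -> wdg M <= (d%:R * expR k) ^+ 2.
Proof.
move=> bM; rewrite (le_trans (wdg_le _))// ler_pXn2r ?nnegrE ?fn_ge0 ?mulr_ge0 ?expR_ge0//.
exact: bnd_fn_le.
Qed.

(** Submultiplicativity applied to M M^-1 = 1, together with the upper bound for the inverse. *)
Lemma bnd_wdg_ge k M : (2 <= d)%N -> bnd k M -> ((d%:R * expR k) ^+ 2)^-1 <= wdg M.
Proof.
move=> d2 bM; have uM := bnd_unit bM.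
have := wdg1_ge1 (R := R) d2; rewrite -(mulmxV uM) => /le_trans /(_ (wdg_mul _ _)) h.
have K0 : 0 < (d%:R * expR k) ^+ 2.
  by rewrite exprn_gt0// mulr_gt0 ?expR_gt0// ltr0n (leq_trans _ d2).
rewrite -[leLHS]mul1r ler_pdivrMr//; apply: (le_trans h).
by rewrite ler_wpM2l ?wdg_ge0//; exact: bnd_wdg_le (bnd_inv bM).
Qed.

Lemma bnd_wdg_gt0 k M : (2 <= d)%N -> bnd k M -> 0 < wdg M.
Proof.
move=> d2 /(bnd_wdg_ge d2); apply: lt_le_trans; rewrite invr_gt0 exprn_gt0//.
by rewrite mulr_gt0 ?expR_gt0// ltr0n (leq_trans _ d2).
Qed.

End bounded_distortion.

(** * Measurability and expectations along a cocycle *)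

Section matrix_measurability.
Context {R : realType} d' (S : measurableType d').

Definition mxmeas m n (F : S -> 'M[R]_(m, n)) :=
  forall i j, measurable_fun setT (fun s => F s i j).

Lemma mxmeas_cst m n (M : 'M[R]_(m, n)) : mxmeas (fun=> M).
Proof. by move=> i j; exact: measurable_cst. Qed.

Lemma measurable_sumR (I : Type) (s : seq I) (F : I -> S -> R) :
  (forall i, measurable_fun setT (F i)) ->
  measurable_fun setT (fun x => \sum_(i <- s) F i x).
Proof. by move=> mF; apply: measurable_sum. Qed.

Lemma mxmeas_mul m n p (F : S -> 'M[R]_(m, n)) (G : S -> 'M[R]_(n, p)) :
  mxmeas F -> mxmeas G -> mxmeas (fun s => F s *m G s).
Proof.
move=> mF mG i j; under eq_fun do rewrite mxE.
by apply: measurable_sumR => k; exact: measurable_funM.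
Qed.

Lemma mxmeas_tr m n (F : S -> 'M[R]_(m, n)) : mxmeas F -> mxmeas (fun s => (F s)^T).
Proof. by move=> mF i j; under eq_fun do rewrite mxE; exact: mF. Qed.

Lemma measurable_fn2 m n (F : S -> 'M[R]_(m, n)) :
  mxmeas F -> measurable_fun setT (fun s => fn2 (F s)).
Proof.
move=> mF; apply: measurable_sumR => i; apply: measurable_sumR => j.
by apply: measurable_funX; exact: mF.
Qed.

Lemma measurable_sqrtR (f : S -> R) : measurable_fun setT f ->
  measurable_fun setT (fun s => Num.sqrt (f s)).
Proof.
move=> mf; apply: (measurableT_comp (f := @Num.sqrt R)) => //.
by apply: continuous_measurable_fun; exact: sqrt_continuous.
Qed.

Lemma measurable_fn m n (F : S -> 'M[R]_(m, n)) :
  mxmeas F -> measurable_fun setT (fun s => fn (F s)).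
Proof. by move=> mF; apply: measurable_sqrtR; exact: measurable_fn2. Qed.

Lemma measurable_wdg m n (F : S -> 'M[R]_(m, n)) :
  mxmeas F -> measurable_fun setT (fun s => wdg (F s)).
Proof.
move=> mF; apply: measurable_sqrtR.
under eq_fun do rewrite wdg2E.
apply: measurable_funM => //; apply: measurable_funB.
  by apply: measurable_funX; exact: measurable_fn2.
by apply: measurable_fn2; apply: mxmeas_mul => //; exact: mxmeas_tr.
Qed.

End matrix_measurability.

Section nice.
Context {R : realType} (d : nat).
Implicit Types (M : 'M[R]_d) (phi psi : 'M[R]_d -> R).

(* Functions of a matrix that can be integrated along every cocycle of bounded
   distortion, whatever its base space. *)
Definition nice phi :=
  (forall k, exists C, forall M, bnd k M -> `|phi M| <= C) /\
  (forall k d' (S : measurableType d') (F : S -> 'M[R]_d), mxmeas F ->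
     (forall s, bnd k (F s)) -> measurable_fun setT (fun s => phi (F s))).

Lemma nice_bm phi k d' (S : measurableType d') (F : S -> 'M[R]_d) :
  nice phi -> mxmeas F -> (forall s, bnd k (F s)) -> bm (fun s => phi (F s)).
Proof.
move=> [bphi mphi] mF bF; split; first exact: (mphi k).
by have [C hC] := bphi k; exists C => s; exact: hC.
Qed.

Lemma nice_of_bm phi :
  (forall k, exists C, forall M, bnd k M -> `|phi M| <= C) ->
  (forall k d' (S : measurableType d') (F : S -> 'M[R]_d), mxmeas F ->
     (forall s, bnd k (F s)) -> bm (fun s => phi (F s))) -> nice phi.
Proof. by move=> h1 h2; split => // k d' S F mF bF; have [] := h2 k d' S F mF bF. Qed.

Lemma nice_cst c : nice (fun=> c).
Proof. by split => [k|k d' S F _ _]; [exists (Num.norm c)|exact: measurable_cst]. Qed.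

Lemma niceD phi psi : nice phi -> nice psi -> nice (fun M => phi M + psi M).
Proof.
move=> nphi npsi; apply: nice_of_bm => [k|k d' S F mF bF].
  have [C hC] := nphi.1 k; have [D hD] := npsi.1 k.
  by exists (C + D) => M bM; rewrite (le_trans (ler_normD _ _))// lerD ?hC ?hD.
by apply: bmD; exact: nice_bm bF.
Qed.

Lemma niceM phi psi : nice phi -> nice psi -> nice (fun M => phi M * psi M).
Proof.
move=> nphi npsi; apply: nice_of_bm => [k|k d' S F mF bF].
  have [C hC] := nphi.1 k; have [D hD] := npsi.1 k.
  by exists (C * D) => M bM; rewrite normrM ler_pM ?hC ?hD.
by apply: bmM; exact: nice_bm bF.
Qed.

Lemma niceZ c phi : nice phi -> nice (fun M => c * phi M).
Proof. by move=> h; apply: niceM => //; exact: nice_cst. Qed.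

Lemma niceN phi : nice phi -> nice (fun M => - phi M).
Proof.
move=> h; have := niceZ (-1) h; congr nice; apply/funext => M; exact: mulN1r.
Qed.

Lemma niceB phi psi : nice phi -> nice psi -> nice (fun M => phi M - psi M).
Proof. by move=> h1 h2; apply: niceD => //; exact: niceN. Qed.

Lemma nice_exp phi : nice phi -> nice (fun M => expR (phi M)).
Proof.
move=> [bphi mphi]; split => [k|k d' S F mF bF].
  have [C hC] := bphi k; exists (expR C) => M bM.
  by rewrite ger0_norm ?expR_ge0// ler_expR (le_trans (ler_norm _))// hC.
apply: measurableT_comp; first exact: measurable_expR.
exact: mphi bF.
Qed.

Lemma nice_ln phi : nice phi ->
  (forall k, exists2 c, 0 < c & forall M, bnd k M -> c <= phi M) ->
  nice (fun M => ln (phi M)).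
Proof.
move=> [bphi mphi] lphi; split => [k|k d' S F mF bF].
  have [C hC] := bphi k; have [c c0 hc] := lphi k.
  exists (`|ln c| + `|ln C|) => M bM.
  have cM := hc M bM; have MC := le_trans (ler_norm _) (hC M bM).
  have M0 := lt_le_trans c0 cM; have C0 := lt_le_trans M0 MC.
  have h1 : ln c <= ln (phi M) by rewrite ler_ln.
  have h2 : ln (phi M) <= ln C by rewrite ler_ln.
  rewrite ler_norml; apply/andP; split.
    by rewrite (le_trans _ h1)// lerNl (le_trans (ler_norm _))// normrN lerDl.
  by rewrite (le_trans h2)// (le_trans (ler_norm _))// lerDr.
apply: measurableT_comp; first exact: measurable_ln.
exact: mphi bF.
Qed.

Lemma nice_fn_mul p (N : 'M[R]_(d, p)) : nice (fun M => fn (M *m N)).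
Proof.
split => [k|k d' S F mF bF].
  exists (d%:R * expR k * fn N) => M bM; rewrite ger0_norm ?fn_ge0//.
  by rewrite (le_trans (fn_mul _ _))// ler_wpM2r ?fn_ge0// bnd_fn_le.
by apply: measurable_fn; apply: mxmeas_mul => //; exact: mxmeas_cst.
Qed.

Lemma nice_wdg : nice (@wdg R d d).
Proof.
split => [k|k d' S F mF bF]; last exact: measurable_wdg.
exists ((d%:R * expR k) ^+ 2) => M bM; rewrite ger0_norm ?wdg_ge0//.
exact: bnd_wdg_le.
Qed.

Lemma nice_ln_fn : (0 < d)%N -> nice (fun M => ln (fn M)).
Proof.
move=> d0; apply: nice_ln => [|k].
  have := nice_fn_mul (1%:M : 'M[R]_d); congr nice.
  by apply/funext => M; rewrite mulmx1.
by exists (expR (- k)); [exact: expR_gt0|move=> M; exact: bnd_fn_ge].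
Qed.

Lemma nice_ln_wdg : (2 <= d)%N -> nice (fun M => ln (wdg M)).
Proof.
move=> d2; apply: (nice_ln nice_wdg) => k.
exists (((d%:R * expR k) ^+ 2)^-1); last by move=> M; exact: bnd_wdg_ge.
by rewrite invr_gt0 exprn_gt0// mulr_gt0 ?expR_gt0// ltr0n (leq_trans _ d2).
Qed.

(** Normalized by the length of [v], this is an additive cocycle ([lnv_mul]) that depends only on
    the line of [v]. *)
Definition lnv (v : 'cV[R]_d) M : R := ln (fn (M *m v)) - ln (fn v).

Lemma nice_lnv v : v != 0 -> nice (lnv v).
Proof.
move=> v0; apply: niceB; last exact: nice_cst.
apply: nice_ln => [|k]; first exact: nice_fn_mul.
exists (expR (- k) * fn v); first by rewrite mulr_gt0 ?expR_gt0 ?fn_gt0.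
by move=> M /(_ v)[].
Qed.

Lemma lnv_mul v M M' : lnv v (M' *m M) = lnv v M + lnv (M *m v) M'.
Proof. by rewrite /lnv -mulmxA; ring. Qed.

Lemma lnv_bnd k v M : v != 0 -> bnd k M -> `|lnv v M| <= k.
Proof.
move=> v0 bM; have [h1 h2] := bM v.
have fv : 0 < fn v by rewrite fn_gt0.
have fMv : 0 < fn (M *m v) by rewrite fn_gt0 (bnd_neq0 bM).
rewrite /lnv ler_norml lerBrDr lerBlDr; apply/andP; split.
  by rewrite -[- k]expRK -lnM ?posrE ?expR_gt0// ler_ln// posrE mulr_gt0 ?expR_gt0.
by rewrite -[X in _ <= X + _]expRK -lnM ?posrE ?expR_gt0// ler_ln// posrE mulr_gt0 ?expR_gt0.
Qed.

Lemma lnvZ c v M : c != 0 -> v != 0 -> M *m v != 0 -> lnv (c *: v) M = lnv v M.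
Proof.
move=> c0 v0 Mv0; rewrite /lnv -scalemxAr !fnZ !lnM ?posrE ?normr_gt0 ?fn_gt0//; ring.
Qed.

End nice.

Section cocycle_iterates.
Context {R : realType} (d : nat) d0 (T : measurableType d0).
Variables (A : T -> 'M[R]_d).
Local Notation Om := (prodT int T).

(** The recursion of [iterate], over an arbitrary measurable base and without continuity or
    invertibility of [A]; it is also applied to restrictions to subspaces. *)
Fixpoint it (w : int -> T) (n : nat) : 'M[R]_d :=
  if n is k.+1 then A (w k%:Z) *m it w k else 1%:M.

Lemma eq_it w w' n : (forall i : nat, (i < n)%N -> w i%:Z = w' i%:Z) -> it w n = it w' n.
Proof.
elim: n => //= n IH h; rewrite h// IH// => i ilt; apply: h; exact: leq_trans ilt _.
Qed.

Lemma it_add w n m : it w (n + m) = it (shiftn n w) m *m it w n.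
Proof.
elim: m => [|m IH]; first by rewrite addn0 mul1mx.
by rewrite addnS /= IH mulmxA /shiftn -PoszD addnC.
Qed.

Lemma it_splice (w w' : Om) n m : it (splice n (w, w')) (n + m) = it w' m *m it w n.
Proof.
rewrite it_add; congr (_ *m _).
  apply: eq_it => i _; rewrite /shiftn /splice /=.
  by rewrite -PoszD ltz_nat ltnNge leq_addl/= PoszD addrK.
by apply: eq_it => i ilt; rewrite /splice ltz_nat ilt.
Qed.

Hypothesis mA : mxmeas A.

Lemma mxmeas_it n : mxmeas (fun w : Om => it w n).
Proof.
elim: n => [|n IH] /=; first exact: mxmeas_cst.
apply: mxmeas_mul => // i j.
apply: (measurableT_comp (f := fun x => A x i j)); first exact: mA.
exact: measurable_coord.
Qed.

Variables (kappa : R) (kappa0 : 0 <= kappa) (bA : forall x, bnd kappa (A x)).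

Lemma bnd_it w n : bnd (n%:R * kappa) (it w n).
Proof.
elim: n => [|n IH] /=; first by rewrite mul0r; exact: bnd1.
by rewrite -natr1 mulrDl mul1r addrC; exact: bnd_mul.
Qed.

Variables (mu : probability T R) (P : probability Om R) (PI : iid_law mu P).

Definition EE n (phi : 'M[R]_d -> R) : R := Ex P (fun w => phi (it w n)).

Lemma bm_it n phi : nice phi -> bm (fun w : Om => phi (it w n)).
Proof. by move=> nphi; apply: (nice_bm nphi (mxmeas_it n)) => w; exact: bnd_it. Qed.

Lemma EE_cst n c : EE n (fun=> c) = c.
Proof. exact: Ex_cst. Qed.

Lemma EED n phi psi : nice phi -> nice psi ->
  EE n (fun M => phi M + psi M) = EE n phi + EE n psi.
Proof. by move=> h1 h2; rewrite /EE ExD//; exact: bm_it. Qed.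

Lemma EEB n phi psi : nice phi -> nice psi ->
  EE n (fun M => phi M - psi M) = EE n phi - EE n psi.
Proof. by move=> h1 h2; rewrite /EE ExB//; exact: bm_it. Qed.

Lemma EEZ n c phi : nice phi -> EE n (fun M => c * phi M) = c * EE n phi.
Proof. by move=> h; rewrite /EE ExZ//; exact: bm_it. Qed.

Lemma le_EE n phi psi : nice phi -> nice psi ->
  (forall M, bnd (n%:R * kappa) M -> phi M <= psi M) -> EE n phi <= EE n psi.
Proof.
move=> h1 h2 h; apply: le_Ex; [exact: bm_it|exact: bm_it|].
by move=> w; apply: h; exact: bnd_it.
Qed.

Lemma le_EE_cst n phi c : nice phi ->
  (forall M, bnd (n%:R * kappa) M -> phi M <= c) -> EE n phi <= c.
Proof. by move=> h H; rewrite -(EE_cst n c); apply: le_EE => //; exact: nice_cst. Qed.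

Lemma ge_EE_cst n phi c : nice phi ->
  (forall M, bnd (n%:R * kappa) M -> c <= phi M) -> c <= EE n phi.
Proof. by move=> h H; rewrite -(EE_cst n c); apply: le_EE => //; exact: nice_cst. Qed.

Lemma norm_EE_le n phi c : nice phi ->
  (forall M, bnd (n%:R * kappa) M -> `|phi M| <= c) -> `|EE n phi| <= c.
Proof.
move=> h H; apply: norm_Ex_le; first exact: bm_it.
by move=> w; apply: H; exact: bnd_it.
Qed.

Lemma nice_mulr k phi (M : 'M[R]_d) :bnd k M -> nice phi -> nice (fun M' => phi (M' *m M)).
Proof.
move=> bM [h1 h2]; split => [l|l d' S F mF bF].
  by have [C hC] := h1 (l + k); exists C => M' bM'; apply: hC; exact: bnd_mul.
apply: (h2 (l + k)); first by apply: mxmeas_mul => //; exact: mxmeas_cst.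
by move=> s; exact: bnd_mul.
Qed.

Lemma bm_joint m phi k d' (S : measurableType d') (F : S -> 'M[R]_d) :
  nice phi -> mxmeas F -> (forall s, bnd k (F s)) ->
  bm (fun p : S * Om => phi (it p.2 m *m F p.1)).
Proof.
move=> nphi mF bF.
apply: (@nice_bm _ _ phi (m%:R * kappa + k) _ _ (fun p : S * Om => it p.2 m *m F p.1)) => //.
  apply: mxmeas_mul => i j.
    apply: (measurableT_comp (f := fun w : Om => it w m i j)); first exact: mxmeas_it.
    exact: measurable_snd.
  apply: (measurableT_comp (f := fun s => F s i j)); first exact: mF.
  exact: measurable_fst.
by move=> p; apply: bnd_mul; [exact: bnd_it|].
Qed.

Lemma nice_EE m phi : nice phi -> nice (fun M => EE m (fun M' => phi (M' *m M))).
Proof.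
move=> nphi; split => [k|k d' S F mF bF].
  have [C hC] := nphi.1 (m%:R * kappa + k); exists C => M bM.
  apply: norm_EE_le; first exact: (nice_mulr bM).
  by move=> M' bM'; apply: hC; exact: bnd_mul.
(* Only the measurability of the partial integral is wanted; the Dirac mass on [S] merely fills the
   argument for the first measure. *)
have [] // := @bm_Ex_section _ _ S Om R (\d_(point : S) : probability S R) P
  (fun p => phi (it p.2 m *m F p.1)) (bm_joint m nphi mF bF).
Qed.

(** The Markov property: the later [m] factors are independent of the first [n] and have the law of
    an iterate started afresh. *)
Lemma EE_comp n m phi : nice phi ->
  EE (n + m) phi = EE n (fun M => EE m (fun M' => phi (M' *m M))).
Proof.
move=> nphi; rewrite /EE (iid_splice PI n); last exact: bm_it.
by apply: eq_Ex => w; apply: eq_Ex => w'; rewrite it_splice.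
Qed.

Lemma EE0 phi : EE 0 phi = phi 1%:M.
Proof. by rewrite /EE /= Ex_cst. Qed.

Lemma EE1 phi : nice phi -> EE 1 phi = Ex mu (fun x => phi (A x)).
Proof.
move=> nphi; rewrite -(iid_coord PI 0); last exact: (nice_bm nphi mA bA).
by apply: eq_Ex => w /=; rewrite mulmx1.
Qed.

End cocycle_iterates.

(** * The Furstenberg-Kesten theorem *)

Lemma archimedean_mul (R : realType) (B c : R) : 0 < c -> exists N : nat, B <= N%:R * c.
Proof.
move=> c0; exists (Num.bound (`|B| / c)); rewrite -ler_pdivrMr//.
apply: (le_trans _ (ltW (archi_boundP _))); last by rewrite divr_ge0// ltW.
by rewrite ler_pM2r ?invr_gt0// ler_norm.
Qed.

Section probability_tools.
Context {R : realType} d (X : measurableType d).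

Lemma measurable_lt_set (f : X -> R) c : measurable_fun setT f ->
  measurable [set x | f x < c].
Proof.
move=> mf; have := mf measurableT _ (measurable_itv `]-oo, c[); rewrite setTI.
by congr measurable; apply/seteqP; split => x /=; rewrite in_itv.
Qed.

Lemma measurable_le_set (f : X -> R) c : measurable_fun setT f ->
  measurable [set x | f x <= c].
Proof.
move=> mf; have := mf measurableT _ (measurable_itv `]-oo, c]); rewrite setTI.
by congr measurable; apply/seteqP; split => x /=; rewrite in_itv.
Qed.

Lemma measurable_gt_set (f : X -> R) c : measurable_fun setT f ->
  measurable [set x | c < f x].
Proof.
move=> mf; rewrite (_ : mkset _ = ~` [set x | f x <= c]).
  by apply: measurableC; exact: measurable_le_set.
by apply/seteqP; split => x /=; rewrite ltNge => /negP.
Qed.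

Lemma measurable_ge_set (f : X -> R) c : measurable_fun setT f ->
  measurable [set x | c <= f x].
Proof.
move=> mf; rewrite (_ : mkset _ = ~` [set x | f x < c]).
  by apply: measurableC; exact: measurable_lt_set.
by apply/seteqP; split => x /=; rewrite leNgt => /negP.
Qed.

Variable P : probability X R.

Lemma ae_and (A B D : X -> Prop) : {ae P, forall x, A x} -> {ae P, forall x, B x} ->
  (forall x, A x -> B x -> D x) -> {ae P, forall x, D x}.
Proof. by move=> hA hB h; apply: filterS (filterI hA hB) => x []; exact: h. Qed.

Lemma exponential_markov (f : X -> R) : bm f -> measurable [set x | 0 < f x] ->
  fine (P [set x | 0 < f x]) <= Ex P (fun x => expR (f x)).
Proof.
move=> bf mF; rewrite -(Ex_indic P mF); apply: le_Ex.
- exact: bm_indic.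
- case: bf => mf [C hC]; split.
    by apply: measurableT_comp => //; exact: measurable_expR.
  exists (expR C) => x; rewrite ger0_norm ?expR_ge0// ler_expR.
  by rewrite (le_trans (ler_norm _)).
- move=> x; rewrite indicE; case: (boolP (x \in _)) => [/set_mem/= fx|_]; last exact: expR_ge0.
  by rewrite -expR0 ler_expR ltW.
Qed.

Lemma geometric_borel_cantelli (F : (set X)^nat) (rho : R) : 0 <= rho -> rho < 1 ->
  (forall k, measurable (F k)) -> (forall k, fine (P (F k)) <= rho ^+ k) ->
  {ae P, forall x, exists K, forall k, (K <= k)%N -> ~ F k x}.
Proof.
move=> r0 r1 mF PF.
have : P (lim_sup_set F) = 0%E.
  apply: lim_sup_set_cvg0 => //.
  apply: (@le_lt_trans _ _ ((1 - rho)^-1)%:E); last exact: ltry.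
  apply: lime_le; first by apply: is_cvg_nneseries.
  apply: nearW => n.
  apply: (@le_trans _ _ (\sum_(0 <= k < n) (rho ^+ k)%:E)%E).
    apply: lee_sum => k _; rewrite -[X in (X <= _)%E]fineK ?lee_fin; first exact: PF.
    by rewrite fin_num_measure.
  rewrite sumEFin lee_fin.
  have rn0 : 1 - rho != 0 by rewrite subr_eq0 eq_sym lt_eqF.
  have -> : \sum_(0 <= k < n) rho ^+ k = (1 - rho ^+ n) / (1 - rho).
    elim: n => [|n IH]; first by rewrite big_geq// expr0 subrr mul0r.
    by rewrite big_nat_recr//= IH exprS; field.
  rewrite ler_pdivrMr ?subr_gt0// mulVf// lerBlDr lerDl.
  exact: exprn_ge0.
move=> PF0; exists (lim_sup_set F); split => //.
  apply: bigcapT_measurable => n; apply: bigcup_measurable => k _; exact: mF.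
move=> x /= /forallNP nx n _.
have /existsNP[k /not_implyP[nk /contrapT Fk]] := nx n.
by exists k.
Qed.

End probability_tools.

Section exponential_moment.
Context {R : realType}.

(** From exp(-y) >= 1 - y one gets exp y <= 1 / (1 - y), and this is at most the quadratic for y <=
    1/2. *)
Lemma expR_le_quadratic (y : R) : y <= 2^-1 -> expR y <= 1 + y + 2 * y ^+ 2.
Proof.
move=> y2; have y1 : 0 < 1 - y by lra.
have : 1 - y <= expR (- y) by have := expR_ge1Dx (- y); lra.
rewrite expRN => h.
have -> : expR y = ((expR y)^-1)^-1 by rewrite invrK.
apply: (@le_trans _ _ (1 - y)^-1).
  by rewrite lef_pV2 ?posrE ?invr_gt0 ?expR_gt0.
rewrite -[leLHS]mul1r ler_pdivrMr//.
have -> : (1 + y + 2 * y ^+ 2) * (1 - y) = 1 + y ^+ 2 * (1 - 2 * y) by ring.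
by rewrite lerDl mulr_ge0 ?sqr_ge0//; lra.
Qed.

(** For small t the linear term t E f dominates the quadratic error. That t depends only on [Z] and
    [delta], not on the space, the law or [f], is what makes later estimates uniform in the vector
    and the cocycle; t <= 1 lets it serve as a Hoelder exponent. *)
Lemma exponential_moment (Z delta : R) : 0 < Z -> 0 < delta ->
  exists t, [/\ 0 < t, t <= 1 & forall d (X : measurableType d) (P : probability X R) f,
    bm f -> (forall x, `|f x| <= Z) -> Ex P f <= - delta ->
    Ex P (fun x => expR (t * f x)) <= expR (- (t * delta / 2))].
Proof.
move=> Z0 delta0.
(* The second bound gives t |f| <= 1/2, as the quadratic estimate requires; the third makes 2 (t
   Z)^2 at most half of t [delta]. *)
pose t := Num.min 1 (Num.min (2 * Z)^-1 (delta / (4 * Z ^+ 2))).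
have t0 : 0 < t.
  by rewrite /t !lt_min ltr01 invr_gt0 mulr_gt0//= divr_gt0// mulr_gt0// exprn_gt0.
have t1 : t <= 1 by rewrite /t ge_min lexx.
have t2 : t <= (2 * Z)^-1 by rewrite /t !ge_min lexx orbT.
have t3 : t <= delta / (4 * Z ^+ 2) by rewrite /t !ge_min lexx !orbT.
exists t; split => // d X P f bf fZ Ef.
have b1 : bm (fun x => 1 + t * f x) by apply: bmD; [exact: bm_cst|exact: bmZ].
have b2 : bm (fun x => 1 + t * f x + 2 * (t * Z) ^+ 2).
  by apply: bmD => //; exact: bm_cst.
have be : bm (fun x => expR (t * f x)).
  have [mf _] := bf; split.
    apply: measurableT_comp; first exact: measurable_expR.
    exact: measurable_funM.
  exists (expR (t * Z)) => x; rewrite ger0_norm ?expR_ge0// ler_expR.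
  by rewrite ler_wpM2l ?(ltW t0)// (le_trans (ler_norm _)).
apply: (@le_trans _ _ (Ex P (fun x => 1 + t * f x + 2 * (t * Z) ^+ 2))).
  apply: le_Ex => // x.
  have tf : `|t * f x| <= t * Z by rewrite normrM gtr0_norm// ler_wpM2l// ltW.
  have tf2 : t * f x <= 2^-1.
    rewrite (le_trans (le_trans (ler_norm _) tf))//.
    move: t2; rewrite -[(2 * Z)^-1]mul1r ler_pdivlMr ?mulr_gt0// => h; lra.
  apply: (le_trans (expR_le_quadratic tf2)); rewrite lerD2l ler_wpM2l//.
  by rewrite -[leLHS]real_normK ?num_real// ler_pXn2r// nnegrE// mulr_ge0// ltW.
rewrite ExD//; last exact: bm_cst.
rewrite ExD; [|exact: bm_cst|exact: bmZ].
rewrite !Ex_cst ExZ//.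
apply: (@le_trans _ _ (1 + - (t * delta / 2))); last exact: expR_ge1Dx.
rewrite -addrA lerD2l.
have h1 : t * Ex P f <= - (t * delta).
  by rewrite -mulrN ler_wpM2l// ltW.
have h2 : 2 * (t * Z) ^+ 2 <= t * delta / 2.
  have : t * (4 * Z ^+ 2) <= delta by rewrite -ler_pdivlMr// mulr_gt0// exprn_gt0.
  move=> /(ler_wpM2l (ltW t0)).
  have -> : 2 * (t * Z) ^+ 2 = t * (t * (4 * Z ^+ 2)) / 2 by field.
  by move=> h; rewrite ler_pM2r// invr_gt0.
lra.
Qed.

End exponential_moment.

Section furstenberg_kesten.
Context {R : realType} (d : nat) d0 (T : measurableType d0).
Variables (A : T -> 'M[R]_d) (mA : mxmeas A).
Variables (kappa : R) (kappa0 : 0 <= kappa) (bA : forall x, bnd kappa (A x)).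
Variables (mu : probability T R).
Local Notation Om := (prodT int T).
Variables (P : probability Om R) (PI : iid_law mu P).
Variables (H : 'M[R]_d -> R) (nH : nice H) (C : R) (C0 : 0 <= C).
(** [H] will be the logarithm of [fn] or of [wdg]. [H_low] bounds the loss when the first factor is
    removed, which makes the set of low sequences stable under the shift. *)
Hypothesis H_sub : forall k k' M M', bnd k M -> bnd k' M' -> H (M' *m M) <= H M + H M'.
Hypothesis H_low : forall k M M', bnd kappa M -> bnd k M' -> H M' - C <= H (M' *m M).
Hypothesis H_bnd : forall (n : nat) M, bnd (n%:R * kappa) M -> `|H M| <= C * n.+1%:R.

Local Notation g n := (EE A P n H).

Lemma H_it_le (w : Om) n : `|H (it A w n)| <= C * n.+1%:R.
Proof. by apply: H_bnd; exact: bnd_it. Qed.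

Lemma H_it_add (w : Om) n m : H (it A w (n + m)) <= H (it A w n) + H (it A (shiftn n w) m).
Proof. by rewrite it_add; apply: H_sub; exact: bnd_it. Qed.

Lemma g_le n : `|g n| <= C * n.+1%:R.
Proof. by apply: (norm_EE_le mA bA) => // M bM; exact: H_bnd. Qed.

Lemma g_sub n m : g (n + m)%N <= g n + g m.
Proof.
rewrite (EE_comp mA bA PI)// -(EE_cst A P n (g m)) -(EED mA bA)//; last exact: nice_cst.
apply: (le_EE mA bA).
- exact: (nice_EE mA bA).
- by apply: niceD => //; exact: nice_cst.
move=> M bM; rewrite -(EE_cst A P m (H M)) -(EED mA bA)//; last exact: nice_cst.
apply: (le_EE mA bA).
- exact: (nice_mulr bM).
- by apply: niceD => //; exact: nice_cst.
by move=> M' bM'; exact: H_sub bM bM'.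
Qed.

(** By Fekete's lemma this infimum is the limit of the averages; the index [n.+1] avoids time 0. *)
Definition growth : R := inf [set EE A P n.+1 H / n.+1%:R | n in [set: nat]].
Local Notation gam := growth.

Lemma growth_has_inf : has_inf [set EE A P n.+1 H / n.+1%:R | n in [set: nat]].
Proof.
split; first by exists (EE A P 1 H / 1%:R), 0%N.
exists (- (2 * C)) => _ [n _ <-]; rewrite ler_pdivlMr ?ltr0n// mulNr.
rewrite lerNl (le_trans (ler_norm _))// normrN (le_trans (g_le _))//.
rewrite [2 * C]mulrC -mulrA ler_wpM2l// -natrM ler_nat; lia.
Qed.

Lemma growth_leS n : (0 < n)%N -> n%:R * gam <= g n.
Proof.
case: n => // n _.
have : gam <= g n.+1 / n.+1%:R by apply: ge_inf; [have [] := growth_has_inf|exists n].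
by rewrite ler_pdivlMr ?ltr0n// mulrC.
Qed.

Lemma growth_attained (e : R) : 0 < e -> exists2 m, (0 < m)%N & g m < m%:R * (gam + e).
Proof.
move=> e0; have [_ [n _ <-] h] := inf_adherent e0 growth_has_inf.
by exists n.+1 => //; move: h; rewrite ltr_pdivrMr ?ltr0n// mulrC.
Qed.

Lemma nice_expH t c : nice (fun M => expR (t * (H M - c))).
Proof. by apply: nice_exp; apply: niceZ; apply: niceB => //; exact: nice_cst. Qed.

(** Subadditivity of [H] inside the exponential, and independence of the two blocks of steps. *)
Lemma exp_EE_submult (t : R) n m a b : 0 <= t ->
  EE A P (n + m) (fun M => expR (t * (H M - (a + b)))) <=
  EE A P n (fun M => expR (t * (H M - a))) * EE A P m (fun M => expR (t * (H M - b))).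
Proof.
move=> t0; have nab := nice_expH t (a + b).
rewrite (EE_comp mA bA PI)// [leRHS]mulrC -(EEZ mA bA); last exact: nice_expH.
apply: (le_EE mA bA).
- exact: (nice_EE mA bA _ m nab).
- by apply: niceZ; exact: nice_expH.
move=> M bM; rewrite mulrC -(EEZ mA bA); last exact: nice_expH.
apply: (le_EE mA bA).
- exact: (nice_mulr bM nab).
- by apply: niceZ; exact: nice_expH.
move=> M' bM'; rewrite -expRD ler_expR -mulrDr ler_wpM2l//.
have := H_sub bM bM'; lra.
Qed.

(** Some block length [m] has mean below m (gam + e/2). Relative to gam + e this is a negative
    drift, whose exponential moment is below 1 and is raised to the power [k] by independence. The
    factor [expR C] covers [k] = 0, where [H] of the identity is at most [C]. *)
Lemma exponential_upper_bound (e : R) : 0 < e -> exists m t rho, [/\ (0 < m)%N, 0 < t,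
  0 < rho, rho < 1 & forall k,
  EE A P (k * m) (fun M => expR (t * (H M - (k * m)%:R * (gam + e)))) <= expR C * rho ^+ k].
Proof.
move=> e0; have [m m0 gm] := growth_attained (divr_gt0 e0 (ltr0n R 2)).
pose phi M := H M - m%:R * (gam + e).
have nphi : nice phi by apply: niceB => //; exact: nice_cst.
have mR0 : 0 < m%:R :> R by rewrite ltr0n.
pose Z := C * m.+1%:R + `|m%:R * (gam + e)| + 1.
have Z0 : 0 < Z by rewrite /Z ltr_pwDr// addr_ge0// mulr_ge0.
have delta0 : 0 < m%:R * (e / 2) by rewrite mulr_gt0// divr_gt0.
have [t [t0 t1 Ht]] := exponential_moment Z0 delta0.
exists m, t, (expR (- (t * (m%:R * (e / 2)) / 2))); split => //.
- exact: expR_gt0.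
- by rewrite -[ltRHS]expR0 ltr_expR oppr_lt0 divr_gt0// mulr_gt0.
have base : EE A P m (fun M => expR (t * phi M)) <= expR (- (t * (m%:R * (e / 2)) / 2)).
  apply: (Ht _ _ P (fun w => phi (it A w m))).
  - exact: (bm_it mA bA).
  - move=> w; rewrite /phi /Z (le_trans (ler_normB _ _))//.
    by have := H_it_le w m; lra.
  - have : EE A P m phi = g m - m%:R * (gam + e).
      by rewrite /phi (EEB mA bA)//; [rewrite EE_cst|exact: nice_cst].
    by rewrite -[Ex P _]/(EE A P m phi) => ->; move: gm; rewrite !mulrDr; lra.
elim => [|k IH].
  rewrite mul0n EE0 mul0r subr0 expr0 mulr1 ler_expR.
  have := H_bnd (n := 0) (M := 1%:M); rewrite mul0r mulr1 => /(_ (@bnd1 R d)) h1.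
  have := le_trans (ler_norm _) h1 => h2.
  have : t * H 1%:M <= t * C by rewrite ler_wpM2l// ltW.
  move/le_trans; apply; rewrite ler_piMl//.
rewrite mulSn natrD mulrDl exprS mulrCA.
apply: (le_trans (exp_EE_submult _ _ _ _ (ltW t0))).
apply: ler_pM => //.
- by apply: Ex_ge0 => w; exact: expR_ge0.
- by apply: Ex_ge0 => w; exact: expR_ge0.
Qed.

(** Borel-Cantelli along the multiples of [m]; a remainder of fewer than [m] steps costs a constant,
    absorbed by n e/2. *)
Lemma growth_upper_ae (e : R) : 0 < e -> {ae P, forall w, exists N, forall n, (N <= n)%N ->
  H (it A w n) <= n%:R * (gam + e)}.
Proof.
move=> e0; have e20 : 0 < e / 2 by rewrite divr_gt0.
have [m [t [rho [m0 t0 r0 r1 Hk]]]] := exponential_upper_bound e20.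
(* Subtracting [C] cancels the factor [expR C] of the moment bound. *)
pose f k (w : Om) := t * (H (it A w (k * m)) - (k * m)%:R * (gam + e / 2)) - C.
have bf k : bm (f k).
  apply: bmB; last exact: bm_cst.
  apply: bmZ; apply: bmB; last exact: bm_cst.
  exact: (bm_it mA bA).
pose F k := [set w : Om | 0 < f k w].
have mF k : measurable (F k) by apply: measurable_gt_set; case: (bf k).
have PF k : fine (P (F k)) <= rho ^+ k.
  apply: (le_trans (exponential_markov P (bf k) (mF k))).
  rewrite -(ler_pM2l (expR_gt0 C)); apply: le_trans (Hk k).
  rewrite -ExZ; last first.
    have nh := nice_exp (niceB (niceZ t (niceB nH (nice_cst _ ((k * m)%:R * (gam + e / 2))))) (nice_cst _ C)).
    exact: (bm_it mA bA (k * m) nh).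
  rewrite /EE le_eqVlt; apply/orP; left; apply/eqP; apply: eq_Ex => w.
  by rewrite -expRD; congr expR; rewrite /f; ring.
have := geometric_borel_cantelli (ltW r0) r1 mF PF.
apply: filterS => w [K HK].
pose B := `|gam + e / 2| * m%:R + C * m.+1%:R + C / t.
have B0 : 0 <= B by rewrite /B !addr_ge0// ?mulr_ge0// ?invr_ge0// ltW.
have [N1 HN1] : exists N1 : nat, B <= N1%:R * (e / 2).
  exact: archimedean_mul.
exists (maxn N1 (K * m))%N => n; rewrite geq_max => /andP[nN1 nK].
pose k := (n %/ m)%N; pose r := (n %% m)%N.
have nE : n = (k * m + r)%N by exact: divn_eq.
have kK : (K <= k)%N by rewrite leq_divRL.
have rm : (r < m)%N by rewrite ltn_mod.
have := HK k kK; rewrite /F /f /= => /negP; rewrite -leNgt subr_le0 => hk.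
have hk' : H (it A w (k * m)) <= (k * m)%:R * (gam + e / 2) + C / t.
  by rewrite -lerBlDl ler_pdivlMr// mulrC.
have h1 := H_it_add w (k * m) r; rewrite -nE in h1.
have h2 := le_trans (ler_norm _) (H_it_le (shiftn (k * m) w) r).
have h3 : C * r.+1%:R <= C * m.+1%:R by rewrite ler_wpM2l// ler_nat ltnS ltnW.
have h4 : (k * m)%:R * (gam + e / 2) <= n%:R * (gam + e / 2) + `|gam + e / 2| * m%:R.
  rewrite {1}nE natrD mulrDl -addrA lerDl.
  have := ler_norm (- (gam + e / 2)); rewrite normrN => h.
  have hr : r%:R <= m%:R :> R by rewrite ler_nat ltnW.
  have r0' : 0 <= r%:R :> R by [].
  have : `|gam + e / 2| * r%:R <= `|gam + e / 2| * m%:R by rewrite ler_wpM2l.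
  have : - (gam + e / 2) * r%:R <= `|gam + e / 2| * r%:R by rewrite ler_wpM2r.
  lra.
have h5 : N1%:R * (e / 2) <= n%:R * (e / 2) by rewrite ler_wpM2r ?(ltW e20)// ler_nat.
have -> : n%:R * (gam + e) = n%:R * (gam + e / 2) + n%:R * (e / 2) by field.
rewrite /B in HN1; lra.
Qed.

(** Fekete's argument: divide [n] by a length [m] whose average is almost optimal. *)
Lemma growth_upper_g (e : R) : 0 < e -> exists N, forall n, (N <= n)%N -> g n <= n%:R * (gam + e).
Proof.
move=> e0; have e20 : 0 < e / 2 by rewrite divr_gt0.
have [m m0 gm] := growth_attained e20.
have gkm k : g (k * m)%N <= (k * m)%:R * (gam + e / 2) + C.
  elim: k => [|k IH].
    by rewrite mul0n mul0r add0r (le_trans (ler_norm _))// (le_trans (g_le 0))// mulr1.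
  rewrite mulSn natrD mulrDl; have := g_sub m (k * m); lra.
pose B := `|gam + e / 2| * m%:R + C * m.+1%:R + C.
have B0 : 0 <= B by rewrite /B !addr_ge0// ?mulr_ge0.
have [N1 HN1] : exists N1 : nat, B <= N1%:R * (e / 2).
  exact: archimedean_mul.
exists N1 => n nN1.
pose k := (n %/ m)%N; pose r := (n %% m)%N.
have nE : n = (k * m + r)%N by exact: divn_eq.
have rm : (r < m)%N by rewrite ltn_mod.
have h1 := g_sub (k * m) r; rewrite -nE in h1.
have h2 := le_trans (ler_norm _) (g_le r).
have h3 : C * r.+1%:R <= C * m.+1%:R by rewrite ler_wpM2l// ler_nat ltnS ltnW.
have hk := gkm k.
have h4 : (k * m)%:R * (gam + e / 2) <= n%:R * (gam + e / 2) + `|gam + e / 2| * m%:R.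
  rewrite {1}nE natrD mulrDl -addrA lerDl.
  have := ler_norm (- (gam + e / 2)); rewrite normrN => h.
  have hr : r%:R <= m%:R :> R by rewrite ler_nat ltnW.
  have r0' : 0 <= r%:R :> R by [].
  have : `|gam + e / 2| * r%:R <= `|gam + e / 2| * m%:R by rewrite ler_wpM2l.
  have : - (gam + e / 2) * r%:R <= `|gam + e / 2| * r%:R by rewrite ler_wpM2r.
  lra.
have h5 : N1%:R * (e / 2) <= n%:R * (e / 2) by rewrite ler_wpM2r ?(ltW e20)// ler_nat.
have -> : n%:R * (gam + e) = n%:R * (gam + e / 2) + n%:R * (e / 2) by field.
rewrite /B in HN1; lra.
Qed.

(* The lower bound follows the proof of the ergodic theorem by Katznelson and
   Weiss: on the set [E] of infinitely low sequences, cut the orbit greedily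
   into blocks of length at most [N] on which the average of [H] is below [c];
   the starting times where this fails have small frequency. If [E] had
   positive probability, the mean of [H] would be too small. *)
Section lower_bound.
Variable e : R.
Hypothesis e0 : 0 < e.
Let c := gam - e.

(** The arbitrary margin [K] absorbs the bounded effect of one shift, so the set is shift-stable
    without an exact additivity of [H]. *)
Definition infinitely_low : set Om :=
  [set w | forall K, exists2 n, (K <= n)%N & H (it A w n) < n%:R * c - K%:R].
Local Notation E := infinitely_low.

Lemma bm_Hit n : bm (fun w : Om => H (it A w n)).
Proof. exact: (bm_it mA bA). Qed.

Lemma measurable_infinitely_low : measurable E.
Proof.
have -> : E = \bigcap_K \bigcup_(n in [set n | (K <= n)%N])
    [set w | H (it A w n) < n%:R * c - K%:R].
  apply/seteqP; split => w h K.
    by move=> _; have [n nK hn] := h K; exists n.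
  by have [n nK hn] := h K I; exists n.
apply: bigcapT_measurable => K; apply: bigcup_measurable => n _.
by apply: measurable_lt_set; case: (bm_Hit n).
Qed.

(** The starting points in [E] at which no block of length at most [N] has average below [c]. *)
Definition late N : set Om :=
  E `&` [set w | forall n, (1 <= n <= N)%N -> n%:R * c <= H (it A w n)].

Lemma measurable_late N : measurable (late N).
Proof.
apply: measurableI; first exact: measurable_infinitely_low.
have -> : [set w : Om | forall n, (1 <= n <= N)%N -> n%:R * c <= H (it A w n)] =
    \bigcap_(n in [set n | (1 <= n <= N)%N]) [set w : Om | n%:R * c <= H (it A w n)].
  by apply/seteqP; split => w h n; exact: h.
apply: bigcap_measurableType => n _.
by apply: measurable_ge_set; case: (bm_Hit n).
Qed.

(** Dropping one step changes [H] by at most [C] and [n%:R * c] by |c|; asking for the margin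
    [(K + B).+1] pays for both and guarantees that there is a step to drop. *)
Lemma shift_infinitely_low n w : E w -> E (shiftn n w).
Proof.
elim: n w => [|n IH] w Ew.
  rewrite (_ : shiftn 0 w = w)//; apply/funext => i; rewrite /shiftn addr0//.
have -> : shiftn n.+1 w = shiftn 1 (shiftn n w).
  by apply/funext => i; rewrite /shiftn -addrA -PoszD add1n.
move: (shiftn n w) (IH w Ew) => {w Ew IH} w Ew K.
have [B HB] := archimedean_mul (C + `|c|) (ltr01 : 0 < 1 :> R); rewrite mulr1 in HB.
have [m mK hm] := Ew (K + B).+1.
case: m mK hm => // m mK hm; exists m; first by lia.
have := H_low (bA (w 0)) (bnd_it bA (shiftn 1 w) m).
have itE : it A w m.+1 = it A (shiftn 1 w) m *m A (w 0).
  by rewrite -add1n it_add /= mulmx1.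
rewrite -itE => h; have := ler_norm c; move: hm; rewrite -natr1 -[(K + B).+1%:R]natr1 natrD.
move=> hm hc; lra.
Qed.

(** At a late starting time a single step is taken, at cost at most 2 C, in excess of [c] by at most
    2 C + |c|; otherwise a whole block with average below [c] is removed. The last term pays for a
    final block that would overrun [M]. *)
Lemma greedy_bound N M w : E w -> H (it A w M) <=
  M%:R * c + (2 * C + `|c|) * (\sum_(k < M) \1_(late N) (shiftn k w))
  + (C + `|c|) * N.+1%:R.
Proof.
have cc : 0 <= C + `|c| by rewrite addr_ge0.
have c2 : 0 <= 2 * C + `|c| by rewrite addr_ge0// mulr_ge0.
have cN := ler_norm (- c); rewrite normrN in cN.
have S0 m (v : Om) : 0 <= \sum_(k < m) \1_(late N) (shiftn k v) :> R.
  by apply: sumr_ge0 => k _; rewrite indicE.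
elim/ltn_ind: M w => M IH w Ew.
have [lw|nlw] := pselect (late N w).
  case: M IH => [|M] IH.
    rewrite big_ord0 mulr0 mul0r !add0r.
    have := le_trans (ler_norm _) (H_it_le w 0); rewrite mulr1 => h.
    apply: (le_trans h); apply: (@le_trans _ _ (C * N.+1%:R)).
      by rewrite ler_peMr// ler1n.
    by rewrite ler_wpM2r// lerDl.
  have := IH M (ltnSn M) _ (shift_infinitely_low 1 Ew).
  have := H_it_add w 1 M; rewrite add1n => h1 h2.
  have h3 := le_trans (ler_norm _) (H_it_le w 1).
  rewrite big_ord_recl.
  have -> : shiftn (@ord0 M) w = w by apply/funext => i; rewrite /shiftn addr0.
  rewrite (_ : \1_(late N) w = 1) ; last by rewrite indicE mem_set.
  have -> : \sum_(i < M) \1_(late N) (shiftn (lift ord0 i) w) =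
      \sum_(k < M) \1_(late N) (shiftn k (shiftn 1 w)) :> R.
    apply: eq_bigr => i _; congr (\1_ _ _); apply/funext => j.
    by rewrite /shiftn /= /bump leq0n -addrA -PoszD addnC.
  have -> : M.+1%:R * c = M%:R * c + c by rewrite -natr1 mulrDl mul1r.
  lra.
have [n /andP[n1 nN] hn] : exists2 n, (1 <= n <= N)%N & H (it A w n) < n%:R * c.
  apply: contrapT => hno; apply: nlw; split => // n nN; rewrite leNgt; apply/negP => hn.
  by apply: hno; exists n.
have [nM|Mn] := leqP n M; last first.
  have MN : (M < N)%N by exact: leq_trans nN.
  have h1 := le_trans (ler_norm _) (H_it_le w M).
  have h2 : C * M.+1%:R <= C * N.+1%:R by rewrite ler_wpM2l// ler_nat ltnS ltnW.
  have h3 : - c * M%:R <= `|c| * N.+1%:R.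
    apply: (@le_trans _ _ (`|c| * M%:R)); first by rewrite ler_wpM2r.
    by rewrite ler_wpM2l// ler_nat (leq_trans (ltnW MN)).
  have h4 := mulr_ge0 c2 (S0 M w); lra.
have h1 := H_it_add w n (M - n); rewrite subnKC// in h1.
have Mn : (M - n < M)%N by rewrite ltn_subrL n1 (leq_trans n1).
have h2 := IH (M - n)%N Mn _ (shift_infinitely_low n Ew).
have h3 : \sum_(k < M - n) \1_(late N) (shiftn k (shiftn n w)) <=
    \sum_(k < M) \1_(late N) (shiftn k w) :> R.
  pose f k := \1_(late N) (shiftn k w) : R.
  rewrite -[leRHS](big_mkord xpredT f) (@big_cat_nat _ _ _ n)//=.
  have -> : \sum_(n <= i < M) f i = \sum_(i < M - n) f (i + n)%N.
    by rewrite -{1}(add0n n) big_addn big_mkord.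
  rewrite [leLHS](_ : _ = \sum_(i < M - n) f (i + n)%N).
    by rewrite lerDr; apply: sumr_ge0 => k _; rewrite /f indicE.
  apply: eq_bigr => i _; congr (\1_ _ _); apply/funext => j.
  by rewrite /shiftn -addrA -PoszD addnC.
have h4 : M%:R = n%:R + (M - n)%:R :> R by rewrite -natrD subnKC.
have h5 := ler_wpM2l c2 h3.
rewrite h4 mulrDl; lra.
Qed.

(** The sets decrease to the empty set: a sequence of [E] has an average below [c] at some positive
    time. *)
Lemma late_small (del : R) : 0 < del -> exists N, fine (P (late N)) <= del.
Proof.
move=> del0.
have nin : \bigcap_N late N = set0.
  apply/seteqP; split => // w hw; have [Ew _] := hw 0%N I.
  have [n n1 hn] := Ew 1%N; have [_ /(_ n)] := hw n I.
  rewrite n1 leqnn => /(_ isT); lra.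
have : P (late N) @[N --> \oo] --> P (\bigcap_N late N).
  apply: nonincreasing_cvg_mu.
  - apply: (@le_lt_trans _ _ 1%E); last exact: ltry.
    by apply: probability_le1; exact: measurable_late.
  - exact: measurable_late.
  - by apply: bigcapT_measurable; exact: measurable_late.
  - move=> N1 N2 N12; apply/subsetPset => w [Ew h]; split => // n /andP[n1 nN].
    by apply: h; rewrite n1 (leq_trans nN).
rewrite nin measure0 => /fine_cvgP[_ /cvgrPdist_le /(_ _ del0)] [N _ /(_ N (leqnn N))] /=.
by rewrite sub0r normrN => /(le_trans (ler_norm _)) h; exists N.
Qed.

Lemma shift_late N k :
  Ex P (fun w => \1_(late N) (shiftn k w) : R) = fine (P (late N)).
Proof.
have mS : measurable (shiftn k @^-1` late N : set Om).
  by rewrite -[X in measurable X]setTI; apply: measurable_shift => //; exact: measurable_late.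
rewrite (shift_invariant PI k (measurable_late N)).
transitivity (Ex P (fun w => \1_(shiftn k @^-1` late N : set Om) w : R)); last exact: Ex_indic.
by apply: eq_Rintegral => w _; rewrite !indicE; congr (_%:R); congr nat_of_bool.
Qed.

(** On [E] the greedy cutting bounds [H] near M (gam - e); elsewhere it is at most M (gam + del) up
    to an exponential excess of bounded mean. If [E] had probability p > 0, the mean at time M would
    fall below M [gam] by a multiple of M, against the definition of [gam] as an infimum. *)
Lemma infinitely_low_null : P E = 0%E.
Proof.
have mE := measurable_infinitely_low.
have PE : P E = (fine (P E))%:E by rewrite fineK// fin_num_measure.
rewrite PE; congr (_%:E); set p := fine (P E).
have p0 : 0 <= p by rewrite /p fine_ge0.
have p1 : p <= 1.
  by rewrite -lee_fin -PE probability_le1.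
apply/eqP; rewrite eq_le p0 andbT leNgt; apply/negP => pgt0.
(* The gain is M e p, while the excess over [gam] and the late times cost M [del] each; half of the
   gain remains. *)
pose del := e * p / 4.
have del0 : 0 < del by rewrite /del divr_gt0// mulr_gt0.
have c2 : 0 <= 2 * C + `|c| by rewrite addr_ge0// mulr_ge0.
have [N HN] : exists N, (2 * C + `|c|) * fine (P (late N)) <= del.
  have c3 : 0 < 2 * C + `|c| + 1 by rewrite ltr_wpDl.
  have [N HN] := late_small (divr_gt0 del0 c3); exists N.
  have q0 : 0 <= fine (P (late N)) by rewrite fine_ge0.
  move: HN; rewrite ler_pdivlMr// => HN.
  have : (2 * C + `|c|) * fine (P (late N)) <= fine (P (late N)) * (2 * C + `|c| + 1).
    by rewrite mulrC ler_wpM2l// lerDl.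
  lra.
have [m [t [rho [m0 t0 r0 r1 Hk]]]] := exponential_upper_bound del0.
pose K0 := (C + `|c|) * N.+1%:R + expR C / t.
have cc : 0 <= (C + `|c|) * N.+1%:R by rewrite mulr_ge0// addr_ge0.
have key k : (0 < k)%N -> (k * m)%:R * (e * p / 2) <= K0.
  move=> k0; set M := (k * m)%N.
  have M0 : (0 < M)%N by rewrite muln_gt0 k0.
  pose X (w : Om) := expR (t * (H (it A w M) - M%:R * (gam + del))).
  have bX : bm X by exact: (bm_it mA bA M (nice_expH t (M%:R * (gam + del)))).
  have bE : bm (fun w => \1_E w : R) by exact: bm_indic.
  have bL k' : bm (fun w => \1_(late N) (shiftn k' w) : R).
    apply: (bm_comp (f := fun w => \1_(late N) w)); first exact: measurable_shift.
    by apply: bm_indic; exact: measurable_late.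
  (* The first two terms equal M [c] on [E] and M (gam + del) off it; off [E], the excess is bounded
     by t^-1 [X] because exp(x) >= x. *)
  pose rhs (w : Om) := (M%:R * (gam + del) + - (M%:R * (e + del)) * \1_E w)
      + ((2 * C + `|c|) * (\sum_(k < M) \1_(late N) (shiftn k w)) + t^-1 * X w)
      + (C + `|c|) * N.+1%:R.
  have ptw w : H (it A w M) <= rhs w.
    have X0 : 0 <= t^-1 * X w by rewrite mulr_ge0 ?invr_ge0 ?(ltW t0)// expR_ge0.
    have S0 : 0 <= (2 * C + `|c|) * (\sum_(k < M) \1_(late N) (shiftn k w)).
      by rewrite mulr_ge0// sumr_ge0// => k' _; rewrite indicE.
    rewrite /rhs indicE; case: (boolP (w \in E)) => [/set_mem Ew|_].
      have := greedy_bound N M Ew; rewrite mulr1 /c; lra.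
    rewrite mulr0 addr0.
    have : H (it A w M) - M%:R * (gam + del) <= t^-1 * X w.
      rewrite ler_pdivlMl// /X.
      have := expR_ge1Dx (t * (H (it A w M) - M%:R * (gam + del))); lra.
    lra.
  have bS : bm (fun w => \sum_(k < M) \1_(late N) (shiftn k w) : R) by exact: bm_sum.
  have b1 := bmD (bm_cst _ (M%:R * (gam + del))) (bmZ (- (M%:R * (e + del))) bE).
  have b2 := bmD (bmZ (2 * C + `|c|) bS) (bmZ t^-1 bX).
  have Erhs : Ex P rhs = (M%:R * (gam + del) + - (M%:R * (e + del)) * p)
      + ((2 * C + `|c|) * (M%:R * fine (P (late N))) + t^-1 * Ex P X)
      + (C + `|c|) * N.+1%:R.
    rewrite /rhs ExD; [|exact: bmD|exact: bm_cst].
    rewrite ExD// Ex_cst ExD; [|exact: bm_cst|exact: bmZ].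
    rewrite Ex_cst ExZ// Ex_indic// ExD; [|exact: bmZ|exact: bmZ].
    rewrite !ExZ// Ex_sum//; congr (_ + (_ * _ + _) + _).
    rewrite (eq_bigr (fun=> fine (P (late N)))) ?sumr_const ?card_ord ?mulr_natl//.
    by move=> k' _; rewrite shift_late.
  have h1 : g M <= Ex P rhs.
    apply: le_Ex; [exact: bm_Hit|by apply: bmD; [exact: bmD|exact: bm_cst]|exact: ptw].
  have h2 := growth_leS M0.
  have h3 : t^-1 * Ex P X <= expR C / t.
    rewrite mulrC ler_pM2r ?invr_gt0//; apply: le_trans (Hk k) _.
    rewrite ler_piMr ?expR_ge0//; apply: exprn_ile1; exact: ltW.
  rewrite Erhs in h1.
  have M0' : 0 <= M%:R :> R by [].
  have h4 := ler_wpM2l M0' HN.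
  have h5 : 0 <= M%:R * (del * p) by rewrite !mulr_ge0// ltW.
  have h6 : M%:R * (e * p / 2) = M%:R * (e * p) - 2 * (M%:R * del) by rewrite /del; field.
  rewrite h6 /K0; lra.
have e2 : 0 < e * p / 2 by rewrite divr_gt0// mulr_gt0.
have [B HB] := archimedean_mul (K0 + 1) e2.
have := key B.+1 isT.
have : B%:R * (e * p / 2) <= (B.+1 * m)%:R * (e * p / 2).
  by rewrite ler_wpM2r ?(ltW e2)// ler_nat (leq_trans (leqnSn B))// leq_pmulr.
lra.
Qed.

(** The second [e] absorbs the fixed margin [K] attached to a sequence outside [E]. *)
Lemma growth_lower_ae : {ae P, forall w, exists N, forall n, (N <= n)%N ->
  n%:R * (gam - 2 * e) <= H (it A w n)}.
Proof.
exists E; split; [exact: measurable_infinitely_low|exact: infinitely_low_null|].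
move=> w /= /forallNP hw K.
have [B HB] := archimedean_mul K%:R e0.
have /existsNP[n /not_implyP[nN hn]] := hw (maxn K B).
rewrite geq_max in nN; case/andP: nN => nK nB.
exists n => //; rewrite ltNge; apply/negP => h; apply: hn.
apply: le_trans h; rewrite /c.
have : B%:R * e <= n%:R * e by rewrite ler_wpM2r ?(ltW e0)// ler_nat.
lra.
Qed.

End lower_bound.

Theorem furstenberg_kesten : {ae P, forall w, forall e, 0 < e ->
  exists N, forall n, (N <= n)%N -> `|H (it A w n) - n%:R * gam| <= n%:R * e}.
Proof.
have Hj j : {ae P, forall w, exists N, forall n, (N <= n)%N ->
    `|H (it A w n) - n%:R * gam| <= n%:R * (j.+1%:R^-1)}.
  have e0 : 0 < j.+1%:R^-1 / 2 :> R by rewrite divr_gt0// invr_gt0.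
  have j0 : 0 < j.+1%:R^-1 :> R by rewrite invr_gt0.
  apply: (ae_and (growth_upper_ae j0) (growth_lower_ae e0)) => w [N1 h1] [N2 h2].
  exists (maxn N1 N2) => n; rewrite geq_max => /andP[/h1 u /h2 l].
  move: (j.+1%:R^-1) u l => x u l; rewrite ler_norml; lra.
have := ae_foralln Hj.
apply: filterS => w hw e e0.
have [j hj] := archimedean_mul 1 e0.
have [N HN] := hw j; exists N => n /HN h; apply: (le_trans h).
rewrite ler_wpM2l// -[leLHS]mul1r ler_pdivrMr// mulrC; apply: (le_trans hj).
by rewrite ler_wpM2r ?(ltW e0)// ler_nat.
Qed.

End furstenberg_kesten.

(** * Slow and fast vectors *)

Section wedge_of_vectors.
Context {R : realType} (d : nat).
Implicit Types (y z v : 'cV[R]_d) (B : 'M[R]_d).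

(** The Gram determinant, that is, the squared area of the parallelogram spanned by the two
    vectors. *)
Lemma wdg2_pair y z : wdg2 (row_mx y z) = fn2 y * fn2 z - fdot y z ^+ 2.
Proof.
rewrite wdg2E.
have f2 : fn2 (row_mx y z) = fn2 y + fn2 z.
  rewrite /fn2 -big_split; apply: eq_bigr => i _.
  by rewrite big_split_ord /= !big_ord1 row_mxEl row_mxEr.
have dE (a b : 'cV[R]_d) : (a^T *m b) 0 0 = fdot a b.
  by rewrite mxE; apply: eq_bigr => i _; rewrite big_ord1 mxE.
have G2 : fn2 ((row_mx y z)^T *m row_mx y z) =
    fn2 y ^+ 2 + fdot y z ^+ 2 + (fdot z y ^+ 2 + fn2 z ^+ 2).
  rewrite tr_row_mx mul_col_row {1}/fn2 big_split_ord /= !big_ord1.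
  rewrite !big_split_ord /= !big_ord1.
  rewrite block_mxEul block_mxEur block_mxEdl block_mxEdr.
  by rewrite !dE !fdotxx.
have fC : fdot z y = fdot y z.
  by apply: eq_bigr => i _; apply: eq_bigr => j _; rewrite mulrC.
by rewrite G2 f2 fC; field.
Qed.

Lemma fdotBD m n (M N : 'M[R]_(m, n)) : fdot (M - N) (M + N) = fn2 M - fn2 N.
Proof.
rewrite /fdot /fn2 -sumrB; apply: eq_bigr => i _; rewrite -sumrB.
by apply: eq_bigr => j _; rewrite !mxE; ring.
Qed.

Lemma fdotZ m n a b (M N : 'M[R]_(m, n)) : fdot (a *: M) (b *: N) = a * b * fdot M N.
Proof.
rewrite /fdot mulr_sumr; apply: eq_bigr => i _; rewrite mulr_sumr.
by apply: eq_bigr => j _; rewrite !mxE; ring.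
Qed.

(* Write [y' = |z| y] and [z' = |y| z]; these have the same norm, and
   [|y' - z'| |y' + z'| = 2 |y| |z| |y /\ z|]. *)
Lemma stretch_diff B y z :
  `|fn2 (B *m y) * fn2 z - fn2 y * fn2 (B *m z)| <=
  2 * fn2 B * (fn y * fn z) * wdg (row_mx y z).
Proof.
pose y' := fn z *: y; pose z' := fn y *: z.
have -> : fn2 (B *m y) * fn2 z - fn2 y * fn2 (B *m z) =
    fdot (B *m (y' - z')) (B *m (y' + z')).
  rewrite mulmxBr mulmxDr fdotBD /y' /z' -!scalemxAr !fn2Z !sqr_fn; ring.
apply: (le_trans (fdot_le _ _)).
have h1 := fn_mul B (y' - z'); have h2 := fn_mul B (y' + z').
apply: (le_trans (ler_pM (fn_ge0 _) (fn_ge0 _) h1 h2)).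
have -> : fn B * fn (y' - z') * (fn B * fn (y' + z')) =
    fn2 B * (fn (y' - z') * fn (y' + z')) by rewrite -sqr_fn; ring.
rewrite [2 * _]mulrC -!mulrA ler_wpM2l ?fn2_ge0//.
rewrite le_eqVlt; apply/orP; left; apply/eqP.
apply: (@pexpIrn _ 2) => //.
- by rewrite nnegrE mulr_ge0 ?fn_ge0.
- by rewrite nnegrE !mulr_ge0 ?fn_ge0 ?wdg_ge0.
rewrite !exprMn !sqr_fn sqr_wdg wdg2_pair -[y' - z']/(y' + (- z')) !fn2D.
have -> : fdot y' (- z') = - fdot y' z'.
  by rewrite -[y']scale1r -scaleN1r fdotZ mul1r mulN1r scale1r.
have -> : fn2 (- z') = fn2 z' by rewrite -!sqr_fn fnN.
rewrite /y' /z' !fn2Z fdotZ -!sqr_fn; ring.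
Qed.

Lemma wdg_pair_mul B y z : wdg (row_mx (B *m y) (B *m z)) <= wdg B * wdg (row_mx y z).
Proof. by rewrite -mul_mx_row wdg_mul. Qed.

Lemma wdg_pair_le y z : wdg (row_mx y z) <= fn y * fn z.
Proof.
rewrite -(@ler_pXn2r _ 2)// ?nnegrE ?wdg_ge0 ?mulr_ge0 ?fn_ge0//.
rewrite sqr_wdg wdg2_pair exprMn !sqr_fn; have := sqr_ge0 (fdot y z); lra.
Qed.

(** [B] stretches M v and a column of M almost equally when these are almost parallel, and their
    wedge is at most [wdg M] times |v|. So the relative size of M v changes by the order of the
    ratio of the first two singular values. *)
Lemma relative_size_step (k : R) (B M : 'M[R]_d) v : (0 < d)%N -> bnd k B -> 0 < fn M -> 0 < fn (B *m M) ->
  `|fn (B *m (M *m v)) / fn (B *m M) - fn (M *m v) / fn M| <=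
  2 * d%:R ^+ 4 * expR k ^+ 4 * (wdg M / fn2 M) * fn v.
Proof.
move=> dpos bB M0 BM0; set y := M *m v.
have ek0 : 0 < expR k by exact: expR_gt0.
have fB : fn B <= d%:R * expR k by exact: bnd_fn_le.
have K1 : 0 < d%:R * expR k by rewrite mulr_gt0// ltr0n.
have fMB : fn M <= d%:R * expR k * fn (B *m M).
  have uB := bnd_unit bB.
  rewrite -{1}[M](mulKmx uB) (le_trans (fn_mul _ _))// ler_wpM2r ?fn_ge0//.
  exact: bnd_fn_le (bnd_inv bB).
have [y0|y0] := eqVneq y 0.
  rewrite y0 mulmx0 fn0 !mul0r subrr normr0.
  by rewrite !mulr_ge0 ?exprn_ge0 ?wdg_ge0 ?invr_ge0 ?fn2_ge0 ?fn_ge0// ltW.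
have fy : 0 < fn y by rewrite fn_gt0.
have fBy : expR (- k) * fn y <= fn (B *m y) by have [] := bB y.
pose a := fn (B *m y) * fn M; pose b := fn y * fn (B *m M).
(* Squares are compared because the squared norm of [B *m M] is a sum over columns, to each of which
   [stretch_diff] applies. *)
have sq : `|a ^+ 2 - b ^+ 2| <= 2 * d%:R * fn2 B * (fn y * fn M) * (wdg M * fn v).
  rewrite /a /b !exprMn !sqr_fn [fn2 M]fn2_cols [fn2 (B *m M)]fn2_cols.
  rewrite [X in X - _]mulr_sumr [X in _ - X]mulr_sumr -sumrB (le_trans (ler_norm_sum _ _ _))//.
  apply: (@le_trans _ _ (\sum_(j < d) 2 * fn2 B * (fn y * fn M) * (wdg M * fn v))); last first.
    rewrite sumr_const card_ord -[leLHS]mulr_natr le_eqVlt; apply/orP; left; apply/eqP; ring.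
  apply: ler_sum => j _.
  have -> : col j (B *m M) = B *m col j M by rewrite !colE mulmxA.
  apply: (le_trans (stretch_diff B y (col j M))).
  apply: ler_pM.
  - by rewrite !mulr_ge0 ?fn2_ge0 ?fn_ge0.
  - exact: wdg_ge0.
  - by rewrite ler_wpM2l ?mulr_ge0 ?fn2_ge0// ler_wpM2l ?fn_ge0// fn_col.
  - rewrite colE /y (le_trans (wdg_pair_mul _ _ _))// ler_wpM2l ?wdg_ge0//.
    by rewrite (le_trans (wdg_pair_le _ _))// fn_delta mulr1.
have a0 : expR (- k) * (fn y * fn M) <= a by rewrite /a mulrA ler_wpM2r ?fn_ge0.
have b0 : 0 <= b by rewrite /b mulr_ge0 ?fn_ge0.
have yM : 0 < fn y * fn M by rewrite mulr_gt0.
have apos : 0 < expR (- k) * (fn y * fn M) by rewrite mulr_gt0// expR_gt0.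
have ab : `|a - b| <= 2 * d%:R * fn2 B * expR k * (wdg M * fn v).
  have : `|a - b| * (expR (- k) * (fn y * fn M)) <= `|a ^+ 2 - b ^+ 2|.
    rewrite subr_sqr normrM ler_wpM2l// ger0_norm; lra.
  move=> /le_trans /(_ sq).
  rewrite -ler_pdivlMr// => /le_trans; apply.
  rewrite ler_pdivrMr// expRN le_eqVlt; apply/orP; left; apply/eqP; field.
  by rewrite gt_eqF.
have -> : fn (B *m y) / fn (B *m M) - fn y / fn M = (a - b) / (fn (B *m M) * fn M).
  by rewrite /a /b; field; rewrite !gt_eqF.
rewrite normrM normfV [X in _ / X]ger0_norm ?mulr_ge0 ?fn_ge0//.
have den : fn2 M <= d%:R * expR k * (fn (B *m M) * fn M).
  by rewrite -sqr_fn expr2 mulrA ler_wpM2r ?fn_ge0.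
have fM2 : 0 < fn2 M by rewrite -sqr_fn exprn_gt0.
rewrite ler_pdivrMr ?mulr_gt0// (le_trans ab)//.
have fB2 : fn2 B <= (d%:R * expR k) ^+ 2.
  by rewrite -sqr_fn ler_pXn2r// nnegrE ?fn_ge0// ltW.
have w0 : 0 <= wdg M * fn v by rewrite mulr_ge0 ?wdg_ge0 ?fn_ge0.
apply: (@le_trans _ _ (2 * d%:R * (d%:R * expR k) ^+ 2 * expR k * (wdg M * fn v))).
  by rewrite ler_wpM2r// ler_wpM2r ?(ltW ek0)// ler_wpM2l// mulr_ge0.
have -> : 2 * d%:R ^+ 4 * expR k ^+ 4 * (wdg M / fn2 M) * fn v * (fn (B *m M) * fn M) =
   2 * d%:R * (d%:R * expR k) ^+ 2 * expR k * (wdg M * fn v) *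
     ((d%:R * expR k * (fn (B *m M) * fn M)) / fn2 M).
  by field; rewrite gt_eqF.
rewrite ler_peMr//; last by rewrite ler_pdivlMr// mul1r.
by rewrite !mulr_ge0 ?exprn_ge0 ?wdg_ge0 ?fn_ge0// ltW.
Qed.

End wedge_of_vectors.

Section oseledets_dichotomy.
Context {R : realType} (d : nat).
Variables (M B : nat -> 'M[R]_d) (k g1 g2 : R).
Hypotheses (dpos : (2 <= d)%N) (MS : forall n, M n.+1 = B n *m M n)
  (bB : forall n, bnd k (B n)) (bM : forall n, exists l, bnd l (M n)).
Hypothesis gap : g2 < 2 * g1.
Hypothesis lim1 : forall e : R, 0 < e -> exists N, forall n, (N <= n)%N ->
  `|ln (fn (M n)) - n%:R * g1| <= n%:R * e.
Hypothesis lim2 : forall e : R, 0 < e -> exists N, forall n, (N <= n)%N ->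
  `|ln (wdg (M n)) - n%:R * g2| <= n%:R * e.

Let dpos' : (0 < d)%N. Proof. exact: leq_trans dpos. Qed.

Let fM0 n : 0 < fn (M n).
Proof.
have [l bl] := bM n; exact: lt_le_trans (expR_gt0 _) (bnd_fn_ge dpos' bl).
Qed.

Let wM0 n : 0 < wdg (M n).
Proof. by have [l bl] := bM n; exact: bnd_wdg_gt0 bl. Qed.

(** The ratio q_n = |M_n v| / |M_n| has increments of order r^n, with r close to exp(g2 - 2 g1).
    Either it exceeds twice the remaining sum once and then stays bounded away from 0, so [v] grows
    at rate g1; or it is always of order r^n, and [v] grows at rate at most g1 + (g2 - 2 g1). *)
Lemma slow_or_fast (v : 'cV[R]_d) :
  (forall e : R, 0 < e -> exists N, forall n, (N <= n)%N ->
     fn (M n *m v) <= expR (n%:R * (g2 - g1 + e))) \/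
  (forall e : R, 0 < e -> exists N, forall n, (N <= n)%N ->
     expR (n%:R * (g1 - e)) <= fn (M n *m v)).
Proof.
have [|/existsNP[e0 /not_implyP[e00 nslow]]] := pselect (forall e : R, 0 < e -> exists N,
   forall n, (N <= n)%N -> fn (M n *m v) <= expR (n%:R * (g2 - g1 + e))); first by left.
right => e1 e10.
pose theta := 2 * g1 - g2.
have th0 : 0 < theta by rewrite subr_gt0.
(* The slow bound below collects five errors [e], which must fit into [e0]; the bound by [theta]
   keeps the ratio [r] below 1. *)
pose e := Num.min (e0 / 8) (theta / 8).
have epos : 0 < e by rewrite /e lt_min !divr_gt0.
have ee0 : e <= e0 / 8 by rewrite /e ge_min lexx.
have eth : e <= theta / 8 by rewrite /e ge_min lexx orbT.
have [N1 HN1] := lim1 epos; have [N2 HN2] := lim2 epos.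
pose r := expR (- (theta - 3 * e)).
have r1 : r < 1 by rewrite -[ltRHS]expR0 ltr_expR; lra.
have r0 : 0 < r by exact: expR_gt0.
pose N := maxn N1 N2.
have xr n : (N <= n)%N -> wdg (M n) / fn2 (M n) <= r ^+ n.
  rewrite geq_max => /andP[/HN1 h1 /HN2 h2].
  rewrite -expRM_natl mulrN -[leLHS]lnK; last by rewrite posrE divr_gt0// -sqr_fn exprn_gt0.
  rewrite ler_expR ln_div ?posrE// -?sqr_fn ?exprn_gt0//.
  rewrite lnXn//; move: h1 h2; rewrite !ler_norml => /andP[h1 h1'] /andP[h2 h2'].
  rewrite -mulr_natl /theta; lra.
pose K := 2 * d%:R ^+ 4 * expR k ^+ 4 * fn v + 1.
have K0 : 0 < K.
  by rewrite /K ltr_wpDl// !mulr_ge0 ?exprn_ge0 ?fn_ge0// expR_ge0.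
pose q n := fn (M n *m v) / fn (M n).
have q0 n : 0 <= q n by rewrite divr_ge0 ?fn_ge0.
have qS n : (N <= n)%N -> `|q n.+1 - q n| <= K * r ^+ n.
  move=> Nn; rewrite /q MS -mulmxA.
  have BM : 0 < fn (B n *m M n) by rewrite -MS.
  apply: (le_trans (relative_size_step v dpos' (bB n) (fM0 n) BM)).
  rewrite mulrAC; apply: ler_pM => //.
  - by rewrite !mulr_ge0 ?exprn_ge0 ?fn_ge0// expR_ge0.
  - by rewrite divr_ge0 ?wdg_ge0 ?fn2_ge0.
  - by rewrite /K lerDl.
  - exact: xr.
have rr : 0 < 1 - r by rewrite subr_gt0.
pose C := K / (1 - r).
have C0 : 0 < C by rewrite divr_gt0.
have tail n m : (N <= n)%N -> q n - C * r ^+ n <= q (n + m)%N.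
  move=> Nn; suff : q n - C * (r ^+ n - r ^+ (n + m)) <= q (n + m)%N.
    apply: le_trans; rewrite lerD2l lerN2 ler_wpM2l ?(ltW C0)//.
    by rewrite lerBlDr lerDl exprn_ge0// ltW.
  elim: m => [|m IH]; first by rewrite addn0 subrr mulr0 subr0.
  have := qS (n + m)%N (leq_trans Nn (leq_addr _ _)).
  rewrite addnS ler_norml => /andP[h _].
  have E : C * r ^+ (n + m) - C * r ^+ (n + m).+1 = K * r ^+ (n + m).
    by rewrite /C exprS; field; rewrite gt_eqF.
  lra.
(* The total later variation from time [n] is at most C r^n, so beyond twice this value at least
   half of [q n] survives forever. *)
have [[n [Nn qn]]|small] := pselect (exists n, (N <= n)%N /\ 2 * C * r ^+ n < q n).
  have qpos : 0 < q n / 2.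
    have h0 : 0 <= 2 * C * r ^+ n.
    by apply: mulr_ge0; [rewrite mulr_ge0// ltW|rewrite exprn_ge0// ltW].
  by rewrite divr_gt0// (le_lt_trans h0 qn).
  have qm m : q n / 2 <= q (n + m)%N by have := tail n m Nn; lra.
  have [N3 HN3] := lim1 (divr_gt0 e10 (ltr0n R 2)).
  have [N4 HN4] := archimedean_mul (- ln (q n / 2)) (divr_gt0 e10 (ltr0n R 2)).
  exists (maxn n (maxn N3 N4)) => m; rewrite !geq_max => /and3P[nm mN3 mN4].
  have := HN3 m mN3; rewrite ler_norml => /andP[h1 _].
  have h2 : N4%:R * (e1 / 2) <= m%:R * (e1 / 2) by rewrite ler_wpM2r ?divr_ge0 ?(ltW e10)// ler_nat.
  have h3 := qm (m - n)%N; rewrite subnKC// /q ler_pdivlMr// in h3.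
  apply: le_trans h3.
  rewrite -[leRHS]lnK; last by rewrite posrE mulr_gt0.
  rewrite ler_expR lnM ?posrE//; lra.
exfalso; apply: nslow.
have [N5 HN5] := archimedean_mul (ln (2 * C)) epos.
exists (maxn N N5) => n; rewrite geq_max => /andP[Nn nN5].
have qn : q n <= 2 * C * r ^+ n.
  by rewrite leNgt; apply/negP => h; apply: small; exists n.
have := Nn; rewrite geq_max => /andP[/HN1 h1 _].
move: h1; rewrite ler_norml => /andP[_ h1].
move: qn; rewrite /q ler_pdivrMr// => qn; apply: (le_trans qn).
have C20 : 0 < 2 * C by rewrite mulr_gt0.
have rn : 0 < r ^+ n by exact: exprn_gt0.
have Crn : 0 < 2 * C * r ^+ n by exact: mulr_gt0.
rewrite -[leLHS]lnK; last by rewrite posrE; exact: mulr_gt0.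
rewrite ler_expR lnM ?posrE//.
rewrite lnM ?posrE//.
rewrite lnXn// /r expRK.
have -> : - (theta - 3 * e) *+ n = - (n%:R * (theta - 3 * e)) by rewrite [n%:R * _]mulr_natl mulNrn.
have h5 : N5%:R * e <= n%:R * e by rewrite ler_wpM2r ?(ltW epos)// ler_nat.
have h6 : n%:R * (8 * e) <= n%:R * e0 by rewrite ler_wpM2l//; lra.
have h7 : 0 <= n%:R * e by rewrite mulr_ge0// ltW.
rewrite /theta; lra.
Qed.

End oseledets_dichotomy.

Section nice_extra.
Context {R : realType} (d : nat).

Lemma nice_ext (phi psi : 'M[R]_d -> R) : nice phi ->
  (forall k M, bnd k M -> phi M = psi M) -> nice psi.
Proof.
move=> [h1 h2] e; split => [k|k d' S F mF bF].
  by have [C hC] := h1 k; exists C => M bM; rewrite -(e k)//; exact: hC.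
have -> : (fun s => psi (F s)) = (fun s => phi (F s)) by apply/funext => s; rewrite (e k).
exact: h2 bF.
Qed.

Lemma nice_scaled_exp (phi : 'M[R]_d -> R) t c : nice phi ->
  nice (fun M => expR (t * (c - phi M))).
Proof.
by move=> nphi; apply: nice_exp; apply: niceZ; apply: niceB => //; exact: nice_cst.
Qed.

Lemma ln_ratio_le (x y : R) : 0 < x -> 0 < y -> ln x - ln y <= (x - y) / y.
Proof.
move=> x0 y0; rewrite -ln_div ?posrE//.
have xy : 0 < x / y by rewrite divr_gt0.
have := expR_ge1Dx (ln (x / y)); rewrite lnK ?posrE// => h.
have -> : (x - y) / y = x / y - 1 by field; rewrite gt_eqF.
lra.
Qed.

Lemma lnv_lipschitz k (v w : 'cV[R]_d) M : bnd k M -> fn v = 1 -> fn w = 1 ->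
  lnv v M - lnv w M <= expR (2 * k) * fn (v - w).
Proof.
move=> bM v1 w1.
have v0 : v != 0 by rewrite -fn_gt0 v1.
have w0 : w != 0 by rewrite -fn_gt0 w1.
have Mv : 0 < fn (M *m v) by rewrite fn_gt0 (bnd_neq0 bM).
have Mw : 0 < fn (M *m w) by rewrite fn_gt0 (bnd_neq0 bM).
have -> : lnv v M - lnv w M = ln (fn (M *m v)) - ln (fn (M *m w)).
  by rewrite /lnv v1 w1; ring.
apply: (le_trans (ln_ratio_le Mv Mw)).
rewrite ler_pdivrMr//.
have h1 : fn (M *m v) - fn (M *m w) <= fn (M *m (v - w)).
  rewrite lerBlDr -[X in fn (_ *m X) <= _](subrK w v) mulmxDr; exact: fnD.
apply: (le_trans h1); have [_ h2] := bM (v - w); apply: (le_trans h2).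
have [h3 _] := bM w; rewrite w1 mulr1 in h3.
have -> : 2 * k = k + k by ring.
rewrite expRD -!mulrA ler_wpM2l ?expR_ge0// mulrA -[leLHS]mul1r.
rewrite [X in _ <= X]mulrAC ler_wpM2r ?fn_ge0//.
by rewrite -(expRxMexpNx_1 k) ler_wpM2l ?expR_ge0.
Qed.

End nice_extra.

(** * Compactness of the sphere and uniform expansion *)

Section spheres.
Context {R : realType} (n : nat).

Lemma entry_le_norm (u : 'rV[R]_n) j : `|u 0 j| <= `|u|.
Proof.
rewrite [leRHS]mx_normrE.
apply: (le_bigmax 0 (fun ij : 'I_1 * 'I_n => `|u ij.1 ij.2|) (0, j)).
Qed.

Lemma fn_le_norm (u : 'rV[R]_n) : fn u <= n%:R * `|u|.
Proof.
rewrite -(@ler_pXn2r _ 2)// ?nnegrE ?fn_ge0 ?mulr_ge0//.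
rewrite sqr_fn /fn2 big_ord1.
apply: (@le_trans _ _ (\sum_(j < n) `|u| ^+ 2)).
  apply: ler_sum => j _.
  rewrite -[leLHS]real_normK ?num_real// ler_pXn2r ?nnegrE//.
  exact: entry_le_norm.
rewrite sumr_const card_ord exprMn -[leLHS]mulr_natl ler_wpM2r ?sqr_ge0//.
by rewrite -natrX ler_nat; case: (n) => // m; rewrite expnS expn1 leq_pmulr.
Qed.

Lemma norm_le_fn (u : 'rV[R]_n) : `|u| <= fn u.
Proof.
have [u0|/mx_norm_neq0[[i j] /= E]] := eqVneq (mx_norm u) 0.
  by rewrite -[leLHS]/(mx_norm u) u0 fn_ge0.
by rewrite -[leLHS]/(mx_norm u) E fn_entry.
Qed.

End spheres.

Section sphere_compactness.
Context {R : realType} (n : nat).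

Lemma fn_continuous : continuous (fun u : 'rV[R]_n.+1 => fn u).
Proof.
move=> u; have FF : Filter (nbhs u) by exact: nbhs_filter.
apply/(@cvgrPdist_le _ _ _ (nbhs u) FF) => e e0; near=> v.
rewrite (le_trans (fn_dist _ _))// (le_trans (fn_le_norm _))//.
have n1 : 0 < n.+1%:R :> R by rewrite ltr0n.
rewrite mulrC -ler_pdivlMr//; near: v; apply: cvgr_dist_le; first exact: cvg_id.
by rewrite divr_gt0.
Unshelve. all: by end_near. Qed.

Lemma compact_sphere : compact [set u : 'rV[R]_n.+1 | fn u = 1].
Proof.
apply: bounded_closed_compact.
  exists 1; split => // M M1 u /= u1.
  by rewrite (le_trans (norm_le_fn u))// u1 ltW.
have -> : [set u : 'rV[R]_n.+1 | fn u = 1] = (fun u => fn u) @^-1` [set 1] by [].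
apply: preimage_closed; last exact: closed_eq.
by move=> u _; exact: fn_continuous.
Qed.

End sphere_compactness.

(** Compactness is taken from row vectors by transposition; in dimension 0 there is no unit
    vector. *)
Lemma sphere_cluster (R : realType) n (v : nat -> 'cV[R]_n) : (forall k, fn (v k) = 1) ->
  exists2 p, fn p = 1 & forall e K, 0 < e -> exists2 k, (K <= k)%N & fn (v k - p) < e.
Proof.
case: n v => [|n] v v1.
  by have := v1 0%N; rewrite (flatmx0 (v 0%N)) fn0 => /eqP; rewrite eq_sym oner_eq0.
have [|p [/= p1 cp]] := @compact_sphere R n ((fun k => (v k)^T) @ \oo) _.
  by exists 0%N => // k _ /=; rewrite fn_tr v1.
exists p^T; first by rewrite fn_tr.
move=> e K e0; have n1 : 0 < n.+1%:R :> R by rewrite ltr0n.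
have e1 : 0 < e / n.+1%:R by rewrite divr_gt0.
have [] := cp [set u | exists2 k, (K <= k)%N & u = (v k)^T] (ball p (e / n.+1%:R)).
- by exists K => // k /= Kk; exists k.
- exact: nbhsx_ballx.
move=> _ [[k Kk ->]]; rewrite -ball_normE /ball_ /= => h; exists k => //.
rewrite fnBC -fn_tr (_ : (_ - _)^T = p - (v k)^T); last by rewrite linearB /= trmxK.
apply: (le_lt_trans (fn_le_norm _)).
by rewrite mulrC -ltr_pdivlMr.
Qed.

Section linear_sets.
Context {F : fieldType} {vT : vectType F}.

(** A subspace of maximal dimension inside [S] contains every vector of [S]: adding the line of such
    a vector stays inside [S]. *)
Lemma linear_set_vspace (S : set vT) : S 0 -> (forall a u v, S u -> S v -> S (a *: u + v)) ->
  exists V : {vspace vT}, forall v, (v \in V) <-> S v.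
Proof.
move=> S0 Slin.
pose Q k := `[< exists V : {vspace vT}, \dim V = k /\ forall v, v \in V -> S v >].
have exQ : exists k, Q k.
  exists 0%N; apply/asboolP; exists 0%VS; split; first by rewrite dimv0.
  by move=> v; rewrite memv0 => /eqP ->.
have bQ k : Q k -> (k <= \dim {:vT})%N.
  by move=> /asboolP[V [<- _]]; rewrite dimvS// subvf.
case: (ex_maxnP exQ bQ) => k /asboolP[V [dV VS]] maxk.
exists V => v; split => [|Sv]; first exact: VS.
have : Q (\dim (V + <[v]>)).
  apply/asboolP; exists (V + <[v]>)%VS; split => // w /memv_addP[u uV [_ /vlineP[a ->] ->]].
  by rewrite addrC; apply: Slin => //; exact: VS.
move=> /maxk; rewrite -dV => le.
have /eqP -> : (V == V + <[v]>)%VS by rewrite eqEdim addvSl.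
by rewrite (subvP (addvSr _ _))// memv_line.
Qed.

End linear_sets.

Section expansion.
Context {R : realType} (d : nat) d0 (T : measurableType d0).
Variables (A : T -> 'M[R]_d) (mA : mxmeas A).
Variables (kappa : R) (kappa0 : 0 <= kappa) (bA : forall x, bnd kappa (A x)).
Variables (mu : probability T R).
Local Notation Om := (prodT int T).
Variables (P : probability Om R) (PI : iid_law mu P).

(** This rate will be L_1, and [rate2] will be L_1 + L_2. *)
Definition rate1 : R := growth A P (fun M => ln (fn M)).
Definition rate2 : R := growth A P (fun M => ln (wdg M)).

Definition expansion n (v : 'cV[R]_d) : R := EE A P n (lnv v).
Local Notation a := expansion.

Lemma expansion_bound n v : v != 0 -> `|a n v| <= n%:R * kappa.
Proof.
move=> v0; apply: (norm_EE_le mA bA); first exact: nice_lnv.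
by move=> M bM; exact: lnv_bnd.
Qed.

Lemma nice_expansion n (v : 'cV[R]_d) : v != 0 -> nice (fun M => a n (M *m v)).
Proof.
move=> v0; apply: (nice_ext (phi := fun M => EE A P n (fun M' => lnv v (M' *m M)) - lnv v M)).
  apply: niceB; last exact: nice_lnv.
  by apply: (nice_EE mA bA); exact: nice_lnv.
move=> k M bM; have Mv0 := bnd_neq0 bM v0.
rewrite (_ : EE A P n (fun M' => lnv v (M' *m M)) = lnv v M + a n (M *m v)); first by rewrite addrC addKr.
rewrite -(EE_cst A P n (lnv v M)) -(EED mA bA); last 2 first.
- exact: nice_cst.
- exact: nice_lnv.
by apply: eq_Ex => w; rewrite lnv_mul.
Qed.

Lemma expansion_add n m v : v != 0 ->
  a (n + m) v = a n v + EE A P n (fun M => a m (M *m v)).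
Proof.
move=> v0; rewrite /expansion (EE_comp mA bA PI); last exact: nice_lnv.
rewrite -(EED mA bA); last 2 first.
- exact: nice_lnv.
- exact: (nice_expansion m v0).
apply: eq_Ex => w; have Mv0 := bnd_neq0 (bnd_it bA w n) v0.
rewrite -[X in X + _](EE_cst A P m) -(EED mA bA); last 2 first.
- exact: nice_cst.
- exact: nice_lnv.
by apply: eq_Ex => w'; rewrite lnv_mul.
Qed.

Lemma expansion_lipschitz n v w : fn v = 1 -> fn w = 1 ->
  a n v <= a n w + expR (2 * (n%:R * kappa)) * fn (v - w).
Proof.
move=> v1 w1.
have v0 : v != 0 by rewrite -fn_gt0 v1.
have w0 : w != 0 by rewrite -fn_gt0 w1.
rewrite -lerBlDl /expansion -(EEB mA bA); last 2 first.
- exact: nice_lnv.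
- exact: nice_lnv.
apply: (le_EE_cst mA bA); first by apply: niceB; exact: nice_lnv.
by move=> M bM; exact: lnv_lipschitz.
Qed.

Lemma expansionZ n c v : c != 0 -> v != 0 -> a n (c *: v) = a n v.
Proof.
move=> c0 v0; apply: eq_Ex => w; apply: lnvZ => //.
exact: bnd_neq0 (bnd_it bA w n) v0.
Qed.

Lemma fn_normalize (v : 'cV[R]_d) : v != 0 -> fn ((fn v)^-1 *: v) = 1.
Proof.
move=> v0; have fv : 0 < fn v by rewrite fn_gt0.
by rewrite fnZ normfV gtr0_norm// mulVf// gt_eqF.
Qed.

Definition expands_by (b : R) := exists N, forall n, (N <= n)%N ->
  forall v : 'cV[R]_d, v != 0 -> n%:R * b <= a n v.

(** If no bounded time and uniform gain worked, unit vectors violating them would accumulate at some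
    [p]. The time that serves [p] also serves nearby vectors, as the expansion at a fixed time is
    Lipschitz on the sphere. *)
Lemma expansion_stalls (b : R) : (forall v : 'cV[R]_d, v != 0 -> exists2 n, (0 < n)%N & n%:R * b < a n v) ->
  exists (k : nat) (eta : R), 0 < eta /\ forall v : 'cV[R]_d, v != 0 ->
    exists2 n, (0 < n <= k)%N & n%:R * b + eta <= a n v.
Proof.
move=> hyp; apply: contrapT => /forallNP H.
have bad k : exists v, fn v = 1 /\ forall n, (0 < n <= k)%N -> a n v < n%:R * b + k.+1%:R^-1.
  have /forallNP/(_ (k.+1%:R^-1)) /not_andP[|] := H k.
    by rewrite invr_gt0.
  move=> /existsNP[v /not_implyP[v0 /forall2NP Hv]].
  exists ((fn v)^-1 *: v); split; first exact: fn_normalize.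
  move=> n nk; rewrite expansionZ//; last by rewrite invr_eq0 fn_eq0.
  by have [//|/negP] := Hv n; rewrite -ltNge.
have [v Hv] := choice bad.
have [p p1 Hp] := sphere_cluster (fun k => (Hv k).1).
have p0 : p != 0 by rewrite -fn_gt0 p1.
have [n n0 hn] := hyp p p0.
pose e := a n p - n%:R * b; have e0 : 0 < e by rewrite subr_gt0.
pose L := expR (2 * (n%:R * kappa)); have L0 : 0 < L by exact: expR_gt0.
have [K HK] := archimedean_mul 1 (divr_gt0 e0 (ltr0n R 2)).
have [k Kk hk] := Hp (e / 2 / L) (maxn n K) (divr_gt0 (divr_gt0 e0 (ltr0n R 2)) L0).
have [nk Kk'] : (n <= k)%N /\ (K <= k)%N by move: Kk; rewrite geq_max => /andP.
have [vk1 /(_ n)] := Hv k; rewrite n0 nk => /(_ isT) h1.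
have h2 := expansion_lipschitz n p1 vk1; rewrite fnBC in h2.
have h3 : L * fn (v k - p) < e / 2 by rewrite mulrC -ltr_pdivlMr.
have h4 : k.+1%:R^-1 <= e / 2.
  rewrite -[leLHS]mul1r ler_pdivrMr// mulrC (le_trans HK)// ler_wpM2r ?divr_ge0 ?(ltW e0)//.
  by rewrite ler_nat (leq_trans Kk').
move: h1 h2 h3 h4; rewrite -/L /e.
move: (k.+1%:R^-1) (a n p) (a n (v k)) (L * _) => z x y q; lra.
Qed.

(** Time is cut into blocks adapted to the current vector, each gaining [eta] over the rate [b].
    Blocks have length at most [k], so the rate improves by at least eta / (k + 1); the last,
    incomplete block costs the constant. *)
Lemma expansion_greedy (b eta : R) k : 0 < eta -> (forall v : 'cV[R]_d, v != 0 ->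
    exists2 n, (0 < n <= k)%N & n%:R * b + eta <= a n v) ->
  forall m (v : 'cV[R]_d), v != 0 ->
    m%:R * (b + eta / k.+1%:R) - k%:R * (kappa + `|b + eta / k.+1%:R|) <= a m v.
Proof.
move=> eta0 H; set b' := b + _; set c := k%:R * _.
have c0 : 0 <= c by rewrite /c mulr_ge0// addr_ge0.
elim/ltn_ind => m IH v v0.
have [n /andP[n0 nk] hn] := H v v0.
have hb : n%:R * b' <= n%:R * b + eta.
  rewrite /b' mulrDr lerD2l mulrCA ger_pMr// ler_pdivrMr// mul1r ler_nat.
  by rewrite (leq_trans nk).
have [nm|mn] := leqP n m.
  have -> : m = (n + (m - n))%N by rewrite subnKC.
  rewrite expansion_add// natrD mulrDl -addrA; apply: lerD; first exact: le_trans hn.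
  apply: (ge_EE_cst mA bA); first exact: nice_expansion.
  move=> M bM; apply: IH; last exact: bnd_neq0 bM v0.
  by rewrite ltn_subrL n0 (leq_trans n0).
have mk : (m <= k)%N by rewrite ltnW// (leq_trans mn).
have := expansion_bound m v0; rewrite ler_norml => /andP[h _].
apply: le_trans h; rewrite lerBlDr /c.
have h1 : m%:R * b' <= m%:R * `|b'| by rewrite ler_wpM2l// ler_norm.
have h2 : m%:R * (kappa + `|b'|) <= k%:R * (kappa + `|b'|).
  by rewrite ler_wpM2r ?ler_nat// addr_ge0.
lra.
Qed.

Lemma expands_by_open (b : R) : (forall v : 'cV[R]_d, v != 0 -> exists2 n, (0 < n)%N & n%:R * b < a n v) ->
  exists2 b', b < b' & expands_by b'.
Proof.
move=> /expansion_stalls[k [eta [eta0 H]]].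
have G := expansion_greedy eta0 H.
pose e := eta / k.+1%:R; have e0 : 0 < e by rewrite divr_gt0.
exists (b + e / 2); first by rewrite ltrDl divr_gt0.
have [N HN] := archimedean_mul (k%:R * (kappa + `|b + e|)) (divr_gt0 e0 (ltr0n R 2)).
exists N => n Nn v v0; apply: le_trans (G n v v0); rewrite -/e.
have e20 : 0 <= e / 2 by rewrite ltW// divr_gt0.
have : N%:R * (e / 2) <= n%:R * (e / 2) by rewrite ler_wpM2r// ler_nat.
lra.
Qed.

Lemma expands_by_low : expands_by (- kappa).
Proof.
exists 0%N => n _ v v0; have := expansion_bound n v0.
by rewrite ler_norml mulrN => /andP[].
Qed.

Lemma expands_by_le b b' : b' <= b -> expands_by b -> expands_by b'.
Proof.
move=> bb [N HN]; exists N => n Nn v v0.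
by apply: le_trans (HN n Nn v v0); rewrite ler_wpM2l.
Qed.

(** Take for [b] the supremum of the rates of uniform expansion. If every vector beat [b] at some
    time, compactness would give uniform expansion at a rate above the supremum. *)
Lemma stalling_vector (c : R) : ~ expands_by c -> exists b : R, [/\ b <= c,
  forall b' : R, b' < b -> expands_by b' &
  exists2 v : 'cV[R]_d, fn v = 1 & forall n, a n v <= n%:R * b].
Proof.
move=> nc; pose S : set R := [set b | expands_by b].
have Sub : ubound S c.
  by move=> b Sb; rewrite leNgt; apply/negP => cb; apply: nc; exact: expands_by_le (ltW cb) Sb.
have Ssup : has_sup S.
  by split; [exists (- kappa); exact: expands_by_low|exists c].
exists (sup S); split.
- by apply: ge_sup => //; case: Ssup.
- move=> b' b'S; have dd : 0 < sup S - b' by rewrite subr_gt0.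
  have [b Sb hb] := sup_adherent dd Ssup.
  by apply: expands_by_le Sb; rewrite subKr in hb; exact: ltW.
- apply: contrapT => /forall2NP H.
  have [v v0|b' Sb' Eb'] := @expands_by_open (sup S).
    have [/(_ (fn_normalize v0))//|/existsNP[n hn]] := H ((fn v)^-1 *: v).
    exists n.
      rewrite lt0n; apply/eqP => n0; apply: hn; rewrite n0 mul0r.
      by rewrite /expansion EE0 /lnv mul1mx subrr.
    move/negP: hn; rewrite -ltNge expansionZ// invr_eq0 fn_eq0//.
  have := sup_upper_bound Ssup Eb'; rewrite leNgt => /negP; exact.
Qed.

End expansion.

(** * Slow vectors and the invariant subspace they form *)

Section rates.
Context {R : realType} (d : nat) d0 (T : measurableType d0).
Variables (A : T -> 'M[R]_d) (mA : mxmeas A).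
Variables (kappa : R) (kappa0 : 0 <= kappa) (bA : forall x, bnd kappa (A x)).
Variables (mu : probability T R).
Local Notation Om := (prodT int T).
Variables (P : probability Om R) (PI : iid_law mu P).

Section fn_rate.
Hypothesis dpos : (0 < d)%N.

Let fnpos k (M : 'M[R]_d) : bnd k M -> 0 < fn M.
Proof. by move=> bM; exact: lt_le_trans (expR_gt0 _) (bnd_fn_ge dpos bM). Qed.

Let lnd : 0 <= ln (d%:R : R).
Proof. by rewrite ln_ge0// ler1n. Qed.

Lemma ln_fn_le k (M : 'M[R]_d) : bnd k M -> `|ln (fn M)| <= ln (d%:R : R) + k.
Proof.
move=> bM; have fM := fnpos bM; have dR : 0 < d%:R :> R by rewrite ltr0n.
have h1 : ln (fn M) <= ln (d%:R : R) + k.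
  rewrite -[X in _ + X]expRK -lnM ?posrE ?expR_gt0// ler_ln ?posrE ?mulr_gt0 ?expR_gt0//.
  exact: bnd_fn_le.
have h2 : - k <= ln (fn M).
  rewrite -[leLHS]expRK ler_ln ?posrE ?expR_gt0//; exact: bnd_fn_ge.
by rewrite ler_norml h1 andbT (le_trans _ h2)// lerN2 lerDr.
Qed.

Let Cf := ln (d%:R : R) + kappa.
Let Cf0 : 0 <= Cf. Proof. by rewrite addr_ge0. Qed.

Let f_sub k k' (M M' : 'M[R]_d) : bnd k M -> bnd k' M' ->
  ln (fn (M' *m M)) <= ln (fn M) + ln (fn M').
Proof.
move=> bM bM'; have f1 := fnpos bM; have f2 := fnpos bM'.
have f3 := fnpos (bnd_mul bM' bM).
by rewrite -lnM ?posrE// ler_ln ?posrE ?mulr_gt0// mulrC fn_mul.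
Qed.

Let f_low k (M M' : 'M[R]_d) : bnd kappa M -> bnd k M' ->
  ln (fn M') - Cf <= ln (fn (M' *m M)).
Proof.
move=> bM bM'; have b1 := bnd_mul bM' bM; have b2 := bnd_inv bM.
have := f_sub b2 b1; rewrite mulmxK ?(bnd_unit bM)// => h.
have := ler_norm (ln (fn (invmx M))); have := ln_fn_le b2; rewrite /Cf; lra.
Qed.

Let f_bnd (n : nat) (M : 'M[R]_d) : bnd (n%:R * kappa) M -> `|ln (fn M)| <= Cf * n.+1%:R.
Proof.
move=> bM; apply: (le_trans (ln_fn_le bM)); rewrite /Cf -natr1 mulrDr mulr1 mulrDl.
have : 0 <= ln (d%:R : R) * n%:R by rewrite mulr_ge0.
have -> : kappa * n%:R = n%:R * kappa by rewrite mulrC.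
have := kappa0; lra.
Qed.

Lemma rate1_ae : {ae P, forall w, forall e, 0 < e ->
  exists N, forall n, (N <= n)%N -> `|ln (fn (it A w n)) - n%:R * rate1 A P| <= n%:R * e}.
Proof. exact: (furstenberg_kesten mA kappa0 bA PI (nice_ln_fn dpos) Cf0 f_sub f_low f_bnd). Qed.

Lemma rate1_upper (e : R) : 0 < e -> exists N, forall n, (N <= n)%N ->
  EE A P n (fun M => ln (fn M)) <= n%:R * (rate1 A P + e).
Proof.
exact: (growth_upper_g mA kappa0 bA PI (nice_ln_fn dpos) Cf0 f_sub f_bnd).
Qed.

End fn_rate.

Section wdg_rate.
Hypothesis d2 : (2 <= d)%N.
Let dpos : (0 < d)%N. Proof. exact: leq_trans d2. Qed.
Let lnd : 0 <= ln (d%:R : R).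
Proof. by rewrite ln_ge0// ler1n. Qed.

Lemma ln_wdg_le k (M : 'M[R]_d) : bnd k M -> `|ln (wdg M)| <= 2 * (ln (d%:R : R) + k).
Proof.
move=> bM; have wM := bnd_wdg_gt0 d2 bM.
have dk : 0 < d%:R * expR k by rewrite mulr_gt0 ?expR_gt0// ltr0n.
have E : ln ((d%:R * expR k) ^+ 2) = 2 * (ln (d%:R : R) + k).
  by rewrite lnXn// lnM ?posrE ?expR_gt0 ?ltr0n// expRK mulr_natl.
have dk2 : 0 < (d%:R * expR k) ^+ 2 by rewrite exprn_gt0.
rewrite -E ler_norml -lnV ?posrE// !ler_ln ?posrE ?invr_gt0//.
by rewrite bnd_wdg_ge// bnd_wdg_le.
Qed.

Let Cf := 2 * (ln (d%:R : R) + kappa).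
Let Cf0 : 0 <= Cf. Proof. by rewrite mulr_ge0// addr_ge0. Qed.

Let f_sub k k' (M M' : 'M[R]_d) : bnd k M -> bnd k' M' ->
  ln (wdg (M' *m M)) <= ln (wdg M) + ln (wdg M').
Proof.
move=> bM bM'; have f1 := bnd_wdg_gt0 d2 bM; have f2 := bnd_wdg_gt0 d2 bM'.
have f3 := bnd_wdg_gt0 d2 (bnd_mul bM' bM).
by rewrite -lnM ?posrE// ler_ln ?posrE ?mulr_gt0// mulrC wdg_mul.
Qed.

Let f_low k (M M' : 'M[R]_d) : bnd kappa M -> bnd k M' ->
  ln (wdg M') - Cf <= ln (wdg (M' *m M)).
Proof.
move=> bM bM'; have b1 := bnd_mul bM' bM; have b2 := bnd_inv bM.
have := f_sub b2 b1; rewrite mulmxK ?(bnd_unit bM)// => h.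
have := ler_norm (ln (wdg (invmx M))); have := ln_wdg_le b2; rewrite /Cf; lra.
Qed.

Let f_bnd (n : nat) (M : 'M[R]_d) : bnd (n%:R * kappa) M -> `|ln (wdg M)| <= Cf * n.+1%:R.
Proof.
move=> bM; apply: (le_trans (ln_wdg_le bM)); rewrite /Cf -[n.+1%:R]natr1 [_ * (_ + 1)]mulrDr mulr1.
have : 0 <= ln (d%:R : R) * n%:R by rewrite mulr_ge0.
have -> : 2 * (ln (d%:R : R) + kappa) * n%:R =
  2 * (ln (d%:R : R) * n%:R) + 2 * (n%:R * kappa) by ring.
have := kappa0; lra.
Qed.

Lemma rate2_ae : {ae P, forall w, forall e, 0 < e ->
  exists N, forall n, (N <= n)%N -> `|ln (wdg (it A w n)) - n%:R * rate2 A P| <= n%:R * e}.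
Proof. exact: (furstenberg_kesten mA kappa0 bA PI (nice_ln_wdg d2) Cf0 f_sub f_low f_bnd). Qed.

Lemma rate2_upper (e : R) : 0 < e -> exists N, forall n, (N <= n)%N ->
  EE A P n (fun M => ln (wdg M)) <= n%:R * (rate2 A P + e).
Proof.
exact: (growth_upper_g mA kappa0 bA PI (nice_ln_wdg d2) Cf0 f_sub f_bnd).
Qed.

End wdg_rate.

(** The error runs over 1 / (j + 1) so that the condition is a countable combination of measurable
    ones. *)
Definition slow (l : R) (w : Om) (v : 'cV[R]_d) := forall j : nat, exists N, forall n, (N <= n)%N ->
  fn (it A w n *m v) <= expR (n%:R * (l + j.+1%:R^-1)).

Lemma slow_bound l w v e : slow l w v -> 0 < e -> exists N, forall n, (N <= n)%N ->
  fn (it A w n *m v) <= expR (n%:R * (l + e)).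
Proof.
move=> sv e0; have [j hj] := archimedean_mul 1 e0; have [N HN] := sv j.
exists N => n Nn; apply: (le_trans (HN n Nn)); rewrite ler_expR ler_wpM2l// lerD2l.
rewrite -[leLHS]mul1r ler_pdivrMr// mulrC (le_trans hj)// ler_wpM2r ?(ltW e0)//.
by rewrite ler_nat.
Qed.

Lemma slow0 l w : slow l w 0.
Proof. by move=> j; exists 0%N => n _; rewrite mulmx0 fn0 expR_ge0. Qed.

Lemma slow_lin l w a u v : slow l w u -> slow l w v -> slow l w (a *: u + v).
Proof.
move=> su sv j; have j0 : 0 < j.+1%:R^-1 :> R by rewrite invr_gt0.
move: (j.+1%:R^-1) j0 => e e0.
have e20 : 0 < e / 2 by rewrite divr_gt0.
have [N1 H1] := slow_bound su e20; have [N2 H2] := slow_bound sv e20.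
have [N3 H3] := archimedean_mul (`|a| + 1) e20.
exists (maxn N1 (maxn N2 N3)) => n; rewrite !geq_max => /and3P[n1 n2 n3].
rewrite mulmxDr -scalemxAr (le_trans (fnD _ _))// fnZ.
have h1 := H1 n n1; have h2 := H2 n n2.
apply: (@le_trans _ _ ((`|a| + 1) * expR (n%:R * (l + e / 2)))).
  by rewrite mulrDl mul1r lerD// ler_wpM2l.
have -> : n%:R * (l + e) = n%:R * (e / 2) + n%:R * (l + e / 2) by field.
rewrite expRD ler_wpM2r ?expR_ge0//.
have h3 : N3%:R * (e / 2) <= n%:R * (e / 2) by rewrite ler_wpM2r ?(ltW e20)// ler_nat.
have := expR_ge1Dx (n%:R * (e / 2)); lra.
Qed.

Lemma measurable_slow l d' (S : measurableType d') (W : S -> Om) (U : S -> 'cV[R]_d) :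
  measurable_fun setT W -> mxmeas U -> measurable [set s | slow l (W s) (U s)].
Proof.
move=> mW mU.
have -> : [set s | slow l (W s) (U s)] = \bigcap_j \bigcup_N \bigcap_(n in [set n | (N <= n)%N])
    [set s | fn (it A (W s) n *m U s) <= expR (n%:R * (l + j.+1%:R^-1))].
  apply/seteqP; split => s hs j.
    by move=> _; have [N HN] := hs j; exists N => // n /HN.
  by have [N _ HN] := hs j I; exists N => n Nn; exact: HN.
apply: bigcapT_measurable => j; apply: bigcupT_measurable => N.
apply: bigcap_measurableType => n _; apply: measurable_le_set; apply: measurable_fn.
apply: mxmeas_mul => // a b.
apply: (measurableT_comp (f := fun w : Om => it A w n a b)) => //.
exact: mxmeas_it.
Qed.

Lemma slow_splice l w w' v : slow l (splice 1 (w, w')) v -> slow l w' (A (w 0) *m v).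
Proof.
move=> s j; have j0 : 0 < j.+1%:R^-1 :> R by rewrite invr_gt0.
move: (j.+1%:R^-1) j0 => e e0; have e20 : 0 < e / 2 by rewrite divr_gt0.
have [N1 H1] := slow_bound s e20.
have [N2 H2] := archimedean_mul (l + e / 2) e20.
exists (maxn N1 N2) => n; rewrite geq_max => /andP[n1 n2].
have := H1 (1 + n)%N (leqW n1); rewrite it_splice /= mulmx1 -mulmxA => h.
apply: (le_trans h); rewrite ler_expR natrD mulrDl mul1r.
have h2 : N2%:R * (e / 2) <= n%:R * (e / 2) by rewrite ler_wpM2r ?(ltW e20)// ler_nat.
have -> : n%:R * (l + e) = n%:R * (e / 2) + n%:R * (l + e / 2) by field.
lra.
Qed.

(** By Fubini in the first step: were A(x) v not almost surely slow for x in a set of positive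
    measure, v itself would fail to be slow with positive probability. *)
Lemma slow_invariant l v : {ae P, forall w, slow l w v} ->
  {ae mu, forall x, {ae P, forall w, slow l w (A x *m v)}}.
Proof.
move=> sv.
pose fast u := ~` [set w : Om | slow l w u].
have mfast u : measurable (fast u).
  by apply: measurableC; apply: measurable_slow => //; exact: mxmeas_cst.
pose F := ~` [set p : T * Om | slow l p.2 (A p.1 *m v)].
have mF : measurable F.
  apply: measurableC; apply: (measurable_slow l (W := snd) (U := fun p => A p.1 *m v)) => //.
  apply: mxmeas_mul; last exact: mxmeas_cst.
  by move=> i j; apply: (measurableT_comp (f := fun x => A x i j)).
have bF : bm (fun p : T * Om => \1_F p : R) by exact: bm_indic.
have bh : bm (fun x => Ex P (fun w => \1_F (x, w) : R)) by exact: (bm_Ex_section mu P bF).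
have Fi x w : \1_F (x, w) = \1_(fast (A x *m v)) w :> R.
  by rewrite !indicE; congr (nat_of_bool _)%:R; apply/idP/idP => /set_mem h; apply/mem_set.
have Ph : Ex mu (fun x => Ex P (fun w => \1_F (x, w) : R)) = 0.
  apply/eqP; rewrite eq_le; apply/andP; split; last first.
    by apply: Ex_ge0 => x; apply: Ex_ge0 => w; rewrite indicE.
  have Pv : fine (P (fast v)) = 0.
    by rewrite (_ : P (fast v) = 0%E)//; exact: ((negligibleP P (mfast v)).1 sv).
  rewrite -(iid_coord PI 0 bh) -Pv -Ex_indic// [leRHS](iid_splice PI 1); last exact: bm_indic.
  have b1 : bm (fun w : Om => \1_(fast v) w : R) by exact: bm_indic.
  apply: le_Ex.
  - apply: (bm_comp (F := fun w : Om => w 0) (f := fun x => Ex P (fun w => \1_F (x, w) : R))) => //.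
    exact: measurable_coord.
  - have := bm_Ex_section P P (bm_comp (measurable_splice (T := T) 1) b1).
    by [].
  move=> w; apply: le_Ex.
  - exact: (bm_section (w 0) bF).
  - apply: (bm_section w (f := fun p => \1_(fast v) (splice 1 p))).
    exact: (bm_comp (measurable_splice (T := T) 1) b1).
  move=> w'; rewrite Fi !indicE ler_nat.
  have [/set_mem h|//] := boolP (w' \in _).
  rewrite mem_set// => s; apply: h; exact: slow_splice.
apply: filterS (Ex_ge0_ae bh _ Ph) => [x hx|x]; last first.
  by apply: Ex_ge0 => w; rewrite indicE.
apply: (negligibleP P (mfast _)).2.
have : fine (P (fast (A x *m v))) = 0.
  by rewrite -Ex_indic// -[RHS]hx; apply: eq_Ex => w; rewrite Fi.
move=> h; rewrite -[LHS]fineK ?h// fin_num_measure//.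
Qed.

(** A control of the lower tail of growth. Over [m] steps the mean growth beats b - del for every
    starting vector, so an exponential moment of the deficit is at most 1; uniformity in the vector
    allows iteration along the random images. *)
Lemma inverse_moment (b del : R) : expands_by A P b -> 0 < del -> exists m t, [/\ (0 < m)%N, 0 < t &
  forall k (v : 'cV[R]_d), v != 0 ->
    EE A P (k * m) (fun M => expR (t * ((k * m)%:R * (b - del) - lnv v M))) <= 1].
Proof.
move=> [N HN] del0; pose m := N.+1.
pose Z := m%:R * kappa + `|m%:R * (b - del)| + 1.
have Z0 : 0 < Z by rewrite /Z ltr_pwDr// addr_ge0// mulr_ge0.
have md0 : 0 < m%:R * del by rewrite mulr_gt0// ltr0n.
have [t [t0 t1 Ht]] := exponential_moment Z0 md0.
exists m, t; split => //.
have base (v : 'cV[R]_d) : v != 0 -> EE A P m (fun M => expR (t * (m%:R * (b - del) - lnv v M))) <= 1.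
  move=> v0; have nl := nice_lnv v0.
  have nf : nice (fun M => m%:R * (b - del) - lnv v M) by apply: niceB => //; exact: nice_cst.
  apply: (@le_trans _ _ (expR (- (t * (m%:R * del) / 2)))); last first.
    by rewrite -[leRHS]expR0 ler_expR oppr_le0 divr_ge0// mulr_ge0// ltW.
  apply: (Ht _ _ P (fun w => m%:R * (b - del) - lnv v (it A w m))).
  - exact: (bm_it mA bA m nf).
  - move=> w; rewrite /Z (le_trans (ler_normB _ _))//.
    have := lnv_bnd v0 (bnd_it bA w m); lra.
  - have -> : Ex P (fun w => m%:R * (b - del) - lnv v (it A w m)) =
      m%:R * (b - del) - expansion A P m v.
      rewrite /expansion -[X in _ = X - _](EE_cst A P m) -(EEB mA bA)//; exact: nice_cst.
    have := HN m (leqnSn N) v v0; lra.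
elim => [|k IH] v v0.
  by rewrite mul0n EE0 mul0r /lnv mul1mx subrr subr0 mulr0 expR0.
have nE c (u : 'cV[R]_d) : u != 0 -> nice (fun M => expR (t * (c - lnv u M))).
  by move=> u0; apply: nice_scaled_exp; exact: nice_lnv.
rewrite mulSn (EE_comp mA bA PI); last exact: nE.
apply: le_trans (base v v0); apply: (le_EE mA bA).
- exact: (nice_EE mA bA _ (k * m) (nE _ v v0)).
- exact: nE.
move=> M bM; have Mv0 := bnd_neq0 bM v0.
apply: (@le_trans _ _ (expR (t * (m%:R * (b - del) - lnv v M)) *
    EE A P (k * m) (fun M' => expR (t * ((k * m)%:R * (b - del) - lnv (M *m v) M'))))).
  rewrite -(EEZ mA bA); last exact: nE.
  rewrite le_eqVlt; apply/orP; left; apply/eqP; apply: eq_Ex => w.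
  by rewrite -expRD lnv_mul natrD; congr expR; ring.
by rewrite ler_piMr ?expR_ge0// IH.
Qed.

(** Growth is almost never far below the rate [b], by [inverse_moment]. If it also exceeded c > b
    with positive probability, its mean would exceed n b. *)
Lemma stalling_not_fast (b c : R) (v : 'cV[R]_d) : fn v = 1 ->
  (forall n, expansion A P n v <= n%:R * b) -> (forall b', b' < b -> expands_by A P b') ->
  b < c ->
  {ae P, forall w, ~ exists N, forall n, (N <= n)%N -> n%:R * c <= lnv v (it A w n)}.
Proof.
move=> v1 av Hb bc; have v0 : v != 0 by rewrite -fn_gt0 v1.
have nl := nice_lnv v0.
pose G N : set Om := [set w | forall n, (N <= n)%N -> n%:R * c <= lnv v (it A w n)].
have mG N : measurable (G N).
  have -> : G N = \bigcap_(n in [set n | (N <= n)%N]) [set w | n%:R * c <= lnv v (it A w n)].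
    by apply/seteqP; split.
  apply: bigcap_measurableType => n _; apply: measurable_ge_set.
  by case: (bm_it mA bA n nl).
suff G0 N : P (G N) = 0%E.
  apply: (@filterS _ _ _ [set w | forall N, ~ G N w]) => [w h [N HN]|]; first exact: (h N).
  apply: ae_foralln => N; apply: (negligibleP P _).2.
    by apply: measurableC; apply: measurableC.
  by have := G0 N; rewrite -{1}(setCK (G N)).
have PE : P (G N) = (fine (P (G N)))%:E by rewrite fineK// fin_num_measure.
rewrite PE; congr (_%:E); set p := fine _.
have p0 : 0 <= p by rewrite fine_ge0.
apply/eqP; rewrite eq_le p0 andbT leNgt; apply/negP => pgt0.
(* The deficit 2 n [del] and the moment error, at most n [del], must stay below the gain n (c - b)
   p. *)
pose del := (c - b) * p / 6.
have del0 : 0 < del by rewrite divr_gt0// mulr_gt0// subr_gt0.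
have [m [t [m0 t0 Hmt]]] := inverse_moment (Hb (b - del) ltac:(by rewrite ltrBlDr ltrDl)) del0.
have [K HK] := archimedean_mul t^-1 del0.
pose k := maxn K.+1 N; pose n := (k * m)%N.
have kn : (k <= n)%N by rewrite leq_pmulr.
have nN : (N <= n)%N by rewrite (leq_trans _ kn)// leq_maxr.
have nK : (K < n)%N by rewrite (leq_trans _ kn)// leq_maxl.
have hK : t^-1 <= n%:R * del.
  by rewrite (le_trans HK)// ler_wpM2r ?(ltW del0)// ler_nat ltnW.
have := Hmt k v v0; rewrite -/n; set y := n%:R * (b - del - del) => hE.
pose X (w : Om) := expR (t * (y - lnv v (it A w n))).
have bX : bm X by apply: (bm_it mA bA n (nice_scaled_exp t y nl)).
have bG : bm (fun w => \1_(G N) w : R) by exact: bm_indic.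
(* A pointwise lower bound of the growth: at least n c on [G N], and elsewhere [y] minus an excess
   of mean at most t^-1. *)
pose Y (w : Om) := y - t^-1 * X w + n%:R * (c - b + 2 * del) * \1_(G N) w.
have YE : Ex P Y = y - t^-1 * Ex P X + n%:R * (c - b + 2 * del) * p.
  rewrite /Y ExD; [|by apply: bmB; [exact: bm_cst|exact: bmZ]|exact: bmZ].
  by rewrite ExB ?Ex_cst ?ExZ// ?Ex_indic//; [exact: bm_cst|exact: bmZ].
have YX w : Y w <= lnv v (it A w n).
  have X0 : 0 <= t^-1 * X w by rewrite mulr_ge0 ?expR_ge0// invr_ge0 ltW.
  rewrite /Y indicE; have [/set_mem/(_ n nN) h|_] := boolP (w \in _).
    rewrite mulr1 /y; lra.
  rewrite mulr0 addr0 lerBlDr -lerBlDl ler_pdivlMl// /X.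
  have := expR_ge1Dx (t * (y - lnv v (it A w n))); lra.
have : Ex P Y <= expansion A P n v.
  apply: le_Ex => //; last exact: (bm_it mA bA n nl).
  by apply: bmD; [apply: bmB; [exact: bm_cst|exact: bmZ]|exact: bmZ].
rewrite YE => /le_trans /(_ (av n)).
have tX : t^-1 * Ex P X <= t^-1 by rewrite ler_piMr// invr_ge0 ltW.
have n0 : 0 < n%:R :> R by rewrite ltr0n (leq_trans _ nK).
have h3 : 0 < n%:R * del by exact: mulr_gt0.
have h1 : 0 <= n%:R * del * p by exact: mulr_ge0 (ltW h3) p0.
have h2 : n%:R * ((c - b) * p) = 6 * (n%:R * del) by rewrite /del; field.
rewrite /y; lra.
Qed.

End rates.

(** If all basis vectors were slow, the columns of M_n would bound its norm at a rate close to g2 -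
    g1, below g1. *)
Lemma not_all_slow (R : realType) d (M : nat -> 'M[R]_d) (g1 g2 : R) : (0 < d)%N -> g2 < 2 * g1 ->
  (forall e : R, 0 < e -> exists N, forall n, (N <= n)%N ->
    `|ln (fn (M n)) - n%:R * g1| <= n%:R * e) ->
  (forall (j : 'I_d) (e : R), 0 < e -> exists N, forall n, (N <= n)%N ->
    fn (M n *m (delta_mx j 0 : 'cV[R]_d)) <= expR (n%:R * (g2 - g1 + e))) ->
  (forall n, 0 < fn (M n)) -> False.
Proof.
move=> dpos gap l1 sw fM.
pose th := (2 * g1 - g2) / 4; have th0 : 0 < th by rewrite divr_gt0// subr_gt0.
have [N1 H1] := l1 th th0.
have /choice[N2 H2] j := sw j th th0.
have [N3 H3] := archimedean_mul (d%:R : R) th0.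
pose n := (maxn N1 (maxn N3.+1 (\max_j N2 j)))%N.
have := H1 n (leq_maxl _ _); rewrite ler_norml => /andP[h1 _].
have h1' : expR (n%:R * (g1 - th)) <= fn (M n).
  by rewrite -[leRHS]lnK ?posrE// ler_expR; move: h1; rewrite mulrBr; lra.
have h2 : fn (M n) <= d%:R * expR (n%:R * (g2 - g1 + th)).
  apply: fn_le_cols => [|j]; first exact: expR_ge0.
  rewrite colE H2// /n !leq_max; apply/orP; right; apply/orP; right.
  exact: leq_bigmax.
have h3 : d%:R < expR (n%:R * th).
  have h : N3%:R * th <= n%:R * th.
    by rewrite ler_wpM2r ?(ltW th0)// ler_nat /n !leq_max leqnSn !orbT.
  apply: (le_lt_trans (le_trans H3 h)); apply: (lt_le_trans _ (expR_ge1Dx _)).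
  by rewrite ltrDr.
have := le_trans h1' h2; apply/negP; rewrite -ltNge.
have -> : n%:R * (g1 - th) = n%:R * th + n%:R * th + n%:R * (g2 - g1 + th).
  by rewrite /th; field.
rewrite expRD ltr_pM2r ?expR_gt0// expRD (lt_le_trans h3)// ler_peMr ?expR_ge0//.
by rewrite -expR0 ler_expR mulr_ge0// ltW.
Qed.

Section slow_subspace.
Context {R : realType} (d : nat) d0 (T : measurableType d0).
Variables (A : T -> 'M[R]_d) (mA : mxmeas A).
Variables (kappa : R) (kappa0 : 0 <= kappa) (bA : forall x, bnd kappa (A x)).
Variables (mu : probability T R).
Local Notation Om := (prodT int T).
Variables (P : probability Om R) (PI : iid_law mu P).
Hypothesis d2 : (2 <= d)%N.
Let dpos : (0 < d)%N. Proof. exact: leq_trans d2. Qed.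
Local Notation g1 := (rate1 A P).
Local Notation g2 := (rate2 A P).

Lemma ae_slow_or_fast (v : 'cV[R]_d) : g2 < 2 * g1 -> v != 0 -> {ae P, forall w,
  slow A (g2 - g1) w v \/
  forall e : R, 0 < e -> exists N, forall n, (N <= n)%N -> expR (n%:R * (g1 - e)) <= fn (it A w n *m v)}.
Proof.
move=> gap v0.
apply: (ae_and (rate1_ae mA kappa0 bA PI dpos) (rate2_ae mA kappa0 bA PI d2)) => w l1 l2.
have [h|h] := @slow_or_fast R d (it A w) (fun n => A (w n%:Z)) kappa g1 g2 d2 (fun=> erefl)
    (fun n => bA _) (fun n => ex_intro (fun l => bnd l (it A w n)) _ (bnd_it bA w n))
    gap l1 l2 v; last by right.
by left => j; apply: h; rewrite invr_gt0.
Qed.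

Lemma probability_ae_ex d' (X : measurableType d') (Q : probability X R) (C : X -> Prop) :
  {ae Q, forall x, C x} -> exists x, C x.
Proof.
move=> [B [mB B0 CB]]; apply: contrapT => /forallNP nC.
have BT : B = setT by apply/seteqP; split => // x _; apply: CB; exact: nC.
have := probability_setT Q; rewrite -BT => /eqP.
by rewrite [X in X == _]B0 eq_sym onee_eq0.
Qed.

Lemma ae_forall_ord d' (X : measurableType d') (Q : probability X R) m (C : 'I_m -> X -> Prop) :
  (forall i, {ae Q, forall x, C i x}) -> {ae Q, forall x, forall i, C i x}.
Proof.
move=> h; pose C' n x := forall i : 'I_m, nat_of_ord i = n -> C i x.
have : {ae Q, forall x, forall n, C' n x}.
  apply: ae_foralln => n; have [nm|mn] := ltnP n m.
    by apply: filterS (h (Ordinal nm)) => x hx i /esym ni; rewrite (_ : i = Ordinal nm)//; apply/val_inj.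
  by apply: aeW => x i iE; have := ltn_ord i; rewrite iE ltnNge mn.
by apply: filterS => x hx i; exact: (hx i).
Qed.

(** Invariance is reduced to finitely many vectors because the null set of exceptional matrices
    depends on the vector. *)
Lemma linear_image_eq (V : {vspace 'cV[R]_d}) (M : 'M[R]_d) : M \in unitmx ->
  (forall i : 'I_(\dim V), M *m (vbasis V)`_i \in V) ->
  (linfun (mulmx M) @: V)%VS = V.
Proof.
move=> uM MV; apply/eqP; rewrite eqEdim; apply/andP; split.
  rewrite -{1}(span_basis (vbasisP V)) limg_span; apply/span_subvP => y.
  move=> /mapP[x xV ->]; have [j] := elimT (nthP 0) xV; rewrite size_tuple => jlt <-.
  by rewrite lfunE; exact: (MV (Ordinal jlt)).
rewrite limg_dim_eq//; apply/eqP; rewrite -subv0; apply/subvP => v /memv_capP[_].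
rewrite memv_ker lfunE /= memv0 => /eqP Mv.
by rewrite -[v](mulKmx uM) Mv mulmx0.
Qed.

(** Failure of uniform expansion near [g1] yields a stalling vector; not being fast, it is almost
    surely slow. The almost surely slow vectors form the required subspace. *)
Theorem slow_subspace_exists : g2 < 2 * g1 ->
  ~ (forall e : R, 0 < e -> expands_by A P (g1 - e)) ->
  exists V : {vspace 'cV[R]_d}, [/\ V != 0%VS, V != fullv,
    {ae mu, forall x, (linfun (mulmx (A x)) @: V)%VS = V} &
    forall v, v \in V -> {ae P, forall w, slow A (g2 - g1) w v}].
Proof.
move=> gap /existsNP[e /not_implyP[e0 /(stalling_vector mA kappa0 bA PI)]].
move=> [b [be Hb [v v1 Hv]]]; have v0 : v != 0 by rewrite -fn_gt0 v1.
have bc : b < g1 - e / 2 by rewrite (le_lt_trans be)// ltrD2l ltrN2 ltr_pdivrMr// ltr_pMr// ltr1n.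
have nfast := stalling_not_fast mA kappa0 bA PI v1 Hv Hb bc.
have sv : {ae P, forall w, slow A (g2 - g1) w v}.
  apply: (ae_and nfast (ae_slow_or_fast gap v0)) => w nf [//|f].
  exfalso; apply: nf; have [|N HN] := f (e / 2); first by rewrite divr_gt0.
  exists N => n /HN h; rewrite /lnv v1 ln1 subr0.
  rewrite -[leLHS]expRK ler_ln ?posrE ?expR_gt0//; exact: lt_le_trans (expR_gt0 _) h.
have [|a u u' su su'|V VS] := @linear_set_vspace _ _
    [set v : 'cV[R]_d | {ae P, forall w, slow A (g2 - g1) w v}].
- by apply: aeW => w; exact: slow0.
- by apply: (ae_and su su') => w; exact: slow_lin.
exists V; split.
- apply/eqP => V0; have := (VS v).2 sv; rewrite V0 memv0; exact/negP.
- apply/eqP => Vf.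
  have sj (j : 'I_d) : {ae P, forall w, slow A (g2 - g1) w (delta_mx j 0)}.
    by apply/VS; rewrite Vf memvf.
  have : {ae P, forall w, forall j : 'I_d, slow A (g2 - g1) w (delta_mx j 0)}.
    exact: ae_forall_ord.
  move=> sj'; have /probability_ae_ex[w [l1 sw]] :=
    ae_and (rate1_ae mA kappa0 bA PI dpos) sj' (fun w p q => conj p q).
  apply: (not_all_slow dpos gap l1) => [j e' e'0|n]; first exact: slow_bound.
  exact: lt_le_trans (expR_gt0 _) (bnd_fn_ge dpos (bnd_it bA w n)).
- have sb (i : 'I_(\dim V)) : {ae mu, forall x, A x *m (vbasis V)`_i \in V}.
    have bV : (vbasis V)`_i \in V by apply: vbasis_mem; apply: mem_nth; rewrite size_tuple.
    have sv' : {ae P, forall w, slow A (g2 - g1) w (vbasis V)`_i} by exact: (VS _).1.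
    have inv := slow_invariant mA PI sv'.
    by apply: (@filterS _ _ _ _ _ _ inv) => x /VS.
  apply: filterS (ae_forall_ord sb) => x hx.
  by apply: linear_image_eq => //; exact: bnd_unit (bA x).
- by move=> u /VS.
Qed.

End slow_subspace.

(** * Lyapunov exponents of continuous cocycles *)

Section perturbation.
Context {R : realType} (d : nat).
Implicit Types (M N : 'M[R]_d).

Lemma expR_half : expR (-1) <= 2^-1 :> R.
Proof.
rewrite expRN lef_pV2 ?posrE ?expR_gt0//; have := expR_ge1Dx (1 : R); lra.
Qed.

(** A perturbation of half the least stretch changes the stretch by at most a factor 2 either way,
    and 2 <= e accounts for the 1. *)
Lemma bnd_perturb k M N : 0 <= k -> bnd k M -> fn (N - M) <= expR (- k) / 2 -> bnd (k + 1) N.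
Proof.
move=> k0 bM NM v; have [h1 h2] := bM v.
have h3 : fn ((N - M) *m v) <= expR (- k) / 2 * fn v.
  by rewrite (le_trans (fn_mul _ _))// ler_wpM2r ?fn_ge0.
have h4 := fn_dist (N *m v) (M *m v); rewrite -mulmxBl in h4.
have := le_trans h4 h3; rewrite ler_distl => /andP[l u].
have e1 := expR_half; have e2 : 2 <= expR 1 :> R by have := expR_ge1Dx (1 : R); lra.
have f0 := fn_ge0 v; split.
  apply: le_trans l; apply: (@le_trans _ _ (expR (- k) * fn v - expR (- k) / 2 * fn v)); last first.
    by rewrite lerD2r.
  rewrite opprD expRD -mulrBl ler_wpM2r//.
  have -> : expR (- k) - expR (- k) / 2 = expR (- k) * 2^-1 :> R by field.
  by rewrite ler_wpM2l ?expR_ge0.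
apply: (le_trans u); apply: (@le_trans _ _ ((expR k + expR (- k) / 2) * fn v)).
  by rewrite mulrDl lerD2r.
rewrite ler_wpM2r// expRD.
have h5 : expR (- k) <= expR k :> R by rewrite ler_expR; lra.
have h6 := expR_ge0 k.
have : expR k * 2 <= expR k * expR 1 by rewrite ler_wpM2l.
lra.
Qed.

Lemma unit_bnd M : M \in unitmx -> exists2 k, 0 <= k & bnd k M.
Proof.
move=> uM; pose s := fn M + fn (invmx M) + 1.
have s1 : 1 <= s by rewrite lerDr addr_ge0 ?fn_ge0.
have s0 : 0 < s by rewrite (lt_le_trans _ s1).
exists (ln s); first exact: ln_ge0.
move=> v; rewrite expRN lnK ?posrE//; split.
  rewrite ler_pdivrMl// -{1}[v](mulKmx uM) (le_trans (fn_mul _ _))// ler_wpM2r ?fn_ge0//.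
  by rewrite /s; have := fn_ge0 M; lra.
rewrite (le_trans (fn_mul _ _))// ler_wpM2r ?fn_ge0//.
by rewrite /s; have := fn_ge0 (invmx M); lra.
Qed.

End perturbation.

(** Points violating the integer constants would cluster at some [p], against the constant valid
    near [p]. *)
Lemma compact_uniform (R : realType) (X : topologicalType) (Q : R -> X -> Prop) :
  compact [set: X] -> (forall C C' x, C <= C' -> Q C x -> Q C' x) ->
  (forall p : X, exists C, \forall x \near p, Q C x) -> exists C, forall x, Q C x.
Proof.
move=> cX Qm Ql; apply: contrapT => /forallNP nQ.
have /choice[u Hu] (n : nat) : exists x, ~ Q n%:R x by apply/existsNP; exact: nQ.
have [|p [_ cp]] := cX (u @ \oo) _; first exact: filterT.
have [C HC] := Ql p.
have [N HN] := archimedean_mul C (ltr01 : 0 < 1 :> R); rewrite mulr1 in HN.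
have [] := cp [set x | exists2 n, (N <= n)%N & x = u n] [set x | Q C x] _ HC.
  by exists N => // n /= Nn; exists n.
move=> _ [[n Nn ->]] /= QC; apply: (Hu n); apply: Qm QC.
by rewrite (le_trans HN)// ler_nat.
Qed.

Section continuous_cocycle.
Context {R : realType} (d : nat) (Sigma : pmetricType R).
Hypothesis cptSigma : compact [set: Sigma].
Variable A : GLmap d Sigma.

Lemma GLmap_near p e : 0 < e -> \forall x \near p, fn (A x - A p) < e.
Proof.
move=> e0; have e1 : 0 < e / d.+1%:R by rewrite divr_gt0.
have := @cvgr_dist_lt _ _ _ _ _ A (A p) (@GLmap_continuous R d Sigma A p) _ e1.
move=> /(_ (nbhs_filter p)) near_p; apply: filterS near_p => x hx; rewrite fnBC.
have hd : fn (A p - A x) <= d%:R * `|A p - A x|.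
  rewrite -(@ler_pXn2r _ 2)// ?nnegrE ?fn_ge0 ?mulr_ge0//.
  rewrite sqr_fn /fn2.
  apply: (@le_trans _ _ (\sum_(i < d) \sum_(j < d) `|A p - A x| ^+ 2)).
    apply: ler_sum => i _; apply: ler_sum => j _.
    rewrite -[leLHS]real_normK ?num_real// ler_pXn2r ?nnegrE//.
    rewrite [leRHS]mx_normrE.
    exact: (le_bigmax 0 (fun ij : 'I_d * 'I_d => `|(A p - A x) ij.1 ij.2|) (i, j)).
  rewrite sumr_const sumr_const !card_ord exprMn -mulrnA -[leLHS]mulr_natl natrM.
  by rewrite -expr2.
apply: (le_lt_trans hd); apply: (@le_lt_trans _ _ (d.+1%:R * `|A p - A x|)).
  by rewrite ler_wpM2r// ler_nat.
by rewrite mulrC -ltr_pdivlMr.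
Qed.

Lemma GLmap_mxmeas : mxmeas (A : borel Sigma -> 'M[R]_d).
Proof.
move=> i j; apply: (measurability _ (RGenOInfty.measurableE R)) => //.
move=> _ [_ [c ->] <-]; rewrite setTI; apply: sub_sigma_algebra.
rewrite openE => p /=; rewrite in_itv /= andbT => cp.
have e0 : 0 < A p i j - c by rewrite subr_gt0.
apply: filterS (GLmap_near p e0) => x hx; rewrite /= in_itv /= andbT.
have := le_lt_trans (fn_entry (A x - A p) i j) hx; rewrite !mxE ltr_norml => /andP[h _].
lra.
Qed.

Lemma GLmap_bnd : exists2 k, 0 <= k & forall x, bnd k (A x).
Proof.
have [|p|C HC] := @compact_uniform R Sigma (fun C x => bnd C (A x)) cptSigma.
- by move=> C C' x; exact: bnd_weak.
- have [k k0 bk] := unit_bnd (GLmap_unit A p); exists (k + 1).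
  have e0 : 0 < expR (- k) / 2 :> R by rewrite divr_gt0// expR_gt0.
  by apply: filterS (GLmap_near p e0) => x hx; apply: (bnd_perturb k0 bk); exact: ltW.
exists (Num.max 0 C); first by rewrite le_max lexx.
by move=> x; apply: bnd_weak (HC x); rewrite le_max lexx orbT.
Qed.

Lemma iterate_it w n : iterate A w n = it (A : borel Sigma -> 'M[R]_d) w n.
Proof. by elim: n => //= n ->. Qed.

End continuous_cocycle.

(** Existence of an i.i.d. law is what makes the choice in [product_measure] return one and not its
    default. *)
Lemma product_measure_iid (R : realType) (Sigma : pmetricType R) (mu : probability (borel Sigma) R) :
  iid_law mu (product_measure mu : probability (prodT int (borel Sigma)) R).
Proof.
have [P PI] := iid_law_exists mu.
have : is_product_measure mu (product_measure mu).
  rewrite /product_measure.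
  exact: (@xgetPex _ _ [set P | is_product_measure mu P] (ex_intro _ P PI)).
exact.
Qed.

Lemma cvg_rate (R : realType) (x y : nat -> R) (g C : R) :
  (forall e, 0 < e -> exists N, forall n, (N <= n)%N -> `|x n - n%:R * g| <= n%:R * e) ->
  (forall n, `|x n - y n| <= C) -> n%:R^-1 * y n @[n --> \oo] --> g.
Proof.
move=> hx hxy; apply/cvgrPdist_le => e e0; have e20 : 0 < e / 2 by rewrite divr_gt0.
have [N1 H1] := hx _ e20; have [N2 H2] := archimedean_mul C e20.
exists (maxn N1 N2).+1 => // n /=; rewrite gtn_max => /andP[n1 n2].
have n0 : 0 < n%:R :> R by rewrite ltr0n (leq_ltn_trans _ n1).
have -> : g - n%:R^-1 * y n = n%:R^-1 * (n%:R * g - y n) by field; rewrite gt_eqF.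
rewrite normrM gtr0_norm ?invr_gt0// mulrC ler_pdivrMr//.
have -> : n%:R * g - y n = (x n - y n) - (x n - n%:R * g) by ring.
apply: (le_trans (ler_normB _ _)).
have := H1 n (ltnW n1); have := hxy n.
have : N2%:R * (e / 2) <= n%:R * (e / 2) by rewrite ler_wpM2r ?(ltW e20)// ler_nat ltnW.
move: `|x n - y n| `|_ - _| => s t; have -> : n%:R * (e / 2) = e * n%:R / 2 by field.
move: H2; lra.
Qed.

Section lyapunov_exponents.
Context {R : realType} (d : nat) (Sigma : pmetricType R).

Lemma as_limit_unique (mu : probability (borel Sigma) R) u l l' :
  as_limit mu u l -> as_limit mu u l' -> l = l'.
Proof.
move=> h h'; have /probability_ae_ex[w [c c']] := ae_and h h' (fun w p q => conj p q).
exact: (norm_cvg_unique c c').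
Qed.

Lemma xget_limit (mu : probability (borel Sigma) R) u l :
  as_limit mu u l -> xget 0 [set l | as_limit mu u l] = l.
Proof. by move=> h; apply: xget_unique => // y hy; exact: as_limit_unique hy h. Qed.

Hypothesis cptSigma : compact [set: Sigma].
Hypothesis d2 : (2 <= d)%N.
Let dpos : (0 < d)%N. Proof. exact: leq_trans d2. Qed.
Variables (A : GLmap d Sigma) (mu : probability (borel Sigma) R).
Local Notation Om := (prodT int (borel Sigma)).
Local Notation P := (product_measure mu : probability Om R).
Local Notation A' := (A : borel Sigma -> 'M[R]_d).

Lemma ln_ratio_bound (x y C : R) : 0 < x -> 0 < y -> 1 <= C -> x <= y -> y <= C * x ->
  `|ln y - ln x| <= ln C.
Proof.
move=> x0 y0 C1 xy yC; have C0 : 0 < C by exact: lt_le_trans C1.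
rewrite ger0_norm; last by rewrite subr_ge0 ler_ln.
by rewrite lerBlDr -lnM ?posrE// ler_ln ?posrE// mulr_gt0.
Qed.

(** The errors are bounded uniformly in the matrix, so they vanish after division by time: log s_1
    has the rate of [ln (fn M)], and log s_2 that of [ln (wdg M) - ln (fn M)]. *)
Lemma ln_singular_values n (M : 'M[R]_d) : bnd n M ->
  `|ln (fn M) - ln (singular_value M 1)| <= ln d%:R /\
  `|(ln (wdg M) - ln (fn M)) - ln (singular_value M 2)| <= 2 * ln d%:R.
Proof.
move=> bM; have [s1 s2 h1 h2 [h3 h4]] := singular_values_bounds d2 (bnd_wdg_gt0 d2 bM).
have fM : 0 < fn M by exact: lt_le_trans (expR_gt0 _) (bnd_fn_ge dpos bM).
have d1 : 1 <= d%:R :> R by rewrite ler1n.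
have e1 := ln_ratio_bound s1 fM d1 h1 h2; split => //.
have e2 := ln_ratio_bound (mulr_gt0 s1 s2) (bnd_wdg_gt0 d2 bM) d1 h3 h4.
rewrite lnM ?posrE// in e2.
have -> : ln (wdg M) - ln (fn M) - ln (singular_value M 2) =
  (ln (wdg M) - (ln (singular_value M 1) + ln (singular_value M 2))) -
  (ln (fn M) - ln (singular_value M 1)) by ring.
apply: (le_trans (ler_normB _ _)); rewrite mulr_natl mulr2n; exact: lerD.
Qed.

Lemma lyapunov1E : lyapunov (A, mu) 1 = rate1 A' P.
Proof.
have [k k0 bk] := GLmap_bnd cptSigma A.
apply: xget_limit; have h := rate1_ae (GLmap_mxmeas A) k0 bk (product_measure_iid mu) dpos.
apply: (ae_and h h) => w hw _; apply: (cvg_rate (C := ln d%:R) hw) => n.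
have [] := ln_singular_values (@bnd_it R d _ (borel Sigma) A' k bk w n).
by rewrite iterate_it.
Qed.

Lemma lyapunov2E : lyapunov (A, mu) 2 = rate2 A' P - rate1 A' P.
Proof.
have [k k0 bk] := GLmap_bnd cptSigma A.
apply: xget_limit.
have h1 := rate1_ae (GLmap_mxmeas A) k0 bk (product_measure_iid mu) dpos.
have h2 := rate2_ae (GLmap_mxmeas A) k0 bk (product_measure_iid mu) d2.
apply: (ae_and h1 h2) => w hw1 hw2.
apply: (cvg_rate (C := 2 * ln d%:R) (x := fun n => ln (wdg (it A' w n)) - ln (fn (it A' w n)))).
  move=> e e0; have e20 : 0 < e / 2 by rewrite divr_gt0.
  have [N1 H1] := hw1 _ e20; have [N2 H2] := hw2 _ e20.
  exists (maxn N1 N2) => n; rewrite geq_max => /andP[/H1 u1 /H2 u2].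
  move: (ln _) (ln _) (rate1 _ _) (rate2 _ _) u1 u2 => a b c1 c2 u1 u2.
  have -> : n%:R * e = n%:R * (e / 2) + n%:R * (e / 2) by field.
  have -> : a - b - n%:R * (c2 - c1) = (a - n%:R * c2) - (b - n%:R * c1) by ring.
  by rewrite (le_trans (ler_normB _ _))// lerD.
move=> n; have [_] := ln_singular_values (@bnd_it R d _ (borel Sigma) A' k bk w n).
by rewrite iterate_it.
Qed.

End lyapunov_exponents.

(** * Exponents on invariant subspaces *)

Section opnorm.
Context {R : realType} (d : nat).
Implicit Types (V : {vspace 'cV[R]_d}) (M : 'M[R]_d).

Let opnorm_set V M := [set enorm (M *m v) | v in [set v | v \in V /\ enorm v <= 1]].

Let opnorm_set0 V M : opnorm_set V M 0.
Proof. by exists 0; [rewrite /= mem0v fn_enorm fn0|rewrite mulmx0 fn_enorm fn0]. Qed.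

Lemma opnorm_on_le V M c : (forall v, v \in V -> fn v <= 1 -> fn (M *m v) <= c) ->
  opnorm_on V M <= c.
Proof.
move=> h; apply: ge_sup; first by exists 0; exact: opnorm_set0.
by move=> y [v [vV]]; rewrite !fn_enorm => v1 <-; exact: h.
Qed.

Let opnorm_has_sup V M : has_sup (opnorm_set V M).
Proof.
split; first by exists 0; exact: opnorm_set0.
exists (fn M) => y [v [vV]]; rewrite !fn_enorm => v1 <-.
by rewrite (le_trans (fn_mul _ _))// ler_piMr ?fn_ge0.
Qed.

Lemma opnorm_on_ge0 V M : 0 <= opnorm_on V M.
Proof. by apply: sup_upper_bound; [exact: opnorm_has_sup|exact: opnorm_set0]. Qed.

Lemma opnorm_on_apply V M v : v \in V -> fn (M *m v) <= opnorm_on V M * fn v.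
Proof.
move=> vV; have [->|v0] := eqVneq v 0; first by rewrite mulmx0 fn0 mulr0.
have fv : 0 < fn v by rewrite fn_gt0.
rewrite -ler_pdivrMr// mulrC -[X in X * _]gtr0_norm ?invr_gt0// -fnZ scalemxAr.
apply: sup_upper_bound; first exact: opnorm_has_sup.
exists ((fn v)^-1 *: v); last by rewrite fn_enorm.
by rewrite /= memvZ// fn_enorm fn_normalize.
Qed.

Lemma fn_le_opnorm M : fn M <= d%:R * opnorm M.
Proof.
apply: fn_le_cols => [|j]; first exact: opnorm_on_ge0.
have := opnorm_on_apply M (memvf (delta_mx j 0 : 'cV[R]_d)).
by rewrite fn_delta mulr1 colE.
Qed.

End opnorm.

Section subspace_coordinates.
Context {R : realType} (d : nat).
Variable V : {vspace 'cV[R]_d}.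

(** The inclusion of [V] in the coordinates of a basis; [coord_mx] is a left inverse of it, defined
    on the whole space. They turn the action on [V] into matrices of size [\dim V]. *)
Definition basis_mx : 'M[R]_(d, \dim V) := \matrix_(i, j) (vbasis V)`_j i 0.
Definition coord_mx : 'M[R]_(\dim V, d) := \matrix_(i, j) coord (vbasis V) i (delta_mx j 0).
Local Notation J := basis_mx.
Local Notation K := coord_mx.

Lemma col_basis_mx j : col j J = (vbasis V)`_j.
Proof. by apply/matrixP => i k; rewrite !mxE (ord1 k). Qed.

Lemma vbasis_in (j : 'I_(\dim V)) : (vbasis V)`_j \in V.
Proof. by apply: vbasis_mem; apply: mem_nth; rewrite size_tuple. Qed.

Lemma coord_mxE (v : 'cV[R]_d) i : (K *m v) i 0 = coord (vbasis V) i v.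
Proof.
rewrite [in RHS](matrix_sum_delta v) !mxE linear_sum; apply: eq_bigr => j _.
by rewrite big_ord1 linearZ mxE /= mulrC.
Qed.

Lemma basis_mxE (u : 'cV[R]_(\dim V)) : J *m u = \sum_j u j 0 *: (vbasis V)`_j.
Proof.
apply/matrixP => i k; rewrite (ord1 k) mxE summxE; apply: eq_bigr => j _.
by rewrite !mxE mulrC.
Qed.

Lemma basis_mx_in u : J *m u \in V.
Proof. by rewrite basis_mxE rpred_sum// => j _; rewrite rpredZ// vbasis_in. Qed.

Lemma basis_coord_mx v : v \in V -> J *m (K *m v) = v.
Proof.
move=> /coord_vbasis vE; rewrite basis_mxE [RHS]vE.
by apply: eq_bigr => j _; rewrite coord_mxE.
Qed.

Lemma coord_basis_mx : K *m J = 1%:M.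
Proof.
apply/matrixP => i j; rewrite mxE.
transitivity ((K *m (vbasis V)`_j) i 0).
  by rewrite mxE; apply: eq_bigr => k _; rewrite [J _ _]mxE.
rewrite coord_mxE coord_free ?(basis_free (vbasisP V))//.
by rewrite mxE eq_sym.
Qed.

Lemma basis_mx_lower (u : 'cV[R]_(\dim V)) : fn u <= fn K * fn (J *m u).
Proof. by rewrite -{1}[u]mul1mx -coord_basis_mx -mulmxA fn_mul. Qed.

Hypothesis V0 : V != 0%VS.

Lemma dim_gt0 : (0 < \dim V)%N.
Proof. by rewrite lt0n dimv_eq0. Qed.

Lemma fn_basis_mx_gt0 : 0 < fn J.
Proof.
rewrite fn_gt0; apply/eqP => J0.
have := coord_basis_mx; rewrite J0 mulmx0 => /matrixP /(_ (Ordinal dim_gt0) (Ordinal dim_gt0)).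
by rewrite !mxE eqxx => /eqP; rewrite eq_sym oner_eq0.
Qed.

Lemma fn_coord_mx_gt0 : 0 < fn K.
Proof.
rewrite fn_gt0; apply/eqP => K0.
have := coord_basis_mx; rewrite K0 mul0mx => /matrixP /(_ (Ordinal dim_gt0) (Ordinal dim_gt0)).
by rewrite !mxE eqxx => /eqP; rewrite eq_sym oner_eq0.
Qed.

Lemma opnorm_on_bounds (M : 'M[R]_d) :
  opnorm_on V M <= fn K * fn (M *m J) /\ fn (M *m J) <= opnorm_on V M * fn J.
Proof.
have op0 := opnorm_on_ge0 V M; split.
  apply: opnorm_on_le => v vV v1.
  rewrite -(basis_coord_mx vV) mulmxA mulrC (le_trans (fn_mul _ _))//.
  by rewrite ler_wpM2l ?fn_ge0// (le_trans (fn_mul _ _))// ler_piMr ?fn_ge0.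
rewrite -(@ler_pXn2r _ 2)// ?nnegrE ?fn_ge0 ?mulr_ge0 ?fn_ge0//.
rewrite exprMn !sqr_fn [fn2 J]fn2_cols fn2_cols mulr_sumr; apply: ler_sum => j _.
rewrite -!sqr_fn -exprMn ler_pXn2r// ?nnegrE ?fn_ge0 ?mulr_ge0 ?fn_ge0//.
have -> : col j (M *m J) = M *m col j J by rewrite !colE mulmxA.
by apply: opnorm_on_apply; rewrite col_basis_mx vbasis_in.
Qed.

Lemma ln_opnorm_on (M : 'M[R]_d) : M \in unitmx ->
  `|ln (fn (M *m J)) - ln (opnorm_on V M)| <= `|ln (fn K)| + `|ln (fn J)|.
Proof.
move=> uM; have [h1 h2] := opnorm_on_bounds M.
have K0 := fn_coord_mx_gt0; have J0 := fn_basis_mx_gt0.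
have MJ : 0 < fn (M *m J).
  rewrite fn_gt0; apply/eqP => MJ0; move: J0.
  by rewrite -(mulKmx uM J) MJ0 mulmx0 fn0 ltxx.
have op : 0 < opnorm_on V M by rewrite -(pmulr_lgt0 _ J0) (lt_le_trans MJ).
have l1 : ln (opnorm_on V M) <= ln (fn K) + ln (fn (M *m J)).
  by rewrite -lnM ?posrE// ler_ln ?posrE// mulr_gt0.
have l2 : ln (fn (M *m J)) <= ln (opnorm_on V M) + ln (fn J).
  by rewrite -lnM ?posrE// ler_ln ?posrE// mulr_gt0.
rewrite ler_norml; have n1 := ler_norm (ln (fn K)); have n2 := ler_norm (ln (fn J)).
have n3 := normr_ge0 (ln (fn K)); have n4 := normr_ge0 (ln (fn J)).
move: l1 l2 n1 n2 n3 n4; move: `|ln (fn K)| `|ln (fn J)| (ln _) (ln _) (ln _) (ln _) => a b x y z t *.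
apply/andP; split; lra.
Qed.

End subspace_coordinates.

Lemma rate_perturb (R : realType) (x y : nat -> R) (g C : R) :
  (forall e, 0 < e -> exists N, forall n, (N <= n)%N -> `|x n - n%:R * g| <= n%:R * e) ->
  (forall n, `|x n - y n| <= C) ->
  forall e, 0 < e -> exists N, forall n, (N <= n)%N -> `|y n - n%:R * g| <= n%:R * e.
Proof.
move=> hx hxy e e0; have e20 : 0 < e / 2 by rewrite divr_gt0.
have [N1 H1] := hx _ e20; have [N2 H2] := archimedean_mul C e20.
exists (maxn N1 N2) => n; rewrite geq_max => /andP[n1 n2].
have -> : y n - n%:R * g = (x n - n%:R * g) - (x n - y n) by ring.
rewrite (le_trans (ler_normB _ _))//.
have h3 : N2%:R * (e / 2) <= n%:R * (e / 2) by rewrite ler_wpM2r ?(ltW e20)// ler_nat.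
have -> : n%:R * e = n%:R * (e / 2) + n%:R * (e / 2) by field.
by rewrite lerD// ?H1// (le_trans (hxy n))// (le_trans H2).
Qed.

Section restriction.
Context {R : realType} (d : nat) d0 (T : measurableType d0).
Variables (A : T -> 'M[R]_d) (mA : mxmeas A).
Variables (kappa : R) (kappa0 : 0 <= kappa) (bA : forall x, bnd kappa (A x)).
Variables (mu : probability T R).
Local Notation Om := (prodT int T).
Variables (P : probability Om R) (PI : iid_law mu P).
Variable V : {vspace 'cV[R]_d}.
Hypothesis V0 : V != 0%VS.
Hypothesis AV : {ae mu, forall x, (linfun (mulmx (A x)) @: V)%VS = V}.
Local Notation J := (basis_mx V).
Local Notation K := (coord_mx V).

(** In coordinates, the action on [V] is the cocycle K A J of bounded distortion, to which the
    Furstenberg-Kesten theorem applies; J and K change norms by bounded factors. *)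
Lemma restriction_rate : exists L, {ae P, forall w, forall e, 0 < e ->
  exists N, forall n, (N <= n)%N -> `|ln (fn (it A w n *m J)) - n%:R * L| <= n%:R * e}.
Proof.
have [Z [mZ Z0 AZ]] := AV.
(* On the null set where [V] may fail to be invariant, [A] is replaced by the identity, so that the
   restriction is invertible everywhere; almost every sequence avoids this set at all times. *)
pose At x := if x \in Z then 1%:M else A x.
have mAt : mxmeas At.
  move=> i j; have -> : (fun x => At x i j) =
      (fun x => \1_Z x * (1%:M : 'M[R]_d) i j + (1 - \1_Z x) * A x i j).
    apply/funext => x; rewrite /At indicE; case: (x \in Z).
      by rewrite mul1r subrr mul0r addr0.
    by rewrite mul0r add0r subr0 mul1r.
  apply: measurable_funD; apply: measurable_funM => //.
  by apply: measurable_funB.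
have bAt x : bnd kappa (At x).
  by rewrite /At; case: (x \in Z) => //; apply: bnd_weak (@bnd1 R d).
have AtV x v : v \in V -> At x *m v \in V.
  move=> vV; rewrite /At; have [|xZ] := boolP (x \in Z); first by rewrite mul1mx.
  have E : (linfun (mulmx (A x)) @: V)%VS = V.
    by apply: contrapT => nE; move/negP: xZ; apply; apply/mem_set; exact: AZ.
  by have := memv_img (linfun (mulmx (A x))) vV; rewrite E lfunE.
pose B x := K *m At x *m J.
have JB x : J *m B x = At x *m J.
  apply/matrixP => i j; suff : col j (J *m B x) = col j (At x *m J).
    by move=> /matrixP /(_ i 0); rewrite !mxE.
  rewrite !colE /B -!mulmxA basis_coord_mx//; apply: AtV; exact: basis_mx_in.
have K0 := fn_coord_mx_gt0 V0; have J0 := fn_basis_mx_gt0 V0.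
have mB : mxmeas B.
  by apply: mxmeas_mul; [apply: mxmeas_mul => //|]; exact: mxmeas_cst.
have ln0 : 1 <= fn K * fn J.
  have [v vE] : exists v : 'cV[R]_(\dim V), v != 0.
    exists (delta_mx (Ordinal (dim_gt0 V0)) 0); by rewrite -fn_gt0 fn_delta.
  have := le_trans (basis_mx_lower v) (ler_wpM2l (fn_ge0 K) (fn_mul J v)).
  by rewrite mulrA -{1}[fn v]mul1r ler_pM2r// fn_gt0.
pose k' := kappa + ln (fn K * fn J).
have k'0 : 0 <= k' by rewrite addr_ge0// ln_ge0.
have KJ : 0 < fn K * fn J by rewrite mulr_gt0.
have ek' : expR k' = expR kappa * (fn K * fn J) by rewrite expRD lnK.
have bB x : bnd k' (B x).
  move=> v; have [h1 h2] := bAt x (J *m v).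
  rewrite mulmxA -JB -mulmxA in h1 h2.
  have u1 := basis_mx_lower v; have u2 := basis_mx_lower (B x *m v).
  have u3 := fn_mul J v; have u4 := fn_mul J (B x *m v).
  rewrite expRN ek'; split.
    rewrite ler_pdivrMl ?mulr_gt0 ?expR_gt0//.
    apply: (le_trans u1); rewrite mulrCA.
    rewrite [X in _ <= X](_ : _ = fn K * (expR kappa * (fn J * fn (B x *m v)))); last by ring.
    rewrite ler_pM2l//; rewrite expRN ler_pdivrMl ?expR_gt0// in h1.
    by rewrite (le_trans h1)// ler_wpM2l ?expR_ge0.
  apply: (le_trans u2); rewrite [X in _ <= X](_ : _ = fn K * (expR kappa * (fn J * fn v))); last by ring.
  by rewrite ler_pM2l// (le_trans h2)// ler_wpM2l ?expR_ge0.
exists (rate1 B P).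
have Zw : {ae P, forall w : Om, forall n : nat, ~ Z (w n%:Z)}.
  apply: ae_foralln => n.
  exists ((fun w : Om => w n%:Z) @^-1` Z); split.
  - by rewrite -[X in measurable X]setTI; apply: measurable_coord.
  - have := PI (s := [:: n%:Z]) (E := fun=> Z) isT (fun=> mZ).
    rewrite big_seq1 Z0 => <-; congr (P _); apply/seteqP; split => w /=.
      by move=> Zw i; rewrite inE => /eqP ->.
    by apply; rewrite inE.
  - by move=> w /= /contrapT.
apply: (ae_and (rate1_ae mB k'0 bB PI (dim_gt0 V0)) Zw) => w hw nZ.
have itE n : it A w n *m J = J *m it B w n.
  elim: n => [|n IH] /=; first by rewrite mul1mx mulmx1.
  rewrite -mulmxA IH [RHS]mulmxA JB [LHS]mulmxA /At.
  by case: ifPn => // /set_mem /nZ.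
apply: (rate_perturb (C := `|ln (fn J)| + `|ln (fn K)|) hw) => n; rewrite itE.
have bI := bnd_it bB w n.
have I0 : 0 < fn (it B w n) by exact: lt_le_trans (expR_gt0 _) (bnd_fn_ge (dim_gt0 V0) bI).
have u1 : fn (it B w n) <= fn K * fn (J *m it B w n).
  by rewrite -{1}[it B w n]mul1mx -coord_basis_mx -mulmxA fn_mul.
have u2 := fn_mul J (it B w n).
have JI : 0 < fn (J *m it B w n) by rewrite -(pmulr_rgt0 _ K0) (lt_le_trans I0).
have l1 : ln (fn (it B w n)) <= ln (fn K) + ln (fn (J *m it B w n)).
  by rewrite -lnM ?posrE// ler_ln ?posrE// mulr_gt0.
have l2 : ln (fn (J *m it B w n)) <= ln (fn J) + ln (fn (it B w n)).
  by rewrite -lnM ?posrE// ler_ln ?posrE// mulr_gt0.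
have n1 := ler_norm (ln (fn K)); have n2 := ler_norm (ln (fn J)).
have n3 := normr_ge0 (ln (fn K)); have n4 := normr_ge0 (ln (fn J)).
move: l1 l2 n1 n2 n3 n4; move: `|ln (fn K)| `|ln (fn J)| (ln _) (ln _) (ln _) (ln _) => a b x y z t *.
rewrite ler_norml; apply/andP; split; lra.
Qed.

(** Slow basis vectors bound every column of [it A w n *m J], and hence its norm. *)
Lemma restriction_rate_le (l L : R) :
  (forall v, v \in V -> {ae P, forall w, slow A l w v}) ->
  {ae P, forall w, forall e, 0 < e ->
    exists N, forall n, (N <= n)%N -> `|ln (fn (it A w n *m J)) - n%:R * L| <= n%:R * e} ->
  L <= l.
Proof.
move=> sV hL.
have sb : {ae P, forall w, forall j : 'I_(\dim V), slow A l w (vbasis V)`_j}.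
  by apply: ae_forall_ord => j; apply: sV; exact: vbasis_in.
have /probability_ae_ex[w [h s]] := ae_and hL sb (fun w p q => conj p q).
rewrite leNgt; apply/negP => lL.
pose e := (L - l) / 4; have e0 : 0 < e by rewrite divr_gt0// subr_gt0.
have [N1 H1] := h e e0.
have /choice[N2 H2] j := slow_bound (s j) e0.
have [N3 H3] := archimedean_mul (ln (\dim V)%:R) e0.
pose n := (maxn N1 (maxn N3.+1 (\max_j N2 j)))%N.
have dV := dim_gt0 V0.
have J0 := fn_basis_mx_gt0 V0.
have nR : 0 < n%:R :> R by rewrite ltr0n /n !leq_max /= orbT.
have MJ : 0 < fn (it A w n *m J).
  have uM := bnd_unit (bnd_it bA w n).
  rewrite fn_gt0; apply/eqP => MJ0; move: J0.
  by rewrite -(mulKmx uM J) MJ0 mulmx0 fn0 ltxx.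
have h2 : fn (it A w n *m J) <= (\dim V)%:R * expR (n%:R * (l + e)).
  apply: fn_le_cols => [|j]; first exact: expR_ge0.
  rewrite (_ : col j (it A w n *m J) = it A w n *m col j J); last by rewrite !colE mulmxA.
  rewrite col_basis_mx H2// /n !leq_max; apply/orP; right; apply/orP; right.
  exact: leq_bigmax.
have h3 : ln (fn (it A w n *m J)) <= ln (\dim V)%:R + n%:R * (l + e).
  rewrite -[X in _ + X]expRK -lnM ?posrE ?expR_gt0 ?ltr0n//.
  by rewrite ler_ln ?posrE// mulr_gt0 ?expR_gt0 ?ltr0n.
have := H1 n (leq_maxl _ _); rewrite ler_norml => /andP[h1 _].
have h4 : N3%:R * e <= n%:R * e.
  by rewrite ler_wpM2r ?(ltW e0)// ler_nat /n !leq_max leqnSn !orbT.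
have h5 : n%:R * (4 * e) = n%:R * (L - l) by rewrite /e; field.
have h6 : 0 < n%:R * e by rewrite mulr_gt0.
move: h1 h3 H3 h4 h5 h6; clearbody e n.
rewrite mulrBr mulrDr; move: (ln _) (ln _) => x y *; lra.
Qed.

End restriction.

(** * Distances between cocycles *)

Section total_variation_bound.
Context {R : realType} d (T : measurableType d).
Implicit Types (m : {finite_measure set T -> \bar R}) (f : T -> R).

Lemma bm_integrable_finite m f : bm f -> m.-integrable setT (EFin \o f).
Proof.
move=> [mf [C fC]]; apply: measurable_bounded_integrable => //.
  by rewrite ltey_eq fin_num_measure.
by exists C; split => //= y Cy x _; rewrite /= (le_trans (fC x))// ltW.
Qed.

Lemma norm_Rintegral_le m f (C : R) : bm f -> (forall x, `|f x| <= C) ->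
  `|\int[m]_x f x| <= C * fine (m setT).
Proof.
move=> bf fC;
rewrite ler_norml; apply/andP; split.
  rewrite -mulNr -Rintegral_cst//; apply: le_Rintegral => //.
  - by apply: bm_integrable_finite; exact: bm_cst.
  - exact: bm_integrable_finite.
  - by move=> x _; have := fC x; rewrite ler_norml => /andP[].
rewrite -Rintegral_cst//; apply: le_Rintegral => //.
- exact: bm_integrable_finite.
- by apply: bm_integrable_finite; exact: bm_cst.
- by move=> x _; have := fC x; rewrite ler_norml => /andP[].
Qed.

Lemma Rintegral_measure_add m m' f : bm f ->
  fine (\int[measure_add m m']_x (f x)%:E) = \int[m]_x f x + \int[m']_x f x.
Proof.
move=> bf; have i1 := bm_integrable_finite m bf; have i2 := bm_integrable_finite m' bf.
rewrite (integral_measure_add measurableT i1 i2).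
by rewrite fineD//; exact: integrable_fin_num.
Qed.

(** With the Jordan decomposition mu - nu = jp - jn, the positive measures mu + jn and nu + jp
    agree, so integrals against signed measures are avoided. *)
Lemma norm_ExB_le_dist_tv (mu nu : probability T R) f (C : R) : bm f -> (forall x, `|f x| <= C) ->
  `|Ex mu f - Ex nu f| <= C * dist_tv mu nu.
Proof.
move=> bf fC.
pose lam := cadd (charge_of_finite_measure mu) (copp (charge_of_finite_measure nu)).
(* [dist_tv] rests on a chosen Hahn decomposition; the estimate is proved for an arbitrary one. *)
suff key A B (h : hahn_decomposition lam A B) :
    `|Ex mu f - Ex nu f| <= C * fine (charge_variation h setT) by exact: key.
pose jp : {finite_measure set T -> \bar R} := jordan_pos h.
pose jn : {finite_measure set T -> \bar R} := jordan_neg h.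
have eqm E : measurable E -> (mu E + jn E = nu E + jp E)%E.
  move=> mE; have e0 : (mu E - nu E = jp E - jn E)%E.
    by have := jordan_decomp h mE; rewrite /cadd /= cscaleN1.
  have f1 := fin_num_measure mu _ mE; have f2 := fin_num_measure nu _ mE.
  have f3 := fin_num_measure jp _ mE; have f4 := fin_num_measure jn _ mE.
  move: e0; rewrite -(fineK f1) -(fineK f2) -(fineK f3) -(fineK f4) -!EFinN -!EFinD => -[e].
  by congr (_%:E); lra.
have E1 := Rintegral_measure_add mu jn bf; have E2 := Rintegral_measure_add nu jp bf.
have E3 : fine (\int[measure_add mu jn]_x (f x)%:E) = fine (\int[measure_add nu jp]_x (f x)%:E).
  congr fine; apply: eq_measure_integral => E mE _.
  by transitivity (mu E + jn E)%E; [exact: measure_addE|rewrite eqm//; symmetry; exact: measure_addE].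
have h1 := norm_Rintegral_le jp bf fC; have h2 := norm_Rintegral_le jn bf fC.
have -> : Ex mu f - Ex nu f = \int[jp]_x f x - \int[jn]_x f x.
  by move: E3; rewrite E1 E2 /Ex; lra.
apply: (le_trans (ler_normB _ _)).
rewrite /charge_variation fineD ?fin_num_measure//.
rewrite mulrDr; exact: lerD.
Qed.

Lemma dist_tv_ge0 (mu nu : probability T R) : 0 <= dist_tv mu nu.
Proof. by apply: fine_ge0; rewrite adde_ge0. Qed.

End total_variation_bound.

Section uniform_distance.
Context {R : realType} (d : nat) (Sigma : pmetricType R).
Hypothesis cptSigma : compact [set: Sigma].
Variables A B : GLmap d Sigma.

Lemma opnorm_le_dist_sup x : opnorm (A x - B x) <= dist_sup A B.
Proof.
have [k _ bk] := GLmap_bnd cptSigma A; have [l _ bl] := GLmap_bnd cptSigma B.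
apply: sup_upper_bound; last by exists x.
split; first by exists (opnorm (A x - B x)), x.
exists (d%:R * expR k + d%:R * expR l) => _ [y _ <-].
apply: opnorm_on_le => v _ v1; rewrite (le_trans (fn_mul _ _))//.
apply: (@le_trans _ _ (fn (A y - B y))); first by rewrite ler_piMr ?fn_ge0.
by rewrite (le_trans (fnB _ _))// lerD// bnd_fn_le.
Qed.

Lemma fn_le_dist_sup x : fn (A x - B x) <= d%:R * dist_sup A B.
Proof. by apply: (le_trans (fn_le_opnorm _)); rewrite ler_wpM2l// opnorm_le_dist_sup. Qed.

Lemma dist_sup_ge0 : 0 <= dist_sup A B.
Proof. exact: le_trans (opnorm_on_ge0 _ _) (opnorm_le_dist_sup point). Qed.

End uniform_distance.

(** * Contraction of angles *)

Section projective_distance.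
Context {R : realType} (d : nat).
Implicit Types (M N : 'M[R]_d) (v w y z : 'cV[R]_d).

(* The sine of the angle between the lines spanned by two nonzero vectors. *)
Definition pdist v w : R := wdg (row_mx v w) / (fn v * fn w).

Lemma pdist_ge0 v w : 0 <= pdist v w.
Proof. by rewrite divr_ge0 ?wdg_ge0 ?mulr_ge0 ?fn_ge0. Qed.

Lemma pdist_le1 v w : pdist v w <= 1.
Proof.
have [h|h] := eqVneq (fn v * fn w) 0; first by rewrite /pdist h invr0 mulr0.
have h0 : 0 < fn v * fn w by rewrite lt_def h mulr_ge0 ?fn_ge0.
by rewrite ler_pdivrMr// mul1r wdg_pair_le.
Qed.

Lemma pdist_mul k v w M : (2 <= d)%N -> v != 0 -> w != 0 -> bnd k M ->
  pdist (M *m v) (M *m w) <= expR (ln (wdg M) - lnv v M - lnv w M) * pdist v w.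
Proof.
move=> d2 v0 w0 bM.
have fv : 0 < fn v by rewrite fn_gt0.
have fw : 0 < fn w by rewrite fn_gt0.
have fMv : 0 < fn (M *m v) by rewrite fn_gt0 (bnd_neq0 bM).
have fMw : 0 < fn (M *m w) by rewrite fn_gt0 (bnd_neq0 bM).
have wM := bnd_wdg_gt0 d2 bM.
have -> : expR (ln (wdg M) - lnv v M - lnv w M) =
    wdg M * (fn v * fn w) / (fn (M *m v) * fn (M *m w)).
  rewrite /lnv !opprB !expRD !expRN !lnK ?posrE//; field.
  by rewrite !gt_eqF.
rewrite /pdist ler_pdivrMr ?mulr_gt0// (le_trans (wdg_pair_mul _ _ _))//.
rewrite le_eqVlt; apply/orP; left; apply/eqP; field.
by rewrite !gt_eqF.
Qed.

(** Squares of stretches are compared by [stretch_diff], which is linear in the sine of the angle;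
    the factor 2 cancels that of the squared logarithms. *)
Lemma lnv_pdist k v w M : v != 0 -> w != 0 -> bnd k M ->
  `|lnv v M - lnv w M| <= d%:R ^+ 2 * expR k ^+ 4 * pdist v w.
Proof.
suff H v' w' : v' != 0 -> w' != 0 -> bnd k M ->
    lnv v' M - lnv w' M <= d%:R ^+ 2 * expR k ^+ 4 * (wdg (row_mx v' w') / (fn v' * fn w')).
  move=> v0 w0 bM; rewrite ler_norml; apply/andP; split; last exact: H.
  rewrite lerNl opprB (le_trans (H _ _ w0 v0 bM))// ler_wpM2l//.
  rewrite /pdist [fn w * _]mulrC ler_wpM2r ?invr_ge0 ?mulr_ge0 ?fn_ge0//.
  rewrite -(@ler_pXn2r _ 2)// ?nnegrE ?wdg_ge0// !sqr_wdg !wdg2_pair.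
  rewrite (_ : fdot w v = fdot v w); last first.
    by apply: eq_bigr => i _; apply: eq_bigr => j _; rewrite mulrC.
  by rewrite [fn2 w * _]mulrC.
move=> v0 w0 bM.
have fv : 0 < fn v' by rewrite fn_gt0.
have fw : 0 < fn w' by rewrite fn_gt0.
have fMv : 0 < fn (M *m v') by rewrite fn_gt0 (bnd_neq0 bM).
have fMw : 0 < fn (M *m w') by rewrite fn_gt0 (bnd_neq0 bM).
pose a := (fn (M *m v') * fn w') ^+ 2; pose b := (fn v' * fn (M *m w')) ^+ 2.
have a0 : 0 < a by rewrite exprn_gt0// mulr_gt0.
have b0 : 0 < b by rewrite exprn_gt0// mulr_gt0.
have E : 2 * (lnv v' M - lnv w' M) = ln a - ln b.
  rewrite /a /b !lnXn ?mulr_gt0// !lnM ?posrE// /lnv; ring.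
have h1 := ln_ratio_le a0 b0.
have st := le_trans (ler_norm _) (stretch_diff M v' w').
have hb : expR (- k) * (fn v' * fn w') <= fn v' * fn (M *m w').
  by rewrite mulrCA ler_wpM2l ?fn_ge0//; have [] := bM w'.
have hb2 : (expR (- k) * (fn v' * fn w')) ^+ 2 <= b.
  by rewrite /b ler_pXn2r// nnegrE ?mulr_ge0 ?expR_ge0 ?fn_ge0.
have hM : fn2 M <= (d%:R * expR k) ^+ 2.
  by rewrite -sqr_fn ler_pXn2r ?nnegrE ?fn_ge0 ?mulr_ge0 ?expR_ge0// bnd_fn_le.
have fvw : 0 < fn v' * fn w' by rewrite mulr_gt0.
have w0' := wdg_ge0 (row_mx v' w').
have ab : a - b <= 2 * (d%:R * expR k) ^+ 2 * (fn v' * fn w') * wdg (row_mx v' w').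
  rewrite /a /b !exprMn !sqr_fn; apply: (le_trans st).
  by rewrite -exprMn !ler_wpM2r ?(ltW fvw)// ler_wpM2l.
have h2 : (a - b) / b <= 2 * (d%:R ^+ 2 * expR k ^+ 4 * (wdg (row_mx v' w') / (fn v' * fn w'))).
  rewrite ler_pdivrMr// (le_trans ab)//.
  apply: (@le_trans _ _ (2 * (d%:R ^+ 2 * expR k ^+ 4 * (wdg (row_mx v' w') / (fn v' * fn w'))) *
     (expR (- k) * (fn v' * fn w')) ^+ 2)).
    rewrite expRN le_eqVlt; apply/orP; left; apply/eqP; field.
    by rewrite !gt_eqF ?expR_gt0.
  rewrite ler_wpM2l// !mulr_ge0 ?exprn_ge0 ?expR_ge0 ?invr_ge0 ?mulr_ge0 ?fn_ge0//.
have := le_trans h1 h2; rewrite -E; lra.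
Qed.

Lemma lnv_perturb k v M N : v != 0 -> bnd k M -> bnd k N ->
  `|lnv v M - lnv v N| <= expR k * fn (M - N).
Proof.
move=> v0; suff H M' N' : bnd k M' -> bnd k N' -> lnv v M' - lnv v N' <= expR k * fn (M' - N').
  move=> bM bN; rewrite ler_norml; apply/andP; split; last exact: H.
  by rewrite lerNl opprB fnBC; exact: H.
move=> bM bN; have fv : 0 < fn v by rewrite fn_gt0.
have fMv : 0 < fn (M' *m v) by rewrite fn_gt0 (bnd_neq0 bM).
have fNv : 0 < fn (N' *m v) by rewrite fn_gt0 (bnd_neq0 bN).
have -> : lnv v M' - lnv v N' = ln (fn (M' *m v)) - ln (fn (N' *m v)) by rewrite /lnv; ring.
apply: (le_trans (ln_ratio_le fMv fNv)); rewrite ler_pdivrMr//.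
have h1 := le_trans (ler_norm _) (fn_dist (M' *m v) (N' *m v)).
apply: (le_trans h1); rewrite -mulmxBl (le_trans (fn_mul _ _))//.
have [h2 _] := bN v; rewrite expRN ler_pdivrMl ?expR_gt0// in h2.
by rewrite [expR k * _]mulrC -mulrA ler_wpM2l ?fn_ge0.
Qed.

(** With y = M v and z = N v, the wedge of y and z is that of y - z and z. *)
Lemma pdist_perturb k v M N : v != 0 -> bnd k M -> bnd k N ->
  pdist (M *m v) (N *m v) <= expR k * fn (M - N).
Proof.
move=> v0 bM bN; have fv : 0 < fn v by rewrite fn_gt0.
have fMv : 0 < fn (M *m v) by rewrite fn_gt0 (bnd_neq0 bM).
have fNv : 0 < fn (N *m v) by rewrite fn_gt0 (bnd_neq0 bN).
have h : wdg (row_mx (M *m v) (N *m v)) <= fn ((M - N) *m v) * fn (N *m v).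
  rewrite mulmxBl; apply: le_trans (wdg_pair_le _ _).
  rewrite -(@ler_pXn2r _ 2)// ?nnegrE ?wdg_ge0// !sqr_wdg !wdg2_pair.
  set y := M *m v; set z := N *m v.
  have e1 : fn2 (y - z) = fn2 y + fn2 z - 2 * fdot y z.
    rewrite fn2D -!sqr_fn fnN -[y in fdot y _]scale1r -[- z]scaleN1r fdotZ; ring.
  have e2 : fdot (y - z) z = fdot y z - fn2 z.
    rewrite /fdot /fn2 -sumrB; apply: eq_bigr => i _; rewrite -sumrB.
    by apply: eq_bigr => j _; rewrite !mxE; ring.
  by rewrite e1 e2 le_eqVlt; apply/orP; left; apply/eqP; ring.
rewrite /pdist ler_pdivrMr ?mulr_gt0// (le_trans h)//.
rewrite mulrA ler_wpM2r ?(ltW fNv)//.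
have [h2 _] := bM v; rewrite expRN ler_pdivrMl ?expR_gt0// in h2.
by rewrite (le_trans (fn_mul _ _))// [expR k * _]mulrC -mulrA ler_wpM2l ?fn_ge0.
Qed.

Lemma fn2_perturb p q (M N : 'M[R]_(p, q)) F : fn M <= F -> fn N <= F ->
  fn2 M - fn2 N <= fn (M - N) * (2 * F).
Proof.
move=> MF NF; rewrite -fdotBD (le_trans (ler_norm _))// (le_trans (fdot_le _ _))//.
rewrite ler_wpM2l ?fn_ge0// (le_trans (fnD _ _))//; lra.
Qed.

(** The exponent 7 is 3 + 4: [wdg2] is a polynomial of degree 4 in the entries, whose variation
    brings F^3, and division by its lower bound F^-4 brings the rest. *)
Lemma ln_wdg_perturb k M N : (2 <= d)%N -> bnd k M -> bnd k N ->
  `|ln (wdg M) - ln (wdg N)| <= 2 * (d%:R * expR k) ^+ 7 * fn (M - N).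
Proof.
move=> d2; suff H M' N' : bnd k M' -> bnd k N' ->
    ln (wdg M') - ln (wdg N') <= 2 * (d%:R * expR k) ^+ 7 * fn (M' - N').
  move=> bM bN; rewrite ler_norml; apply/andP; split; last exact: H.
  by rewrite lerNl opprB fnBC; exact: H.
move=> bM bN; have wM := bnd_wdg_gt0 d2 bM; have wN := bnd_wdg_gt0 d2 bN.
have MF := bnd_fn_le bM; have NF := bnd_fn_le bN; have wF := bnd_wdg_ge d2 bN.
have F0 : 0 < d%:R * expR k by rewrite mulr_gt0 ?expR_gt0// ltr0n (leq_trans _ d2).
move: (d%:R * expR k) MF NF wF F0 => F MF NF wF F0.
have e0 := fn_ge0 (M' - N').
have w2M : 0 < wdg2 M' by rewrite -sqr_wdg exprn_gt0.
have w2N : 0 < wdg2 N' by rewrite -sqr_wdg exprn_gt0.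
have E : 2 * (ln (wdg M') - ln (wdg N')) = ln (wdg2 M') - ln (wdg2 N').
  by rewrite -!sqr_wdg !lnXn//; ring.
have sqF (X : 'M[R]_d) : fn X <= F -> fn2 X <= F ^+ 2.
  by move=> XF; rewrite -sqr_fn ler_pXn2r ?nnegrE ?fn_ge0// ltW.
have trF (X : 'M[R]_d) : fn X <= F -> fn (X^T *m X) <= F ^+ 2.
  by move=> XF; rewrite (le_trans (fn_mul _ _))// fn_tr -expr2 sqr_fn sqF.
have h1 : fn2 M' ^+ 2 - fn2 N' ^+ 2 <= 4 * F ^+ 3 * fn (M' - N').
  have d1 : `|fn2 M' - fn2 N'| <= fn (M' - N') * (2 * F).
    rewrite ler_norml; apply/andP; split; last exact: fn2_perturb.
    by rewrite lerNl opprB fnBC; exact: fn2_perturb.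
  rewrite subr_sqr (le_trans (ler_norm _))// normrM.
  have -> : 4 * F ^+ 3 * fn (M' - N') = fn (M' - N') * (2 * F) * (2 * F ^+ 2) by ring.
  apply: ler_pM => //; rewrite ger0_norm ?addr_ge0 ?fn2_ge0//.
  by have := sqF _ MF; have := sqF _ NF; lra.
have h2 : fn2 (N'^T *m N') - fn2 (M'^T *m M') <= 4 * F ^+ 3 * fn (M' - N').
  apply: (le_trans (fn2_perturb (trF _ NF) (trF _ MF))).
  have -> : N'^T *m N' - M'^T *m M' = N'^T *m (N' - M') + (N' - M')^T *m M'.
    by rewrite mulmxBr linearB /= mulmxBl addrA subrK.
  have : fn (N'^T *m (N' - M') + (N' - M')^T *m M') <= 2 * F * fn (M' - N').
    rewrite (le_trans (fnD _ _))// fnBC.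
    have := fn_mul N'^T (N' - M'); have := fn_mul (N' - M')^T M'.
    rewrite !fn_tr [fn (N' - M')]fnBC.
    have := ler_wpM2l e0 MF; have := ler_wpM2r e0 NF; lra.
  have F20 : 0 <= 2 * F ^+ 2 by rewrite mulr_ge0// exprn_ge0// ltW.
  move=> /(ler_wpM2r F20) /le_trans; apply; rewrite le_eqVlt; apply/orP; left; apply/eqP; ring.
have h3 : wdg2 M' - wdg2 N' <= 4 * F ^+ 3 * fn (M' - N').
  by rewrite !wdg2E; lra.
have h4 : (F ^+ 4)^-1 <= wdg2 N'.
  rewrite -sqr_wdg (_ : (F ^+ 4)^-1 = ((F ^+ 2)^-1) ^+ 2); last by rewrite exprVn -exprM.
  by rewrite ler_pXn2r ?nnegrE ?wdg_ge0// invr_ge0 exprn_ge0// ltW.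
have h5 := ln_ratio_le w2M w2N.
have h6 : (wdg2 M' - wdg2 N') / wdg2 N' <= 4 * F ^+ 7 * fn (M' - N').
  rewrite ler_pdivrMr// (le_trans h3)//.
  have -> : 4 * F ^+ 3 * fn (M' - N') = 4 * F ^+ 7 * fn (M' - N') * (F ^+ 4)^-1.
    by field; rewrite gt_eqF.
  have F7 : 0 <= F ^+ 7 by rewrite exprn_ge0// ltW.
  by rewrite ler_wpM2l// mulr_ge0// mulr_ge0.
have := le_trans h5 h6; rewrite -E; lra.
Qed.

End projective_distance.

Section perturbed_expectations.
Context {R : realType} (d : nat) d0 (T : measurableType d0).
Variables (A : T -> 'M[R]_d) (mA : mxmeas A).
Variables (kappa : R) (kappa0 : 0 <= kappa) (bA : forall x, bnd kappa (A x)).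
Variables (mu : probability T R).
Local Notation Om := (prodT int T).
Variables (P : probability Om R) (PI : iid_law mu P).

Lemma norm_EE_le_EE n phi psi : nice phi -> nice psi ->
  (forall M, bnd (n%:R * kappa) M -> `|phi M| <= psi M) -> `|EE A P n phi| <= EE A P n psi.
Proof.
move=> nphi npsi h; rewrite ler_norml; apply/andP; split; last first.
  by apply: (le_EE mA bA) => // M /h; rewrite ler_norml => /andP[].
rewrite -[EE A P n psi]mul1r -mulNr -(EEZ mA bA)//; apply: (le_EE mA bA) => //.
  exact: niceZ.
by move=> M /h; rewrite ler_norml mulN1r => /andP[].
Qed.

(** The law is replaced one step at a time; each replacement costs at most [Z] times the
    distance. *)
Lemma EE_tv (nu : probability T R) (Q : probability Om R) (QI : iid_law nu Q) n phi (Z : R) :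
  nice phi -> (forall M, bnd (n%:R * kappa) M -> `|phi M| <= Z) ->
  `|EE A P n phi - EE A Q n phi| <= n%:R * Z * dist_tv mu nu.
Proof.
elim: n phi => [|n IH] phi nphi Zphi; first by rewrite !EE0 subrr normr0 !mul0r.
have nQ := nice_EE mA bA Q n nphi; have nP := nice_EE mA bA P n nphi.
rewrite -add1n (EE_comp mA bA PI)// (EE_comp mA bA QI)//.
set gP := (X in EE A P 1 X); set gQ := (X in EE A Q 1 X).
have -> : EE A P 1 gP - EE A Q 1 gQ = (EE A P 1 (fun M => gP M - gQ M)) + (EE A P 1 gQ - EE A Q 1 gQ).
  by rewrite (EEB mA bA)//; ring.
have SS M M' : bnd kappa M -> bnd (n%:R * kappa) M' -> `|phi (M' *m M)| <= Z.
  move=> bM bM'; apply: Zphi; rewrite -natr1 mulrDl mul1r; exact: bnd_mul.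
rewrite (le_trans (ler_normD _ _))// natrD !mulrDl addrC mul1r; apply: lerD.
  rewrite (EE1 mA bA PI)// (EE1 mA bA QI)//; apply: norm_ExB_le_dist_tv.
    exact: (nice_bm nQ mA bA).
  move=> x; apply: (norm_EE_le mA bA); first exact: (nice_mulr (bA x)).
  by move=> M' bM'; exact: SS.
apply: (norm_EE_le mA bA); first exact: niceB.
move=> M; rewrite mul1r => bM; apply: IH; first exact: (nice_mulr bM).
by move=> M' bM'; exact: SS.
Qed.

Variables (B : T -> 'M[R]_d) (mB : mxmeas B) (bB : forall x, bnd kappa (B x)).
Variable (D : R).
Hypothesis AB : forall x, fn (A x - B x) <= D.
Hypothesis dpos : (0 < d)%N.

Lemma it_perturb (w : Om) n : fn (it A w n - it B w n) <= n%:R * (d%:R * expR kappa) ^+ n * D.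
Proof.
have D0 : 0 <= D by exact: le_trans (fn_ge0 _) (AB (w 0)).
set F := d%:R * expR kappa.
have dF : d%:R <= F by rewrite /F ler_peMr// -expR0 ler_expR.
have eF : expR kappa <= F by rewrite /F ler_peMl ?expR_ge0// ler1n.
have F0 : 0 <= F by rewrite (le_trans _ dF).
elim: n => [|n IH] /=; first by rewrite subrr fn0 !mul0r.
have -> : A (w n) *m it A w n - B (w n) *m it B w n =
    A (w n) *m (it A w n - it B w n) + (A (w n) - B (w n)) *m it B w n.
  by rewrite mulmxBr mulmxBl addrA subrK.
rewrite (le_trans (fnD _ _))// -natr1 mulrDl mul1r mulrDl; apply: lerD.
  apply: (@le_trans _ _ (F * (n%:R * F ^+ n * D))); last first.
    by rewrite exprS le_eqVlt; apply/orP; left; apply/eqP; ring.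
  rewrite (le_trans (fn_mul _ _))//; apply: ler_pM; rewrite ?fn_ge0//.
  exact: bnd_fn_le.
rewrite (le_trans (fn_mul _ _))// mulrC; apply: ler_pM; rewrite ?fn_ge0//.
apply: (le_trans (bnd_fn_le (bnd_it bB w n))); rewrite exprS; apply: ler_pM => //.
by rewrite expRM_natl; apply: lerXn2r; rewrite ?nnegrE ?expR_ge0.
Qed.

Lemma EE_perturb n phi (L : R) : 0 <= L -> nice phi -> (forall M M', bnd (n%:R * kappa) M ->
    bnd (n%:R * kappa) M' -> `|phi M - phi M'| <= L * fn (M - M')) ->
  `|EE A P n phi - EE B P n phi| <= L * (n%:R * (d%:R * expR kappa) ^+ n * D).
Proof.
move=> L0 nphi Lphi; have bPA := bm_it mA bA n nphi; have bPB := bm_it mB bB n nphi.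
rewrite /EE -ExB//; apply: norm_Ex_le; first exact: bmB.
move=> w; apply: (le_trans (Lphi _ _ (bnd_it bA w n) (bnd_it bB w n))).
by rewrite ler_wpM2l// it_perturb.
Qed.

End perturbed_expectations.

(** * Hoelder continuity of the mean expansion, uniformly in time *)

Section hoelder_expansion.
Context {R : realType} (d : nat) d0 (T : measurableType d0).
Variables (A : T -> 'M[R]_d) (mA : mxmeas A).
Variables (kappa : R) (kappa0 : 0 <= kappa) (bA : forall x, bnd kappa (A x)).
Variables (mu : probability T R).
Local Notation Om := (prodT int T).
Variables (P : probability Om R) (PI : iid_law mu P).
Hypothesis d2 : (2 <= d)%N.
Local Notation a := (expansion A P).

(* Logarithm of the ratio of the first two singular values of [M], if [v] is
   a most expanded direction. *)
Definition pinch (v : 'cV[R]_d) (M : 'M[R]_d) : R := ln (wdg M) - 2 * lnv v M.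

Lemma nice_pinch v : v != 0 -> nice (pinch v).
Proof.
move=> v0; apply: niceB; first exact: nice_ln_wdg.
by apply: niceZ; exact: nice_lnv.
Qed.

Lemma pinch_bnd k v M : v != 0 -> bnd k M -> `|pinch v M| <= 2 * (ln d%:R + k) + 2 * k.
Proof.
move=> v0 bM; rewrite /pinch (le_trans (ler_normB _ _))// lerD//; first exact: ln_wdg_le.
by rewrite normrM ger0_norm// ler_wpM2l//; exact: lnv_bnd.
Qed.

Lemma expansion_pdist n v w : v != 0 -> w != 0 ->
  `|a n v - a n w| <= d%:R ^+ 2 * expR (n%:R * kappa) ^+ 4 * pdist v w.
Proof.
move=> v0 w0; rewrite /expansion -(EEB mA bA); last 2 first.
- exact: nice_lnv.
- exact: nice_lnv.
apply: (norm_EE_le mA bA); first by apply: niceB; exact: nice_lnv.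
by move=> M bM; exact: lnv_pdist.
Qed.

Lemma ler_powR_id (x al : R) : 0 <= x -> x <= 1 -> 0 < al -> al <= 1 -> x <= x `^ al.
Proof.
move=> x0 x1 al0 al1; move: x0; rewrite le_eqVlt => /orP[/eqP <-|x0].
  by rewrite powR_ge0.
by apply: ger1_powR => //; rewrite x0.
Qed.

Variables (m : nat) (al rho : R).
Hypotheses (m0 : (0 < m)%N) (al0 : 0 < al) (al1 : al <= 1) (rho0 : 0 <= rho) (rho1 : rho < 1).
Hypothesis pinched : forall v : 'cV[R]_d, v != 0 ->
  EE A P m (fun M => expR (al * pinch v M)) <= rho.

(** The solution H of H = C + H rho, with C the Lipschitz constant for times up to [m]. *)
Definition hoelder_cst : R := d%:R ^+ 2 * expR (m%:R * kappa) ^+ 4 / (1 - rho).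
Local Notation H := hoelder_cst.

Lemma hoelder_cst_ge0 : 0 <= H.
Proof.
by rewrite /hoelder_cst divr_ge0 ?mulr_ge0 ?exprn_ge0 ?expR_ge0// subr_ge0 ltW.
Qed.

(** The first [m] steps contribute the constant C; then the power [al] of the sine has shrunk by
    [rho] in mean, and induction bounds the rest by H rho. *)
Lemma expansion_hoelder n v w : v != 0 -> w != 0 ->
  `|a n v - a n w| <= H * pdist v w `^ al.
Proof.
have H0 := hoelder_cst_ge0.
pose C : R := d%:R ^+ 2 * expR (m%:R * kappa) ^+ 4.
have C0 : 0 <= C by rewrite mulr_ge0 ?exprn_ge0 ?expR_ge0.
have HC : H = C + H * rho by rewrite /hoelder_cst -/C; field; rewrite gt_eqF// subr_gt0.
have short j v' w' : (j <= m)%N -> v' != 0 -> w' != 0 ->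
    `|a j v' - a j w'| <= C * pdist v' w' `^ al.
  move=> jm v0 w0; rewrite (le_trans (expansion_pdist j v0 w0))//.
  apply: ler_pM; rewrite ?pdist_ge0//.
    rewrite /C ler_wpM2l ?exprn_ge0// ler_pXn2r ?nnegrE ?expR_ge0// ler_expR.
    by rewrite ler_wpM2r// ler_nat.
  by apply: ler_powR_id; rewrite ?pdist_ge0 ?pdist_le1.
elim/ltn_ind: n v w => n IH v w v0 w0.
have [nm|mn] := leqP n m.
  rewrite (le_trans (short n v w nm v0 w0))// ler_wpM2r ?powR_ge0//.
  by rewrite [leRHS]HC lerDl mulr_ge0.
have -> : n = (m + (n - m))%N by rewrite subnKC// ltnW.
rewrite !(expansion_add mA bA PI)//.
have nv := nice_expansion mA bA P (n - m) v0; have nw := nice_expansion mA bA P (n - m) w0.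
have -> (x y z t : R) : x + y - (z + t) = (x - z) + (y - t) by ring.
rewrite -(EEB mA bA)// (le_trans (ler_normD _ _))// [X in X * _]HC mulrDl.
apply: lerD; first exact: short.
pose psi v M := expR (al * pinch v M).
have npsi u : u != 0 -> nice (psi u).
  by move=> u0; apply: nice_exp; apply: niceZ; exact: nice_pinch.
pose c := H * pdist v w `^ al.
have c0 : 0 <= c by rewrite mulr_ge0 ?powR_ge0.
apply: (@le_trans _ _ (EE A P m (fun M => c * (2^-1 * (psi v M + psi w M))))); last first.
  rewrite (EEZ mA bA); last by apply: niceZ; apply: niceD; exact: npsi.
  rewrite (EEZ mA bA); last by apply: niceD; exact: npsi.
  rewrite (EED mA bA); [|exact: npsi|exact: npsi].
  have -> : H * rho * pdist v w `^ al = c * (2^-1 * (rho + rho)) by rewrite /c; field.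
  by rewrite ler_wpM2l// ler_wpM2l// lerD// pinched.
have nabs : nice (fun M => a (n - m) (M *m v) - a (n - m) (M *m w)) by exact: niceB.
have bd M : bnd (m%:R * kappa) M -> `|a (n - m) (M *m v) - a (n - m) (M *m w)| <=
    c * (2^-1 * (psi v M + psi w M)).
  move=> bM; have Mv := bnd_neq0 bM v0; have Mw := bnd_neq0 bM w0.
  have lt : (n - m < n)%N by rewrite ltn_subrL m0 (leq_trans m0)// ltnW.
  apply: (le_trans (IH (n - m)%N lt _ _ Mv Mw)).
  rewrite /c -mulrA ler_wpM2l//.
  have h := pdist_mul d2 v0 w0 bM.
  apply: (@le_trans _ _ ((expR (ln (wdg M) - lnv v M - lnv w M) * pdist v w) `^ al)).
    apply: ge0_ler_powR => //; first exact: ltW.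
      by rewrite nnegrE pdist_ge0.
    by rewrite nnegrE mulr_ge0 ?expR_ge0 ?pdist_ge0.
  rewrite powRM ?expR_ge0 ?pdist_ge0// mulrC ler_wpM2l ?powR_ge0// -expRM.
  (* [X Y <= (X ^ 2 + Y ^ 2) / 2] separates [v] from [w] *)
  pose X := expR (al * pinch v M / 2); pose Y := expR (al * pinch w M / 2).
  have -> : expR ((ln (wdg M) - lnv v M - lnv w M) * al) = X * Y.
    by rewrite /X /Y -expRD /pinch; congr expR; field.
  have -> : psi v M = X ^+ 2 by rewrite /X /psi -expRM_natl; congr expR; field.
  have -> : psi w M = Y ^+ 2 by rewrite /Y /psi -expRM_natl; congr expR; field.
  have := sqr_ge0 (X - Y); lra.
apply: (norm_EE_le_EE mA bA) => //.
by apply: niceZ; apply: niceZ; apply: niceD; exact: npsi.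
Qed.

End hoelder_expansion.

(** * Comparison of the mean expansions of two cocycles *)

Section comparison.
Context {R : realType} (d : nat) d0 (T : measurableType d0).
Variables (A B : T -> 'M[R]_d) (mA : mxmeas A) (mB : mxmeas B).
Variables (kappa : R) (kappa0 : 0 <= kappa).
Hypotheses (bA : forall x, bnd kappa (A x)) (bB : forall x, bnd kappa (B x)).
Variables (mu nu : probability T R).
Local Notation Om := (prodT int T).
Variables (P Q : probability Om R) (PI : iid_law mu P) (QI : iid_law nu Q).
Variables (al H D : R).
Hypotheses (al0 : 0 < al) (H0 : 0 <= H).
Hypothesis AB : forall x, fn (A x - B x) <= D.
Hypothesis hoelder : forall n (v w : 'cV[R]_d), v != 0 -> w != 0 ->
  `|expansion B Q n v - expansion B Q n w| <= H * pdist v w `^ al.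

(** One step is split off. The later steps differ by the induction hypothesis; the first one is
    changed in its matrix, then in its law, with the later expansion taken from the second cocycle,
    for which the Hoelder bound is assumed. *)
Lemma expansion_comparison n (v : 'cV[R]_d) : v != 0 ->
  `|expansion A P n v - expansion B Q n v| <=
  n%:R * (expR kappa * D + H * (expR kappa * D) `^ al + (kappa + H) * dist_tv mu nu).
Proof.
have D0 : 0 <= D by exact: le_trans (fn_ge0 _) (AB point).
set e1 := expR kappa * D + H * (expR kappa * D) `^ al; set e2 := (kappa + H) * _.
elim: n v => [|n IH] v v0.
  by rewrite /expansion !EE0 /lnv !mul1mx !subrr normr0 mul0r.
rewrite -add1n (expansion_add mA bA PI)// (expansion_add mB bB QI)//.
have nA := nice_expansion mA bA P n v0; have nB := nice_expansion mB bB Q n v0.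
have nl := nice_lnv v0.
rewrite {1 3}/expansion !(EE1 mA bA PI)// !(EE1 mB bB QI)//.
(* Subtracting the expansion of [v] cancels between the two laws and makes [g] bounded by
   [kappa + H] instead of a multiple of n; this keeps the cost of a step independent of n. *)
pose g M := lnv v M + (expansion B Q n (M *m v) - expansion B Q n v).
have ng : nice g.
  by apply: niceD; [exact: nl|apply: niceB; [exact: nB|exact: nice_cst]].
have b1 := nice_bm nl mA bA; have b2 := nice_bm nl mB bB.
have b3 := nice_bm nA mA bA; have b4 := nice_bm nB mB bB.
have b5 := nice_bm nB mA bA.
have b6 := nice_bm ng mA bA; have b7 := nice_bm ng mB bB.
have alg (x1 x2 x3 x4 x5 c y u1 u2 g6 g7 : R) : u1 = x2 - x5 -> u2 = g6 - y ->
    g6 = x1 + (x5 - c) -> g7 = x3 + (x4 - c) ->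
    x1 + x2 - (x3 + x4) = u1 + u2 + (y - g7) by move=> -> -> -> ->; ring.
have alg3 (u x w y z c : R) : u = x + w -> w = y - z -> z = c -> u = x + (y - c).
  by move=> -> -> ->.
have bc : bm (fun _ : T => expansion B Q n v) by exact: bm_cst.
have E6 : Ex mu (fun x => g (A x)) =
    Ex mu (fun x => lnv v (A x)) + (Ex mu (fun x => expansion B Q n (A x *m v)) - expansion B Q n v).
  exact: (alg3 _ _ _ _ _ _ (ExD mu b1 (bmB b5 bc)) (ExB mu b5 bc) (Ex_cst mu _)).
have E7 : Ex nu (fun x => g (B x)) =
    Ex nu (fun x => lnv v (B x)) + (Ex nu (fun x => expansion B Q n (B x *m v)) - expansion B Q n v).
  exact: (alg3 _ _ _ _ _ _ (ExD nu b2 (bmB b4 bc)) (ExB nu b4 bc) (Ex_cst nu _)).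
rewrite (alg _ _ _ _ _ _ _ _ _ _ _ (ExB mu b3 b5) (ExB mu b6 b7) E6 E7).
have -> : (1 + n)%:R * (e1 + e2) = n%:R * (e1 + e2) + e1 + e2 by rewrite natrD; ring.
apply: (le_trans (ler_normD _ _)); apply: lerD; last first.
  apply: norm_ExB_le_dist_tv => // x.
  rewrite /g (le_trans (ler_normD _ _))// lerD//; first exact: lnv_bnd.
  rewrite (le_trans (hoelder n (bnd_neq0 (bB x) v0) v0))// ler_piMr//.
  have p1 : 1 = 1 `^ al :> R by rewrite powR1.
  rewrite [leRHS]p1; apply: ge0_ler_powR; rewrite ?nnegrE ?pdist_ge0 ?pdist_le1//.
  exact: ltW.
rewrite (le_trans (ler_normD _ _))//; apply: lerD.
  by apply: norm_Ex_le; [exact: bmB|move=> x; apply: IH; exact: bnd_neq0 (bA x) v0].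
apply: norm_Ex_le; first exact: bmB.
move=> x; rewrite /g.
have alg' (x1 x2 x3 x4 c : R) : x1 + (x2 - c) - (x3 + (x4 - c)) = (x1 - x3) + (x2 - x4) by ring.
rewrite alg'.
have kD : expR kappa * fn (A x - B x) <= expR kappa * D by rewrite ler_wpM2l ?expR_ge0.
rewrite (le_trans (ler_normD _ _))//; apply: lerD.
  exact: le_trans (lnv_perturb v0 (bA x) (bB x)) kD.
rewrite (le_trans (hoelder n (bnd_neq0 (bA x) v0) (bnd_neq0 (bB x) v0)))// ler_wpM2l//.
have h := le_trans (pdist_perturb v0 (bA x) (bB x)) kD.
apply: ge0_ler_powR => //; first exact: ltW.
  by rewrite nnegrE pdist_ge0.
by rewrite nnegrE mulr_ge0 ?expR_ge0.
Qed.

End comparison.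

(** * Local uniformity over the set of cocycles *)

Section expansion_of_cocycles.
Context {R : realType} (d : nat) (Sigma : pmetricType R).
Hypothesis cptSigma : compact [set: Sigma].
Hypothesis d2 : (2 <= d)%N.
Let dpos : (0 < d)%N. Proof. exact: leq_trans d2. Qed.

Section one_cocycle.
Variables (A : GLmap d Sigma) (mu : probability (borel Sigma) R).
Local Notation Om := (prodT int (borel Sigma)).
Local Notation P := (product_measure mu : probability Om R).
Local Notation A' := (A : borel Sigma -> 'M[R]_d).
Local Notation g1 := (rate1 A' P).
Local Notation g2 := (rate2 A' P).
Let mA : mxmeas A' := GLmap_mxmeas A.
Let PI : iid_law mu P := product_measure_iid mu.
Hypothesis cA : frakC (A, mu).

Lemma rate_gap : g2 < 2 * g1.
Proof.
have [_] := cA; rewrite (lyapunov1E cptSigma d2) (lyapunov2E cptSigma d2).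
by rewrite ltrBlDr -mulr2n mulr_natl.
Qed.

(** The exponent on [V] is identified with the rate of the matrices in coordinates, and slow vectors
    bound that rate. *)
Lemma lyapunov_on_le (V : {vspace 'cV[R]_d}) : V != 0%VS ->
  {ae mu, forall x, (linfun (mulmx (A' x)) @: V)%VS = V} ->
  (forall v, v \in V -> {ae P, forall w, slow A' (g2 - g1) w v}) ->
  lyapunov_on (A, mu) V <= g2 - g1.
Proof.
move=> V0 AV sV; have [k k0 bk] := GLmap_bnd cptSigma A.
have bk' : forall x : borel Sigma, bnd k (A' x) by [].
have [L hL] := restriction_rate mA k0 bk' PI V0 AV.
suff -> : lyapunov_on (A, mu) V = L.
  apply: (@restriction_rate_le R d _ (borel Sigma) A' k bk' P V V0 (g2 - g1) L).
    exact: sV.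
  exact: hL.
apply: xget_limit; apply: (ae_and hL hL) => w hw _.
apply: (cvg_rate (C := `|ln (fn (coord_mx V))| + `|ln (fn (basis_mx V))|) hw) => n.
rewrite iterate_it; apply: ln_opnorm_on => //.
exact: (bnd_unit (@bnd_it R d _ (borel Sigma) A' k bk w n)).
Qed.

(** Otherwise the slow subspace would be proper, invariant and of exponent at most L_2, which
    quasi-irreducibility excludes. *)
Lemma frakC_expands e : 0 < e -> expands_by A' P (g1 - e).
Proof.
have [k k0 bk] := GLmap_bnd cptSigma A.
apply: contrapT => /not_implyP[e0 ne].
have [|V [V0 Vf AV sV]] := slow_subspace_exists mA k0 bk PI d2 rate_gap.
  by move=> h; apply: ne; exact: h.
have [qi _] := cA; apply: qi; exists V; split => //.
by rewrite (lyapunov2E cptSigma d2); exact: lyapunov_on_le.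
Qed.

Lemma expansion_le_rate n (v : 'cV[R]_d) : v != 0 -> expansion A' P n v <= EE A' P n (fun M => ln (fn M)).
Proof.
move=> v0; have [k k0 bk] := GLmap_bnd cptSigma A.
apply: (le_EE mA bk).
- exact: nice_lnv.
- exact: nice_ln_fn.
move=> M bM; have fM : 0 < fn M by exact: lt_le_trans (expR_gt0 _) (bnd_fn_ge dpos bM).
have fv : 0 < fn v by rewrite fn_gt0.
have fMv : 0 < fn (M *m v) by rewrite fn_gt0 (bnd_neq0 bM).
by rewrite /lnv lerBlDr -lnM ?posrE// ler_ln ?posrE ?mulr_gt0// fn_mul.
Qed.

Lemma expansion_rate e : 0 < e -> exists N, forall n, (N <= n)%N ->
  forall v : 'cV[R]_d, v != 0 -> `|expansion A' P n v - n%:R * g1| <= n%:R * e.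
Proof.
move=> e0; have [k k0 bk] := GLmap_bnd cptSigma A.
have [N1 H1] := frakC_expands e0.
have [N2 H2] := rate1_upper mA k0 bk PI dpos e0.
exists (maxn N1 N2) => n; rewrite geq_max => /andP[n1 n2] v v0.
have h1 := H1 n n1 v v0; have h2 := le_trans (expansion_le_rate n v0) (H2 n n2).
rewrite mulrBr in h1; rewrite mulrDr in h2.
by rewrite ler_distl; apply/andP.
Qed.

(** A crude bound that settles pairs of cocycles at distance at least 1. *)
Lemma rate_le_bound kappa : (forall x, bnd kappa (A x)) -> `|g1| <= kappa.
Proof.
move=> bA; apply/ler_addgt0Pr => e e0; have [N HN] := expansion_rate e0.
pose v : 'cV[R]_d := delta_mx (Ordinal dpos) 0.
have v0 : v != 0 by rewrite -fn_gt0 fn_delta.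
have h1 := HN N.+1 (leqnSn N) v v0.
have h2 := expansion_bound mA (bA : forall x : borel Sigma, bnd kappa (A' x)) P N.+1 v0.
have n0 : 0 < N.+1%:R :> R by [].
rewrite -(ler_pM2l n0) -{1}[N.+1%:R]gtr0_norm// -normrM mulrDr.
rewrite -[X in `|X|](subrK (expansion A' P N.+1 v)) (le_trans (ler_normD _ _))//.
by rewrite addrC distrC; apply: lerD.
Qed.

End one_cocycle.

Lemma rate_comparison (A B : GLmap d Sigma) (mu nu : probability (borel Sigma) R) eps :
  frakC (A, mu) -> frakC (B, nu) ->
  (forall n (v : 'cV[R]_d), v != 0 ->
    `|expansion (A : borel Sigma -> 'M[R]_d) (product_measure mu) n v -
      expansion (B : borel Sigma -> 'M[R]_d) (product_measure nu) n v| <= n%:R * eps) ->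
  `|lyapunov (A, mu) 1 - lyapunov (B, nu) 1| <= eps.
Proof.
move=> cA cB h; rewrite !(lyapunov1E cptSigma d2).
apply/ler_addgt0Pr => e e0; have e20 : 0 < e / 2 by rewrite divr_gt0.
have [N1 H1] := expansion_rate cA e20; have [N2 H2] := expansion_rate cB e20.
pose n := (maxn N1 N2).+1.
pose v : 'cV[R]_d := delta_mx (Ordinal dpos) 0.
have v0 : v != 0 by rewrite -fn_gt0 fn_delta.
have h1 := H1 n (leqW (leq_maxl _ _)) v v0; have h2 := H2 n (leqW (leq_maxr _ _)) v v0.
have h3 := h n v v0; have n0 : 0 < n%:R :> R by [].
move: h1 h2 h3; move: (rate1 _ _) (rate1 _ _) (expansion _ _ _ _) (expansion _ _ _ _) => x y a b.
rewrite !ler_distl => /andP[a1 a2] /andP[b1 b2] /andP[c1 c2].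
suff : n%:R * x <= n%:R * (y + (eps + e)) /\ n%:R * y <= n%:R * (x + (eps + e)).
  by rewrite !ler_pM2l// => -[u1 u2]; apply/andP; split; lra.
have -> : n%:R * (y + (eps + e)) = n%:R * y + n%:R * eps + n%:R * (e / 2) + n%:R * (e / 2) by field.
have -> : n%:R * (x + (eps + e)) = n%:R * x + n%:R * eps + n%:R * (e / 2) + n%:R * (e / 2) by field.
split; lra.
Qed.

Lemma pinch_perturb k (v : 'cV[R]_d) M N : v != 0 -> bnd k M -> bnd k N ->
  `|pinch v M - pinch v N| <= (2 * (d%:R * expR k) ^+ 7 + 2 * expR k) * fn (M - N).
Proof.
move=> v0 bM bN; rewrite /pinch.
have -> : ln (wdg M) - 2 * lnv v M - (ln (wdg N) - 2 * lnv v N) =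
  (ln (wdg M) - ln (wdg N)) - 2 * (lnv v M - lnv v N) by ring.
apply: (le_trans (ler_normB _ _)); rewrite [leRHS]mulrDl; apply: lerD; first exact: ln_wdg_perturb.
by rewrite normrM ger0_norm// -mulrA ler_wpM2l//; exact: lnv_perturb.
Qed.

Lemma pinched_time (A : GLmap d Sigma) (mu : probability (borel Sigma) R) : frakC (A, mu) ->
  exists2 m, (0 < m)%N & forall v : 'cV[R]_d, v != 0 ->
    EE (A : borel Sigma -> 'M[R]_d) (product_measure mu) m (pinch v) <= - 1.
Proof.
have alg (x y g1 g2 c : R) : 1 <= c * ((2 * g1 - g2) / 2) ->
    c * (g1 - (2 * g1 - g2) / 6) <= y -> x <= c * (g2 + (2 * g1 - g2) / 6) -> x - 2 * y <= -1.
  have -> : c * (g1 - (2 * g1 - g2) / 6) = c * g1 - c * ((2 * g1 - g2) / 2) / 3 by field.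
  have -> : c * (g2 + (2 * g1 - g2) / 6) = c * g2 + c * ((2 * g1 - g2) / 2) / 3 by field.
  have : c * ((2 * g1 - g2) / 2) = c * g1 - c * g2 / 2 by field.
  move: (c * ((2 * g1 - g2) / 2)) (c * g1) (c * g2) => z u w; lra.
move=> cA; have [k k0 bk] := GLmap_bnd cptSigma A.
have mA := GLmap_mxmeas A; have PI := product_measure_iid mu.
pose th := 2 * rate1 (A : borel Sigma -> 'M[R]_d) (product_measure mu) -
  rate2 (A : borel Sigma -> 'M[R]_d) (product_measure mu).
have th0 : 0 < th by rewrite subr_gt0; exact: rate_gap.
(* The error th / 6 occurs once for the wedge and twice for the expansion; half of the gap remains,
   and m th / 2 >= 1. *)
have e0 : 0 < th / 6 by rewrite divr_gt0.
have [N1 H1] := frakC_expands cA e0.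
have [N2 H2] := rate2_upper mA k0 bk PI d2 e0.
have [N3 H3] := archimedean_mul 1 (divr_gt0 th0 (ltr0n R 2)).
pose m := (maxn N1 (maxn N2 N3)).+1; exists m => // v v0.
have m1 : (N1 <= m)%N by rewrite /m leqW// leq_maxl.
have m2 : (N2 <= m)%N by rewrite /m leqW// !leq_max leqnn orbT.
have m3 : (N3 <= m)%N by rewrite /m leqW// !leq_max leqnn !orbT.
have h1 := H1 m m1 v v0; have h2 := H2 m m2.
have h3 : N3%:R * (th / 2) <= m%:R * (th / 2) by rewrite ler_wpM2r ?ler_nat// ltW// divr_gt0.
have nl := nice_lnv v0.
have n1 := nice_ln_wdg (R := R) d2; have n2 := niceZ 2 nl.
have E : EE (A : borel Sigma -> 'M[R]_d) (product_measure mu) m (pinch v) =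
    EE (A : borel Sigma -> 'M[R]_d) (product_measure mu) m (fun M => ln (wdg M)) -
    2 * expansion (A : borel Sigma -> 'M[R]_d) (product_measure mu) m v.
  have e1 := EEB mA bk (product_measure mu) m n1 n2.
  have e2 := EEZ mA bk (product_measure mu) m 2 nl.
  exact: (eq_trans e1 (congr1 (fun z => _ - z) e2)).
rewrite E; exact: alg (le_trans H3 h3) h1 h2.
Qed.

(** The bound -1 on the mean of [pinch] concerns one fixed time, so it moves little with the
    cocycle: changes of matrices and of law cost 1/4 each, and -1/2 is left for a single exponent
    [al] on the whole neighbourhood. *)
Lemma uniform_hoelder (A0 : GLmap d Sigma) (mu0 : probability (borel Sigma) R) : frakC (A0, mu0) ->
  exists r kappa H al, [/\ 0 < r, 0 <= kappa /\ 0 <= H, 0 < al /\ al <= 1 &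
    forall (A : GLmap d Sigma) (mu : probability (borel Sigma) R),
    dist_sup A A0 < r -> dist_tv mu mu0 < r -> (forall x, bnd kappa (A x)) /\
    forall n (v w : 'cV[R]_d), v != 0 -> w != 0 ->
      `|expansion (A : borel Sigma -> 'M[R]_d) (product_measure mu) n v -
        expansion (A : borel Sigma -> 'M[R]_d) (product_measure mu) n w| <= H * pdist v w `^ al].
Proof.
move=> c0; have [k0 k00 bA0] := GLmap_bnd cptSigma A0.
have [m m0 Hm] := pinched_time c0.
pose kappa := k0 + 1; have kappa0 : 0 <= kappa by rewrite addr_ge0.
pose F := d%:R * expR kappa; pose F' := d%:R * expR (m%:R * kappa).
have F0 : 0 <= F by rewrite mulr_ge0 ?expR_ge0.
have F'0 : 0 <= F' by rewrite mulr_ge0 ?expR_ge0.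
pose L := 2 * F' ^+ 7 + 2 * expR (m%:R * kappa).
have L0 : 0 <= L by rewrite addr_ge0 ?mulr_ge0 ?exprn_ge0 ?expR_ge0.
pose Z := 2 * (ln d%:R + m%:R * kappa) + 2 * (m%:R * kappa) + 1.
have lnd : 0 <= ln (d%:R : R) by rewrite ln_ge0// ler1n.
have mk0 : 0 <= m%:R * kappa by rewrite mulr_ge0.
have Z0 : 0 < Z by rewrite /Z ltr_wpDl// addr_ge0// mulr_ge0// addr_ge0.
have half0 : 0 < 2^-1 :> R by rewrite invr_gt0.
have [al [al0 al1 Hal]] := exponential_moment Z0 half0.
pose rho := expR (- (al * 2^-1 / 2)) : R.
have rho1 : rho < 1.
  by rewrite -[ltRHS]expR0 ltr_expR oppr_lt0 divr_gt0// mulr_gt0.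
(* [K1] keeps A within the distortion [kappa] = k0 + 1; [K2] and [K3] keep the two changes of the
   mean of [pinch] below 1/4. The radius is the inverse of a number that dominates all three. *)
pose K1 := d%:R * (2 * expR k0); pose K2 := 4 * (L * (m%:R * F ^+ m * d%:R)); pose K3 := 4 * (m%:R * Z).
have K10 : 0 <= K1 by rewrite !mulr_ge0 ?expR_ge0.
have K20 : 0 <= K2.
  by apply: mulr_ge0 => //; apply: mulr_ge0 => //; apply: mulr_ge0 => //; rewrite mulr_ge0 ?exprn_ge0.
have K30 : 0 <= K3 by apply: mulr_ge0 => //; apply: mulr_ge0 => //; exact: ltW.
pose S := K1 + K2 + K3 + 1; have S0 : 0 < S by rewrite ltr_wpDl// !addr_ge0.
have Sle K : 0 <= K -> K <= S -> forall t, t < S^-1 -> K * t <= 1.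
  move=> K0 KS t tS; have : K * t <= K * S^-1 by rewrite ler_wpM2l// ltW.
  by move=> /le_trans; apply; rewrite ler_pdivrMr// mul1r.
exists S^-1, kappa, (hoelder_cst d kappa m rho), al; split.
- by rewrite invr_gt0.
- split => //; apply: hoelder_cst_ge0 => //; exact: expR_ge0.
- by [].
move=> A mu dA dmu.
have t1 : K1 * dist_sup A A0 <= 1 by apply: Sle dA => //; rewrite /S; lra.
have t2 : K2 * dist_sup A A0 <= 1 by apply: Sle dA => //; rewrite /S; lra.
have t3 : K3 * dist_tv mu mu0 <= 1 by apply: Sle dmu => //; rewrite /S; lra.
have AA0 x := fn_le_dist_sup cptSigma A A0 x.
have bA x : bnd kappa (A x).
  apply: (bnd_perturb k00 (bA0 x)); apply: (le_trans (AA0 x)).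
  rewrite expRN -invfM -[leRHS]mul1r ler_pdivlMr ?mulr_gt0 ?expR_gt0//.
  by apply: le_trans t1; rewrite /K1 le_eqVlt; apply/orP; left; apply/eqP; ring.
have bA0' x : bnd kappa (A0 x) by apply: bnd_weak (bA0 x); rewrite lerDl.
split => // n v w v0 w0.
have mA := GLmap_mxmeas A; have mA0 := GLmap_mxmeas A0.
have PI := product_measure_iid mu; have P0I := product_measure_iid mu0.
apply: (expansion_hoelder mA kappa0 bA PI d2 m0 al0 al1 (expR_ge0 _) rho1) => // u u0.
have nu := nice_pinch d2 u0.
have HH := Hal _ _ (product_measure mu : probability (prodT int (borel Sigma)) R)
  (fun w => pinch u (it (A : borel Sigma -> 'M[R]_d) w m)).
rewrite /EE; apply: HH.
- exact: (bm_it mA bA m nu).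
- move=> w'; have := pinch_bnd d2 u0 (@bnd_it R d _ (borel Sigma) (A : borel Sigma -> 'M[R]_d) kappa bA w' m).
  by move/le_trans; apply; rewrite /Z lerDl.
have h1 := EE_perturb mA kappa0 bA (product_measure mu) mA0 bA0' AA0 dpos L0 nu
  (fun M N bM bN => pinch_perturb u0 bM bN).
have h2 := EE_tv mA0 bA0' PI P0I (n := m) nu (fun M bM => pinch_bnd d2 u0 bM).
have h3 := Hm u u0.
have h4 : L * (m%:R * (d%:R * expR kappa) ^+ m * (d%:R * dist_sup A A0)) <= 4^-1.
  rewrite -[4^-1]mul1r ler_pdivlMr// (le_trans _ t2)// /K2 le_eqVlt.
  by apply/orP; left; apply/eqP; rewrite /F; ring.
have h5 : m%:R * (2 * (ln d%:R + m%:R * kappa) + 2 * (m%:R * kappa)) * dist_tv mu mu0 <= 4^-1.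
  have hZ : m%:R * (2 * (ln d%:R + m%:R * kappa) + 2 * (m%:R * kappa)) <= m%:R * Z.
    by rewrite ler_wpM2l// /Z lerDl.
  rewrite (le_trans (ler_wpM2r (dist_tv_ge0 mu mu0) hZ))//.
  by rewrite -[4^-1]mul1r ler_pdivlMr// mulrC mulrA.
have h6 := le_trans (ler_norm _) (le_trans h1 h4).
have h7 := le_trans (ler_norm _) (le_trans h2 h5).
rewrite -[X in X <= _]/(EE (A : borel Sigma -> 'M[R]_d) (product_measure mu) m (pinch u)).
move: h3 h6 h7; move: (EE _ _ _ _) (EE _ _ _ _) (EE _ _ _ _) => x y z; lra.
Qed.

End expansion_of_cocycles.

Theorem theorem1 (R : realType) (d : nat) (hd : (2 <= d)%N)
    (Sigma : pmetricType R) (cptSigma : compact [set: Sigma]) :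
  (forall c0 : cocycle d Sigma, frakC c0 ->
    exists U : set (cocycle d Sigma), frakC_nbhs c0 U /\
    exists C alpha : R, [/\ 0 < C, 0 < alpha, alpha <= 1 &
      forall (A B : GLmap d Sigma) (mu nu : probability (borel Sigma) R),
        U (A, mu) -> U (B, nu) ->
        `|lyapunov (A, mu) 1 - lyapunov (B, nu) 1| <=
          C * (dist_sup A B + dist_tv mu nu) `^ alpha])
  /\
  (forall c0 : cocycle d Sigma, frakC c0 ->
    exists U : set (cocycle d Sigma), frakC_nbhs c0 U /\
    exists2 C : R, 0 < C &
      forall (A : GLmap d Sigma) (mu1 mu2 : probability (borel Sigma) R),
        U (A, mu1) -> U (A, mu2) ->
        `|lyapunov (A, mu1) 1 - lyapunov (A, mu2) 1| <= C * dist_tv mu1 mu2).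
Proof.
have dpos : (0 < d)%N by exact: leq_trans hd.
pose nb r (c0 : cocycle d Sigma) := [set c : cocycle d Sigma |
  [/\ frakC c, dist_sup c.1 c0.1 < r & dist_tv c.2 c0.2 < r]].
have nbP r c0 : 0 < r -> frakC_nbhs c0 (nb r c0).
  by move=> r0; split; [move=> c []|exists r].
split=> -[A0 mu0] c0; have [r [kappa [H [al [r0 [kappa0 H0] [al0 al1] loc]]]]] :=
  uniform_hoelder cptSigma hd c0; exists (nb r (A0, mu0)); split; do ?exact: nbP.
  pose k1 := expR kappa * d%:R.
  have k10 : 0 <= k1 by rewrite mulr_ge0 ?expR_ge0.
  pose C := 2 * kappa + (k1 + H * k1 `^ al + (kappa + H)) + 1.
  have Hk : 0 <= H * k1 `^ al by rewrite mulr_ge0 ?powR_ge0.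
  have C2 : 2 * kappa <= C by rewrite /C; lra.
  have C0 : 0 < C by rewrite /C; lra.
  exists C, al; split => //.
  move=> A B mu nu [cA dA mA] [cB dB mB].
  have [bA hA] := loc A mu dA mA; have [bB hB] := loc B nu dB mB.
  have s1 := dist_sup_ge0 cptSigma A B; have s2 := dist_tv_ge0 mu nu.
  set s := dist_sup A B + dist_tv mu nu.
  have s0 : 0 <= s by rewrite addr_ge0.
  (* At distance at least 1 the term 2 [kappa] of [C] suffices; below 1, the linear terms are
     absorbed since s <= s^al. *)
  have [s_ge1|s_lt1] := leP 1 s.
    have LA := rate_le_bound cptSigma hd cA bA; have LB := rate_le_bound cptSigma hd cB bB.
    rewrite !(lyapunov1E cptSigma hd) (le_trans (ler_normB _ _))//.
    have p1 : 1 = 1 `^ al :> R by rewrite powR1.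
    have h1 : 1 <= s `^ al.
      by rewrite p1; apply: ge0_ler_powR; rewrite ?nnegrE// ltW.
    apply: (@le_trans _ _ (C * 1)); last by rewrite ler_wpM2l// ltW.
    by rewrite mulr1 (le_trans (lerD LA LB))// (le_trans _ C2)// mulr_natl mulr2n.
  have s_al : s <= s `^ al by apply: ler_powR_id => //; exact: ltW.
  have AB x := fn_le_dist_sup cptSigma A B x.
  apply: (@le_trans _ _ (expR kappa * (d%:R * dist_sup A B) +
      H * (expR kappa * (d%:R * dist_sup A B)) `^ al + (kappa + H) * dist_tv mu nu)).
    apply: (rate_comparison cptSigma hd cA cB) => n v v0.
    exact: (expansion_comparison (GLmap_mxmeas A) (GLmap_mxmeas B) bA bB
      (product_measure_iid mu) (product_measure_iid nu) al0 H0 AB hB n v0).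
  have e1 : expR kappa * (d%:R * dist_sup A B) <= k1 * s.
    by rewrite mulrA ler_wpM2l// lerDl.
  have e10 : 0 <= expR kappa * (d%:R * dist_sup A B) by rewrite !mulr_ge0 ?expR_ge0.
  have e2 : (expR kappa * (d%:R * dist_sup A B)) `^ al <= k1 `^ al * s `^ al.
    rewrite -powRM//; apply: ge0_ler_powR; rewrite ?nnegrE ?mulr_ge0//; first exact: ltW.
  have e3 : k1 * s <= k1 * s `^ al by rewrite ler_wpM2l.
  have e4 : (kappa + H) * dist_tv mu nu <= (kappa + H) * s `^ al.
    by rewrite ler_wpM2l ?addr_ge0// (le_trans _ s_al)// lerDr.
  have e5 := ler_wpM2l H0 e2.
  have e6 : 0 <= (2 * kappa + 1) * s `^ al by rewrite mulr_ge0 ?powR_ge0// addr_ge0// mulr_ge0.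
  have -> : C * s `^ al = (2 * kappa + 1) * s `^ al + k1 * s `^ al +
      H * (k1 `^ al * s `^ al) + (kappa + H) * s `^ al by rewrite /C; ring.
  move: e1 e2 e3 e4 e5 e6; lra.
exists (kappa + H + 1); first by rewrite ltr_wpDl// addr_ge0.
move=> A mu1 mu2 [cA dA m1] [cB dB m2].
have [bA hA] := loc A mu1 dA m1; have [bB hB] := loc A mu2 dB m2.
apply: (@le_trans _ _ ((kappa + H) * dist_tv mu1 mu2)); last first.
  by rewrite ler_wpM2r ?dist_tv_ge0// lerDl.
apply: (rate_comparison cptSigma hd cA cB) => n v v0.
(* With equal matrices the Hoelder term is a positive power of 0, so only the linear term in the
   total variation distance is left. *)
have AA x : fn (A x - A x) <= 0 by rewrite subrr fn0.
have := expansion_comparison (GLmap_mxmeas A) (GLmap_mxmeas A) bA bB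
  (product_measure_iid mu1) (product_measure_iid mu2) al0 H0 AA hB n v0.
by rewrite mulr0 powR0 ?gt_eqF// mulr0 !add0r.
Qed.
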